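(* Let $d\ge 1$, $D=\{1,\dots,d\}$, let $B\subset D$ be nonempty, and let $B'=D\setminus B$. If $f\in L\log^{|B|}L(\mathbb{T}^d)$, then $$\left\| \left(L_{n_B}\circ R_{n_{B'}}\right)(f)-f\right\|_{L_1(\mathbb{T}^d)}\to 0\quad\text{as } n_i\to\infty \text{ for all } i\in D$$ (that is, as $\min_{i\in D}n_i\to\infty$).
   Context: $\mathbb{T}^d=[-\pi,\pi)^d$ with Lebesgue measure; functions on $\mathbb{T}^d$ are measurable and are regarded as $2\pi$-periodic in each variable. $\|f\|_{L_1(\mathbb{T}^d)}=\int_{\mathbb{T}^d}|f|$. $|B|$ is the number of elements of $B$. Fourier coefficients and rectangular partial sums: for $f\in L_1(\mathbb{T}^d)$, $$\widehat f(k_1,\dots,k_d)=\frac1{(2\pi)^d}\int_{\mathbb{T}^d}f(\mathbf{x})e^{-i(k_1x_1+\cdots+k_dx_d)}\,d\mathbf{x},$$ $$S_{N_1,\dots,N_d}(f;\mathbf{x})=\sum_{k_1=-N_1}^{N_1}\cdots\sum_{k_d=-N_d}^{N_d}\widehat f(k_1,\dots,k_d)e^{i(k_1x_1+\cdots+k_dx_d)}.$$ Mixed logarithmic means: let $l_n=\sum_{k=0}^n\frac1{k+1}$. For natural numbers $n_1,\dots,n_d$, $$\left(L_{n_B}\circ R_{n_{B'}}\right)(f;\mathbf{x})=\frac1{\prod_{j\in D}l_{n_j}}\sum_{i_1=0}^{n_1}\cdots\sum_{i_d=0}^{n_d}\frac{S_{m_1,\dots,m_d}(f;\mathbf{x})}{\prod_{j\in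 D}(i_j+1)},\qquad m_j=\begin{cases}n_j-i_j,& j\in B,\\ i_j,& j\in B'.\end{cases}$$ (That is, Nörlund logarithmic means in the variables indexed by $B$ and Riesz logarithmic means in the variables indexed by $B'$.) Orlicz spaces: a Young function $Q$ is a convex continuous even function with $Q(0)=0$, $\lim_{u\to+\infty}Q(u)/u=+\infty$, $\lim_{u\to0}Q(u)/u=0$. The Orlicz space $L_Q(\mathbb{T}^d)$ consists of the measurable $f$ with finite norm $\|f\|_{L_Q}=\inf\{k>0:\int_{\mathbb{T}^d}Q(|f|/k)\le1\}$. For $r=1,2,\dots$, $L\log^rL(\mathbb{T}^d)$ is the Orlicz space with $Q(u)=u\log^r(1+u)$, $u>0$. *)

(* Defs.v *)
From HB Require Import structures.
From mathcomp Require Import all_boot all_order all_algebra.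
From mathcomp Require Import all_classical all_reals all_analysis.
From mathcomp Require Import complex.

Set Implicit Arguments.
Unset Strict Implicit.
Unset Printing Implicit Defensive.
Import Order.TTheory GRing.Theory Num.Theory.
Import numFieldNormedType.Exports.

Local Open Scope classical_set_scope.
Local Open Scope ring_scope.

Section lebesgue_step.
Context {R : realType} (n : nat).
Local Notation T := (measurableTypeR R).
Variable m : {sigma_finite_measure set (n.-tuple T) -> \bar R}.

(* R x R^n and R^(n+1) identified through (x, t) |-> x :: t *)
Definition tcons (z : T * n.-tuple T) : n.+1.-tuple T := [tuple of z.1 :: z.2].
Definition tuncons (t : n.+1.-tuple T) : T * n.-tuple T :=
  (thead t, [tuple of behead t]).

Lemma tconsK : cancel tcons tuncons.
Proof. by move=> [x t]; rewrite /tuncons /tcons theadE; congr pair; apply/val_inj. Qed.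

Lemma measurable_tcons : measurable_fun setT tcons.
Proof. exact: measurable_cons. Qed.

Lemma measurable_tuncons : measurable_fun setT tuncons.
Proof.
apply: measurable_fun_pair => /=; last exact: measurable_behead.
exact: measurable_tnth.
Qed.

Definition lebesgue_step : set (n.+1.-tuple T) -> \bar R :=
  pushforward (lebesgue_measure \x m)%E tcons.

Let step0 : lebesgue_step set0 = 0%E.
Proof. by rewrite /lebesgue_step /pushforward preimage_set0 measure0. Qed.

Let mpre A : measurable A -> measurable (tcons @^-1` A).
Proof.
by move=> mA; rewrite -[X in measurable X]setTI; exact: measurable_tcons.
Qed.

Let step_ge0 A : (0 <= lebesgue_step A)%E.
Proof. exact: (measure_ge0 (lebesgue_measure \x m)%E). Qed.

Let step_sigma : semi_sigma_additive lebesgue_step.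
Proof.
move=> F mF tF mUF; rewrite /lebesgue_step /pushforward preimage_bigcup.
apply: measure_semi_sigma_additive.
- by move=> i; exact: mpre.
- apply/trivIsetP => /= i j _ _ ij; rewrite -preimage_setI.
  by move/trivIsetP : tF => /(_ _ _ _ _ ij) ->//; rewrite preimage_set0.
- by rewrite -preimage_bigcup; exact: mpre.
Qed.

HB.instance Definition _ := isMeasure.Build _ _ _ lebesgue_step
  step0 step_ge0 step_sigma.

Let step_sigma_finite : sigma_finite setT lebesgue_step.
Proof.
have /sigma_finiteP[F [TF ndF Foo]] := sigma_finiteT (@lebesgue_measure R).
have /sigma_finiteP[G [TG ndG Goo]] := sigma_finiteT m.
exists (fun k => tuncons @^-1` (F k `*` G k)).
  apply/seteqP; split => // t _.
  have [i _ Fi] : (\bigcup_k F k) (thead t) by rewrite -TF.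
  have [j _ Gj] : (\bigcup_k G k) [tuple of behead t] by rewrite -TG.
  exists (maxn i j) => //; split.
  - by move: Fi; exact/subsetPset/ndF/leq_maxl.
  - by move: Gj; exact/subsetPset/ndG/leq_maxr.
move=> k; have [mF oF] := Foo k; have [mG oG] := Goo k; split.
  rewrite -[X in measurable X]setTI; apply: measurable_tuncons => //.
  exact: measurableX.
rewrite /lebesgue_step /pushforward -comp_preimage.
rewrite (_ : tuncons \o tcons = id) ?preimage_id; last first.
  by apply/funext => z /=; rewrite tconsK.
by rewrite product_measure1E// lte_mul_pinfty// ge0_fin_numE.
Qed.

HB.instance Definition _ := Measure_isSigmaFinite.Build _ _ _ lebesgue_step
  step_sigma_finite.

End lebesgue_step.

(* Lebesgue measure on the Borel sets of R^d *)
Fixpoint borel_lebesgue {R : realType} (d : nat) :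
    {sigma_finite_measure set (d.-tuple (measurableTypeR R)) -> \bar R} :=
  match d with
  | 0 => \d_([tuple] : 0.-tuple (measurableTypeR R))
  | d'.+1 => lebesgue_step (borel_lebesgue d')
  end.

(* R^d with the sigma-algebra of Lebesgue (not only Borel) measurable sets. As
   for the library's completed_lebesgue_measure when d = 1, these are the sets
   that are Caratheodory measurable for the outer measure of borel_lebesgue. *)
Definition Rd (R : realType) (d : nat) :=
  caratheodory_type (@borel_lebesgue R d)^*%mu.
HB.instance Definition _ (R : realType) (d : nat) := Measurable.on (Rd R d).

Definition lebesgue {R : realType} (d : nat) : set (Rd R d) -> \bar R :=
  @completed_measure_extension _ _ _ (@borel_lebesgue R d).
HB.instance Definition _ (R : realType) (d : nat) :=
  Measure.on (@lebesgue R d).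

Lemma measurable_box (R : realType) (d : nat) (a b : 'I_d -> R) :
  measurable [set x : d.-tuple (measurableTypeR R) |
    forall j, tnth x j \in `[a j, b j[].
Proof.
rewrite (_ : [set x | _] = \big[setI/setT]_(j < d)
   ((fun x : d.-tuple (measurableTypeR R) => tnth x j) @^-1`
      `[a j, b j[%classic)).
  apply: bigsetI_measurable => j _.
  by rewrite -[X in measurable X]setTI; exact: measurable_tnth.
apply/seteqP; split => x /=; rewrite -bigcap_seq /=.
  by move=> h j _ /=; exact: h.
by move=> h j; apply: h => /=; rewrite mem_index_enum.
Qed.

Lemma borel_lebesgue_box (R : realType) (d : nat) (a b : 'I_d -> R) :
  (forall j, a j <= b j) ->
  borel_lebesgue d [set x | forall j, tnth x j \in `[a j, b j[] =
  (\prod_j (b j - a j))%:E.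
Proof.
elim: d a b => [|d IH] a b ab.
  rewrite big_ord0 /= diracE mem_set//= => -[]//.
rewrite big_ord_recl EFinM /= /lebesgue_step /pushforward.
rewrite (_ : _ @^-1` _ = `[a ord0, b ord0[%classic `*`
    [set x | forall j : 'I_d, tnth x j \in
      `[a (lift ord0 j), b (lift ord0 j)[]); last first.
  apply/seteqP; split => -[x t] /=.
    move=> h; split; first by have := h ord0.
    by move=> j; have := h (lift ord0 j); rewrite tnthS.
  move=> [hx ht] j; have [->|] := eqVneq j ord0; first exact: hx.
  rewrite eq_sym => /unlift_some[k -> _]; rewrite tnthS; exact: ht.
rewrite product_measure1E//; last exact: measurable_box.
rewrite IH; last by move=> j; exact: ab.
have E : lebesgue_measure `[a ord0, b ord0[%classic = (b ord0 - a ord0)%:E.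
  rewrite lebesgue_measure_itv/= lte_fin; case: ltP => // ba.
  suff -> : b ord0 = a ord0 by rewrite subrr.
  by apply/eqP; rewrite eq_le ba ab.
by congr (_ * _)%E; exact: E.
Qed.

Lemma lebesgue_box (R : realType) (d : nat) (a b : 'I_d -> R) :
  (forall j, a j <= b j) ->
  lebesgue [set x : Rd R d | forall j, tnth x j \in `[a j, b j[] =
  (\prod_j (b j - a j))%:E.
Proof.
move=> ab; rewrite -borel_lebesgue_box// [LHS]measurable_mu_extE//.
exact: measurable_box.
Qed.

Section fourier.
Context {R : realType} {d : nat}.
Local Notation mu := (@lebesgue R d).

Definition coord (x : Rd R d) (j : 'I_d) : R := tnth x j.

(* A function on the torus is given by its values on [-pi, pi)^d: the values of
   f : Rd R d -> R[i] elsewhere are never used, so that no periodicity has to be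
   imposed. *)
Definition torus : set (Rd R d) :=
  [set x | forall j, coord x j \in `[- pi, pi[].

Definition cmeasurable (f : Rd R d -> R[i]) : Prop :=
  measurable_fun torus (fun x => complex.Re (f x)) /\
  measurable_fun torus (fun x => complex.Im (f x)).

Definition cabs (z : R[i]) : R := ComplexField.Normc.normc z.

Definition cintegral (f : Rd R d -> R[i]) : R[i] :=
  (\int[mu]_(x in torus) complex.Re (f x) +i*
   \int[mu]_(x in torus) complex.Im (f x))%C.

Definition L1norm (f : Rd R d -> R[i]) : \bar R :=
  (\int[mu]_(x in torus) (cabs (f x))%:E)%E.

(* e^(i t) *)
Definition cis (t : R) : R[i] := (cos t +i* sin t)%C.

Definition dot (k : 'I_d -> int) (x : Rd R d) : R :=
  \sum_(j < d) (k j)%:~R * coord x j.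

Definition fourier (f : Rd R d -> R[i]) (k : 'I_d -> int) : R[i] :=
  (((2 * pi) ^+ d)^-1)%:C%C * cintegral (fun x => f x * cis (- dot k x)).

(* The frequencies k_j in [-N_j, N_j] are enumerated as k_j = p_j - N_j with
   0 <= p_j <= 2 N_j. *)
Definition partial_sum (N : 'I_d -> nat) (f : Rd R d -> R[i]) (x : Rd R d) :
    R[i] :=
  \sum_(p : {dffun forall j : 'I_d, 'I_(N j).*2.+1})
    let k := fun j => (p j)%:Z - (N j)%:Z in fourier f k * cis (dot k x).

Definition logsum (n : nat) : R := \sum_(0 <= k < n.+1) k.+1%:R^-1.

(* Noerlund logarithmic means in the variables of B, Riesz logarithmic means in
   the others *)
Definition log_mean (B : {set 'I_d}) (n : 'I_d -> nat) (f : Rd R d -> R[i])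
    (x : Rd R d) : R[i] :=
  ((\prod_(j < d) logsum (n j))^-1)%:C%C *
  \sum_(i : {dffun forall j : 'I_d, 'I_(n j).+1})
    ((\prod_(j < d) (i j).+1%:R)^-1)%:C%C *
    partial_sum (fun j => if j \in B then (n j - i j)%N else i j) f x.

(* Luxemburg norm; Q is meant to be a Young function. The infimum of the empty
   set is +oo. *)
Definition orlicz_norm (Q : R -> R) (f : Rd R d -> R[i]) : \bar R :=
  ereal_inf [set k%:E | k in
    [set k : R | 0 < k /\
      (\int[mu]_(x in torus) (Q (cabs (f x) / k))%:E <= 1)%E]].

Definition in_orlicz (Q : R -> R) (f : Rd R d -> R[i]) : Prop :=
  cmeasurable f /\ (orlicz_norm Q f < +oo)%E.

(* The even extension of u log^r(1 + u), u > 0 *)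
Definition LlogL_young (r : nat) (u : R) : R := `|u| * ln (1 + `|u|) ^+ r.

Definition in_LlogL (r : nat) (f : Rd R d -> R[i]) : Prop :=
  in_orlicz (LlogL_young r) f.

End fourier.

(* Main.v *)
Require Import Defs.
From mathcomp Require Import all_boot all_order all_algebra.
From mathcomp Require Import all_classical all_reals all_analysis.
From mathcomp Require Import measurable_realfun complex.
From mathcomp Require Import ring lra zify.

(** The mean of [f] is a Fourier multiplier whose symbol is a product of
    one-variable symbols with values in [0, 1] that tend to 1. The proof is a
    uniform [L log^r L -> L^1] bound with [r = #|B|] combined with convergence on
    bounded functions.

    On trigonometric polynomials, the projection onto the frequencies [k_j >= a]
    is bounded in [L^(2m)] with a norm of order [m]: when [F] is the projection
    of [p] and [H = p - F], all the frequencies of [(F * conj H)^m] are positive in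
    the [j]-th variable, so that it has mean zero, and it is close to
    [(-1)^m |F|^(2m)] wherever [p] is small with respect to [F]. Hence a Noerlund
    mean, a convex combination of partial sums, has norm [O(m)], whereas a Riesz
    mean is a convex combination of Fejer means, that is, of translations, and has
    norm 1. Composing over the variables, the multiplier [T] has norm [O(m^r)]
    in [L^(2m)] for all [m]. For [|g| <= 1], the moments of [T g] then give
    [int |h| |T g| <= K1 int |h| (1 + ln^r (1 + |h|)) + K2] by a Young inequality,
    and by duality [|T h|_1] has the same bound.

    Given [f], this is applied to [f / delta] restricted to [|f| > A], with
    [delta] small and then [A] large. The remaining part of [f] is bounded,
    hence approximable in [L^2] by trigonometric polynomials, and there [1 - T]
    is an [L^2] contraction. *)

Set Implicit Arguments.
Unset Strict Implicit.
Unset Printing Implicit Defensive.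
Import Order.TTheory GRing.Theory Num.Theory.
Import numFieldNormedType.Exports.

Local Open Scope classical_set_scope.
Local Open Scope ring_scope.

(** The moment bounds live on trigonometric polynomials, whereas [f] is barely better than
    integrable. Even exponents make these bounds algebraic: up to a factor, the integral of
    [|p|^(2m)] is the constant term of [(p * conj p)^m]. The passage to functions is made on the
    dual side: a multiplier supported in a cube of frequencies does not distinguish a function [g]
    with [|g| <= 1] from its de la Vallee Poussin polynomial, which is bounded by [2^d] whatever the
    cube. The growth [m^r] of the norms is what produces the logarithm: in a pairing of [|h|] with a
    function whose [L^(2m)] norms are [O(m^r)], the best [m] at a point where [|h| = a] is about
    [ln (1 + a)], at a cost of order [a * ln^r (1 + a)]. Only the variables of [B] contribute a
    factor of order [m], hence [r = #|B|]. The resulting bound is not homogeneous, which is why [f]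
    is divided by [delta]: as soon as the weight of [h / delta] has integral at most 1, it gives
    [|T h|_1 <= delta * (K1 + K2)], so that the additive constant does no harm. *)

Section modulus.
Context {R : realType}.
Local Notation C := R[i].
Implicit Types (z w : C) (a b : R).

Lemma cReD z w : complex.Re (z + w) = complex.Re z + complex.Re w.
Proof. by case: z w => ? ? [? ?]. Qed.

Lemma cImD z w : complex.Im (z + w) = complex.Im z + complex.Im w.
Proof. by case: z w => ? ? [? ?]. Qed.

Lemma cReM z w : complex.Re (z * w) =
  complex.Re z * complex.Re w - complex.Im z * complex.Im w.
Proof. by case: z w => ? ? [? ?]. Qed.

Lemma cImM z w : complex.Im (z * w) =
  complex.Re z * complex.Im w + complex.Im z * complex.Re w.
Proof. by case: z w => ? ? [? ?]. Qed.

Lemma cReN z : complex.Re (- z) = - complex.Re z. Proof. by case: z. Qed.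

Lemma cImN z : complex.Im (- z) = - complex.Im z. Proof. by case: z. Qed.

Lemma cRe_conj z : complex.Re (conjc z) = complex.Re z. Proof. by case: z. Qed.

Lemma cIm_conj z : complex.Im (conjc z) = - complex.Im z. Proof. by case: z.
  Qed.

Lemma complex_eqP z w : complex.Re z = complex.Re w ->
  complex.Im z = complex.Im w -> z = w.
Proof. by case: z w => ? ? [? ?] /= -> ->. Qed.

Lemma cabs0 : cabs (0 : C) = 0. Proof. exact: ComplexField.Normc.normc0. Qed.

Lemma cabs1 : cabs (1 : C) = 1. Proof. exact: ComplexField.Normc.normc1. Qed.

Lemma cabsM z w : cabs (z * w) = cabs z * cabs w.
Proof. exact: ComplexField.Normc.normcM. Qed.

Lemma cabsV z : cabs z^-1 = (cabs z)^-1.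
Proof. exact: ComplexField.Normc.normcV. Qed.

Lemma cabsN z : cabs (- z) = cabs z. Proof. exact: normcN. Qed.

Lemma cabs_ge0 z : 0 <= cabs z.
Proof. by case: z => a b; exact: sqrtr_ge0. Qed.

Lemma ler_cabsD z w : cabs (z + w) <= cabs z + cabs w.
Proof. exact: le_normcD. Qed.

Lemma ler_cabsB z w : cabs (z - w) <= cabs z + cabs w.
Proof. by rewrite -(cabsN w) ler_cabsD. Qed.

Lemma cabsX z n : cabs (z ^+ n) = cabs z ^+ n.
Proof. by elim: n => [|n IH]; rewrite ?cabs1// !exprS cabsM IH. Qed.

Lemma cabs_conj z : cabs (conjc z) = cabs z.
Proof. by case: z => a b; rewrite /cabs /= sqrrN. Qed.

Lemma cabs_real a : cabs a%:C%C = `|a|.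
Proof. by rewrite /cabs /= expr0n /= addr0 sqrtr_sqr. Qed.

Lemma cabs_eq0 z : cabs z = 0 -> z = 0.
Proof. exact: ComplexField.Normc.eq0_normc. Qed.

Lemma sqr_cabs z : cabs z ^+ 2 = complex.Re z ^+ 2 + complex.Im z ^+ 2.
Proof. by case: z => a b; rewrite /cabs /= sqr_sqrtr// addr_ge0 ?sqr_ge0. Qed.

Lemma mulc_conj z : z * conjc z = (cabs z ^+ 2)%:C%C.
Proof.
apply: complex_eqP; rewrite ?cReM ?cImM cRe_conj cIm_conj ?sqr_cabs /=; ring.
Qed.

Lemma normr_Re z : `|complex.Re z| <= cabs z.
Proof.
rewrite -(@ler_pXn2r _ 2) ?nnegrE ?cabs_ge0// sqr_cabs real_normK ?num_real//.
by rewrite lerDl sqr_ge0.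
Qed.

Lemma normr_Im z : `|complex.Im z| <= cabs z.
Proof.
rewrite -(@ler_pXn2r _ 2) ?nnegrE ?cabs_ge0// sqr_cabs real_normK ?num_real//.
by rewrite lerDr sqr_ge0.
Qed.

Lemma ler_Re z : complex.Re z <= cabs z.
Proof. exact: le_trans (ler_norm _) (normr_Re z). Qed.

Lemma ler_cabs_sum (I : Type) (r : seq I) (P : pred I) (F : I -> C) :
  cabs (\sum_(i <- r | P i) F i) <= \sum_(i <- r | P i) cabs (F i).
Proof.
elim/big_rec2: _ => [|i y x _ h]; first by rewrite cabs0.
by rewrite (le_trans (ler_cabsD _ _))// lerD2l.
Qed.

Lemma cRe_sum (I : Type) (r : seq I) (P : pred I) (F : I -> C) :
  complex.Re (\sum_(i <- r | P i) F i) = \sum_(i <- r | P i) complex.Re (F i).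
Proof. by elim/big_rec2: _ => // i y x _ <-; rewrite cReD. Qed.

Lemma cReZ a z : complex.Re (a%:C%C * z) = a * complex.Re z.
Proof. by rewrite cReM /= mul0r subr0. Qed.

Lemma cImZ a z : complex.Im (a%:C%C * z) = a * complex.Im z.
Proof. by rewrite cImM /= mul0r addr0. Qed.

Lemma cabsZ a z : 0 <= a -> cabs (a%:C%C * z) = a * cabs z.
Proof. by move=> a0; rewrite cabsM cabs_real ger0_norm. Qed.

Lemma cconjD z w : conjc (z + w) = conjc z + conjc w.
Proof. by apply: complex_eqP;
  rewrite !(cReD, cImD, cRe_conj, cIm_conj) ?opprD. Qed.

Lemma cconjM z w : conjc (z * w) = conjc z * conjc w.
Proof.
by apply: complex_eqP;
  rewrite !(cReM, cImM, cRe_conj, cIm_conj) ?mulrNN// mulrN mulNr opprD.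
Qed.

Lemma cconj_sum (I : Type) (r : seq I) (P : pred I) (F : I -> C) :
  conjc (\sum_(i <- r | P i) F i) = \sum_(i <- r | P i) conjc (F i).
Proof. by apply: (big_morph (@conjc R) cconjD); rewrite /= oppr0. Qed.

Lemma cconj_real a : conjc a%:C%C = a%:C%C.
Proof. by apply: complex_eqP; rewrite /= ?oppr0. Qed.

Lemma natrC n : (n%:R : C) = (n%:R : R)%:C%C.
Proof. by rewrite rmorph_nat. Qed.

End modulus.

(** * The unit circle *)

Section unit_circle.
Context {R : realType}.
Local Notation C := R[i].
Implicit Types a b : R.

Lemma cisD a b : cis (a + b) = cis a * cis b :> C.
Proof.
by apply: complex_eqP; rewrite ?cReM ?cImM /= ?cosD ?sinD; ring.
Qed.

Lemma cis0 : cis 0 = 1 :> C.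
Proof. by rewrite /cis cos0 sin0. Qed.

Lemma cisN a : cis (- a) = conjc (cis a).
Proof. by rewrite /cis cosN sinN. Qed.

Lemma cabs_cis a : cabs (cis a) = 1.
Proof.
apply/eqP; rewrite -(@eqrXn2 _ 2) ?cabs_ge0// sqr_cabs expr1n.
by rewrite -(cos2Dsin2 a).
Qed.

Lemma cis_natM n a : cis (n%:R * a) = cis a ^+ n.
Proof.
elim: n => [|n IH]; first by rewrite mul0r cis0.
by rewrite -natr1 mulrDl mul1r cisD IH exprSr.
Qed.

Lemma cis2pi : cis (2 * pi) = 1 :> C.
Proof. by rewrite /cis mulrC mulr_natr cos2pi sin2pi. Qed.

End unit_circle.

(** * Integration on the torus *)

Local Notation "'J' u" := (\int[@lebesgue _ _]_(x in @torus _ _) u x) (at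
  level 10).

Section torus_integral.
Context {R : realType} {d : nat}.
Local Notation C := R[i].
Local Notation X := (Rd R d).
Local Notation mu := (@lebesgue R d).
Local Notation D := (@torus R d).
Implicit Types (f g : X -> C) (u v : X -> R) (z : C) (a : R).

Lemma measurable_Rd (A : set (d.-tuple (measurableTypeR R))) :
  measurable A -> measurable (A : set X).
Proof. exact: caratheodory_measurable_mu_ext. Qed.

Lemma measurable_torus : measurable D.
Proof. by apply: measurable_Rd; exact: measurable_box. Qed.
#[local] Hint Resolve measurable_torus : core.

Lemma lebesgue_torus : mu D = ((2 * pi) ^+ d)%:E.
Proof.
have pi0 := @pi_ge0 R.
rewrite [LHS](@lebesgue_box R d (fun=> - pi) (fun=> pi)); last first.
  by move=> _; rewrite (le_trans _ pi0)// oppr_le0.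
by rewrite prodr_const card_ord opprK -mulr2n mulrC mulr_natr.
Qed.

Lemma lebesgue_torus_lty : (mu D < +oo)%E.
Proof. by rewrite lebesgue_torus ltry. Qed.
#[local] Hint Resolve lebesgue_torus_lty : core.

Lemma measurable_coord (j : 'I_d) : measurable_fun setT (fun x : X =>
  Defs.coord x j).
Proof.
move=> _ Y mY; rewrite setTI.
apply: (@measurable_Rd [set x | Y (tnth x j)]).
by rewrite -[X in measurable X]setTI; exact: measurable_tnth.
Qed.

Definition bounded_measurable (u : X -> R) :=
  measurable_fun D u /\ exists M, forall x, D x -> `|u x| <= M.

Lemma bounded_measurable_integrable u :
  bounded_measurable u -> mu.-integrable D (EFin \o u).
Proof.
move=> [mu_ [M uM]]; apply: measurable_bounded_integrable => //.
by exists M; split; [rewrite num_real|move=> N MN x Dx /=;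
  rewrite (le_trans (uM _ Dx))// ltW].
Qed.

Lemma bounded_measurable_cst a : bounded_measurable (fun=> a).
Proof. by split; [exact: measurable_cst|exists `|a|]. Qed.

Lemma bounded_measurableD u v : bounded_measurable u -> bounded_measurable v ->
  bounded_measurable (fun x => u x + v x).
Proof.
move=> [mu_ [M uM]] [mv [N vN]]; split; first exact: measurable_funD.
exists (M + N) => x Dx; rewrite (le_trans (ler_normD _ _))//.
by rewrite lerD ?uM ?vN.
Qed.

Lemma bounded_measurableM u v : bounded_measurable u -> bounded_measurable v ->
  bounded_measurable (fun x => u x * v x).
Proof.
move=> [mu_ [M uM]] [mv [N vN]]; split; first exact: measurable_funM.
by exists (M * N) => x Dx; rewrite normrM ler_pM ?uM ?vN.
Qed.

Lemma bounded_measurableZ a u : bounded_measurable u ->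
  bounded_measurable (fun x => a * u x).
Proof. exact/bounded_measurableM/bounded_measurable_cst. Qed.

Lemma bounded_measurableX u n : bounded_measurable u ->
  bounded_measurable (fun x => u x ^+ n).
Proof.
move=> bu; elim: n => [|n IH]; first exact: bounded_measurable_cst.
by under eq_fun do rewrite exprS; exact: bounded_measurableM.
Qed.

Lemma bounded_measurable_sum (I : Type) (r : seq I) (F : I -> X -> R) :
  (forall i, bounded_measurable (F i)) ->
  bounded_measurable (fun x => \sum_(i <- r) F i x).
Proof.
move=> bF; elim: r => [|i r IH].
  by under eq_fun do rewrite big_nil; exact: bounded_measurable_cst.
by under eq_fun do rewrite big_cons; exact: bounded_measurableD.
Qed.

Lemma JD u v : bounded_measurable u -> bounded_measurable v ->
  J (fun x => u x + v x) = J u + J v.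
Proof. by move=> bu bv; rewrite RintegralD//;
  exact: bounded_measurable_integrable. Qed.

Lemma JZ a u : bounded_measurable u -> J (fun x => a * u x) = a * J u.
Proof. by move=> bu; rewrite RintegralZl//;
  exact: bounded_measurable_integrable. Qed.

Lemma J_cst a : J (fun _ : X => a) = a * (2 * pi) ^+ d.
Proof.
by rewrite -[RHS]/(a * fine ((2 * pi) ^+ d)%:E) -lebesgue_torus Rintegral_cst.
Qed.

Lemma J_sum (I : Type) (r : seq I) (F : I -> X -> R) :
  (forall i, bounded_measurable (F i)) ->
  J (fun x => \sum_(i <- r) F i x) = \sum_(i <- r) J (F i).
Proof.
move=> bF; elim: r => [|i r IH].
  rewrite big_nil -[RHS](mul0r ((2 * pi) ^+ d)) -J_cst.
  by apply: eq_Rintegral => x _; rewrite big_nil.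
rewrite big_cons -IH -(JD (bF i) (bounded_measurable_sum r bF)).
by apply: eq_Rintegral => x _; rewrite big_cons.
Qed.

Lemma le_J u v : bounded_measurable u -> bounded_measurable v ->
  (forall x, D x -> u x <= v x) -> J u <= J v.
Proof. by move=> bu bv; apply: le_Rintegral => //;
  exact: bounded_measurable_integrable. Qed.

Lemma J_ge0 u : (forall x, D x -> 0 <= u x) -> 0 <= J u.
Proof. exact: Rintegral_ge0. Qed.

Lemma EFin_J u : bounded_measurable u ->
  (\int[mu]_(x in D) (u x)%:E)%E = (J u)%:E.
Proof.
move=> bu; rewrite /Rintegral fineK//.
by apply: integrable_fin_num => //; exact: bounded_measurable_integrable.
Qed.

Definition cintegrable (f : X -> C) :=
  mu.-integrable D (EFin \o (fun x => complex.Re (f x))) /\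
  mu.-integrable D (EFin \o (fun x => complex.Im (f x))).

Lemma cmeasurableD f g : cmeasurable f -> cmeasurable g ->
  cmeasurable (fun x => f x + g x).
Proof.
move=> [fr fi] [gr gi]; split.
  by under eq_fun do rewrite cReD; exact: measurable_funD.
by under eq_fun do rewrite cImD; exact: measurable_funD.
Qed.

Lemma cmeasurableM f g : cmeasurable f -> cmeasurable g ->
  cmeasurable (fun x => f x * g x).
Proof.
move=> [fr fi] [gr gi]; split.
  by under eq_fun do rewrite cReM; apply: measurable_funB;
    exact: measurable_funM.
by under eq_fun do rewrite cImM; apply: measurable_funD; exact: measurable_funM.
Qed.

Lemma cmeasurable_cst z : cmeasurable (fun _ : X => z).
Proof. by split; exact: measurable_cst. Qed.

Lemma cmeasurable_real (u : X -> R) : measurable_fun D u ->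
  cmeasurable (fun x => (u x)%:C%C).
Proof. by split => //; exact: measurable_cst. Qed.

Lemma cmeasurableZ z f : cmeasurable f -> cmeasurable (fun x => z * f x).
Proof. exact/cmeasurableM/cmeasurable_cst. Qed.

Lemma cmeasurableB f g : cmeasurable f -> cmeasurable g ->
  cmeasurable (fun x => f x - g x).
Proof.
move=> mf mg; have := cmeasurableD mf (cmeasurableZ (-1) mg).
by under eq_fun do rewrite mulN1r.
Qed.

Lemma cmeasurable_conj f : cmeasurable f -> cmeasurable (fun x => conjc (f x)).
Proof.
move=> [fr fi]; split; first by under eq_fun do rewrite cRe_conj.
by under eq_fun do rewrite cIm_conj; exact: measurableT_comp.
Qed.

Lemma measurable_cabs f : cmeasurable f -> measurable_fun D (fun x => cabs (f
  x)).
Proof.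
move=> [fr fi]; have -> : (fun x => cabs (f x)) =
    (fun x => Num.sqrt (complex.Re (f x) ^+ 2 + complex.Im (f x) ^+ 2)).
  by apply/funext => x; case: (f x).
have mD := measurable_funD (measurable_funX 2 fr) (measurable_funX 2 fi).
have msqrt := continuous_measurable_fun (@sqrt_continuous R).
exact: (measurableT_comp msqrt mD).
Qed.

Lemma cintegrableP f : cintegrable f <->
  cmeasurable f /\ mu.-integrable D (EFin \o (fun x => cabs (f x))).
Proof.
split=> [[fr fi]|[[fr fi] fa]].
  have mf : cmeasurable f.
    by split; apply/measurable_EFinP;
      [case/integrableP : fr|case/integrableP : fi].
  split => //.
  apply: (@le_integrable _ _ _ _ _ measurable_torus _
    (fun x => (`|complex.Re (f x)| + `|complex.Im (f x)|)%:E)).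
  - exact/measurable_EFinP/measurable_cabs.
  - move=> x Dx /=; rewrite lee_fin ger0_norm ?cabs_ge0// ger0_norm ?addr_ge0//.
    rewrite -(@ler_pXn2r _ 2) ?nnegrE ?cabs_ge0 ?addr_ge0// sqr_cabs sqrrD.
    rewrite !real_normK ?num_real// -addrA [X in _ <= _ + X]addrC addrA lerDl.
    by rewrite mulrn_wge0// mulr_ge0.
  - exact: (integrableD measurable_torus (integrable_norm fr) (integrable_norm
    fi)).
split; apply: (le_integrable _ _ _ fa) => //; try exact/measurable_EFinP.
  by move=> x Dx /=; rewrite lee_fin (ger0_norm (cabs_ge0 _)) normr_Re.
by move=> x Dx /=; rewrite lee_fin (ger0_norm (cabs_ge0 _)) normr_Im.
Qed.

Definition cbounded (f : X -> C) :=
  cmeasurable f /\ exists M, forall x, D x -> cabs (f x) <= M.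

Lemma cbounded_cabs f : cbounded f -> bounded_measurable (fun x => cabs (f x)).
Proof.
move=> [mf [M fM]]; split; first exact: measurable_cabs.
by exists M => x Dx; rewrite ger0_norm ?cabs_ge0// fM.
Qed.

Lemma cbounded_Re f : cbounded f -> bounded_measurable (fun x => complex.Re (f
  x)).
Proof.
move=> [[mf _] [M fM]]; split => //.
by exists M => x Dx; rewrite (le_trans (normr_Re _))// fM.
Qed.

Lemma cbounded_integrable f : cbounded f -> cintegrable f.
Proof.
move=> bf; apply/cintegrableP; split; first by case: bf.
exact/bounded_measurable_integrable/cbounded_cabs.
Qed.

Lemma cbounded_cst z : cbounded (fun=> z).
Proof. by split; [exact: cmeasurable_cst|exists (cabs z)]. Qed.

Lemma cboundedD f g : cbounded f -> cbounded g -> cbounded (fun x => f x + g x).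
Proof.
move=> [mf [M fM]] [mg [N gN]]; split; first exact: cmeasurableD.
exists (M + N) => x Dx; rewrite (le_trans (ler_cabsD _ _))//.
by rewrite lerD ?fM ?gN.
Qed.

Lemma cboundedM f g : cbounded f -> cbounded g -> cbounded (fun x => f x * g x).
Proof.
move=> [mf [M fM]] [mg [N gN]]; split; first exact: cmeasurableM.
by exists (M * N) => x Dx; rewrite cabsM ler_pM ?cabs_ge0 ?fM ?gN.
Qed.

Lemma cboundedZ z f : cbounded f -> cbounded (fun x => z * f x).
Proof. exact/cboundedM/cbounded_cst. Qed.

Lemma cboundedB f g : cbounded f -> cbounded g -> cbounded (fun x => f x - g x).
Proof.
move=> bf bg; have := cboundedD bf (cboundedZ (-1) bg).
by under eq_fun do rewrite mulN1r.
Qed.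

Lemma cbounded_conj f : cbounded f -> cbounded (fun x => conjc (f x)).
Proof.
move=> [mf [M fM]]; split; first exact: cmeasurable_conj.
by exists M => x Dx; rewrite cabs_conj fM.
Qed.

Lemma cbounded_sum (I : Type) (r : seq I) (F : I -> X -> C) :
  (forall i, cbounded (F i)) -> cbounded (fun x => \sum_(i <- r) F i x).
Proof.
move=> mF; elim: r => [|i r IH].
  by under eq_fun do rewrite big_nil; exact: cbounded_cst.
by under eq_fun do rewrite big_cons; exact: cboundedD.
Qed.

Lemma cintegrableD f g : cintegrable f -> cintegrable g ->
  cintegrable (fun x => f x + g x).
Proof.
move=> [fr fi] [gr gi]; split.
  by under eq_fun do rewrite cReD; exact: (integrableD measurable_torus fr gr).
by under eq_fun do rewrite cImD; exact: (integrableD measurable_torus fi gi).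
Qed.

Lemma cintegrableM f g : cintegrable f -> cbounded g ->
  cintegrable (fun x => f x * g x).
Proof.
move=> /cintegrableP[mf fa] [mg [M gM]]; apply/cintegrableP.
have mfg := cmeasurableM mf mg; split => //.
apply: (@le_integrable _ _ _ _ _ measurable_torus _
  (fun x => (M * cabs (f x))%:E)).
- exact/measurable_EFinP/measurable_cabs.
- move=> x Dx /=; rewrite lee_fin cabsM ger0_norm ?mulr_ge0 ?cabs_ge0//.
  rewrite (le_trans _ (ler_norm _))// mulrC ler_wpM2r ?cabs_ge0//.
  exact: gM.
- exact: (integrableZl measurable_torus M fa).
Qed.

Lemma cintegrableZ z f : cintegrable f -> cintegrable (fun x => z * f x).
Proof.
move=> fi; under eq_fun do rewrite mulrC.
exact/(cintegrableM fi)/cbounded_cst.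
Qed.

Lemma cintegrable_sum (I : Type) (r : seq I) (F : I -> X -> C) :
  (forall i, cintegrable (F i)) -> cintegrable (fun x => \sum_(i <- r) F i x).
Proof.
move=> mF; elim: r => [|i r IH].
  by under eq_fun do rewrite big_nil; exact/cbounded_integrable/cbounded_cst.
by under eq_fun do rewrite big_cons; exact: cintegrableD.
Qed.

Lemma eq_cintegral f g : (forall x, D x -> f x = g x) -> cintegral f =
  cintegral g.
Proof.
move=> fg; rewrite /cintegral; congr (_ +i* _)%C;
  by apply: eq_Rintegral => x /set_mem Dx; rewrite fg.
Qed.

Lemma cintegralD f g : cintegrable f -> cintegrable g ->
  cintegral (fun x => f x + g x) = cintegral f + cintegral g.
Proof.
move=> [fr fi] [gr gi]; apply: complex_eqP; rewrite ?cReD ?cImD /=.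
  by rewrite -RintegralD//; apply: eq_Rintegral => x _; rewrite cReD.
by rewrite -RintegralD//; apply: eq_Rintegral => x _; rewrite cImD.
Qed.

Lemma cintegralZ z f : cintegrable f ->
  cintegral (fun x => z * f x) = z * cintegral f.
Proof.
move=> [fr fi]; have h a u : mu.-integrable D (EFin \o u) ->
    mu.-integrable D (EFin \o (fun x => a * u x)).
  by move=> ui; exact: (integrableZl measurable_torus a ui).
apply: complex_eqP; rewrite ?cReM ?cImM /=.
  rewrite -!RintegralZl// -RintegralB//; try exact: h.
  by apply: eq_Rintegral => x _; rewrite cReM.
rewrite -!RintegralZl// -RintegralD//; try exact: h.
by apply: eq_Rintegral => x _; rewrite cImM.
Qed.

Lemma cintegral_cst z : cintegral (fun _ : X => z) = ((2 * pi) ^+ d)%:C%C * z.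
Proof.
by apply: complex_eqP; rewrite ?cReZ ?cImZ /= J_cst mulrC.
Qed.

Lemma cintegral_sum (I : Type) (r : seq I) (F : I -> X -> C) :
  (forall i, cintegrable (F i)) ->
  cintegral (fun x => \sum_(i <- r) F i x) = \sum_(i <- r) cintegral (F i).
Proof.
move=> bF; elim: r => [|i r IH].
  rewrite big_nil -[RHS](mulr0 (((2 * pi) ^+ d)%:C%C)) -cintegral_cst.
  by apply: eq_cintegral => x _; rewrite big_nil.
rewrite big_cons -IH -(cintegralD (bF i) (cintegrable_sum r bF)).
by apply: eq_cintegral => x _; rewrite big_cons.
Qed.

Lemma cintegral_conj f : cintegrable f ->
  cintegral (fun x => conjc (f x)) = conjc (cintegral f).
Proof.
move=> [fr fi]; apply: complex_eqP; rewrite ?cRe_conj ?cIm_conj /=.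
  by apply: eq_Rintegral => x _; rewrite cRe_conj.
rewrite -mulN1r -RintegralZl//.
by apply: eq_Rintegral => x _; rewrite cIm_conj mulN1r.
Qed.

(* Rotate the integral onto the positive real axis. *)
Lemma ler_cabs_cintegral f : cintegrable f ->
  cabs (cintegral f) <= J (fun x => cabs (f x)).
Proof.
move=> fi; have [mf fa] := (cintegrableP f).1 fi.
have [/cabs_eq0 ->|z0] := eqVneq (cabs (cintegral f)) 0.
  by rewrite cabs0; exact: (J_ge0 (fun x _ => cabs_ge0 (f x))).
set z := cintegral f in z0 *; set w := conjc z / (cabs z)%:C%C.
have w1 : cabs w = 1.
  by rewrite cabsM cabs_conj cabsV cabs_real ger0_norm ?cabs_ge0// mulfV.
have wz : w * z = (cabs z)%:C%C.
  rewrite mulrAC [conjc z * z]mulrC mulc_conj expr2 rmorphM /= mulfK//.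
  by apply: contra z0 => /eqP/(congr1 (@complex.Re _))/= ->.
rewrite -[leLHS]/(complex.Re (cabs z)%:C%C) -wz -cintegralZ//=.
have [wr _] := cintegrableZ w fi.
apply: le_Rintegral => // x _; rewrite (le_trans (ler_Re _))//.
by rewrite cabsM w1 mul1r.
Qed.

End torus_integral.
#[local] Hint Resolve measurable_torus lebesgue_torus_lty : core.

(** * Chords of the circle and sums of roots of unity *)

Section unit_circle_more.
Context {R : realType}.
Local Notation C := R[i].
Implicit Types a b t : R.

Lemma ger0_sin_le t : 0 <= t -> `|sin t| <= t.
Proof.
move=> t0; have [c _ E] : exists2 c, c \in `[0, t] & sin t - sin 0 = cos c *
  (t - 0).
  apply: (@MVT_segment _ sin cos) => //.
  by apply: continuous_subspaceT => x; exact: continuous_sin.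
by rewrite sin0 !subr0 in E; rewrite E normrM (ger0_norm t0) ler_piMl// cos_max.
Qed.

Lemma normr_sin_le t : `|sin t| <= `|t|.
Proof.
have [t0|t0] := leP 0 t; first by rewrite (ger0_norm t0) ger0_sin_le.
by rewrite -normrN -sinN (ltr0_norm t0) ger0_sin_le// oppr_ge0 ltW.
Qed.

(** With [s] half the difference, [cis (s *+ 2) - 1] is [cis s] times [2 i sin s]: a chord is twice
    the sine of half the angle. *)
Lemma cis_lipschitz a b : cabs (cis a - cis b) <= `|a - b|.
Proof.
set s := (a - b) / 2.
have -> : a = b + s *+ 2 by rewrite -mulr_natr /s mulfVK ?pnatr_eq0// addrC
  subrK.
have -> : b + s *+ 2 - b = s *+ 2 by rewrite addrC addKr.
have E : cis (s *+ 2) - 1 = cis s * (0 +i* (sin s *+ 2))%C.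
  apply: complex_eqP; rewrite ?cReM ?cImM ?cReD ?cImD /= ?cReN ?cImN /=.
    have h : cos s ^+ 2 = 1 - sin s ^+ 2 by rewrite -(cos2Dsin2 s) addrK.
    by rewrite cos_mulr2n h; ring.
  by rewrite mulr2n sinD -mulr_natr; ring.
rewrite cisD -{2}[cis b]mulr1 -mulrBr E !cabsM !cabs_cis !mul1r.
have -> : cabs (0 +i* (sin s *+ 2))%C = `|sin s *+ 2|.
  by rewrite /cabs /= expr0n /= add0r sqrtr_sqr.
by rewrite !normrMn lerMn2r /= normr_sin_le.
Qed.

Lemma cis_neq1 t : t != 0 -> `|t| < 2 * pi -> cis t != 1 :> C.
Proof.
move=> t0 tpi; apply/eqP => /(congr1 (@complex.Re R)) /= ct.
have s0 : sin (`|t| / 2) > 0.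
  apply: sin_gt0_pi; apply/andP; split; first by rewrite divr_gt0 ?normr_gt0.
  by rewrite ltr_pdivrMr// mulrC.
have : cos (`|t| / 2 *+ 2) = 1.
  rewrite -mulr_natr mulfVK ?pnatr_eq0//.
  by case: (ger0P t) => _; rewrite ?cosN.
rewrite cos_mulr2n; have := cos2Dsin2 (`|t| / 2).
have : 0 < sin (`|t| / 2) ^+ 2 by rewrite exprn_gt0.
rewrite -mulr_natr; set c := cos _ ^+ 2; set u := sin _ ^+ 2; lra.
Qed.

(** A geometric sum whose ratio is an [M]-th root of unity; as [|q| < M], this ratio is 1 only for
    [q = 0]. *)
Lemma sum_roots_of_unity (M : nat) (q : int) : (`|q| < M)%N ->
  \sum_(l < M) cis (l%:R * (2 * pi * q%:~R / M%:R)) =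
  if q == 0 then M%:R else 0 :> C.
Proof.
move=> qM; have M0 : (0 < M)%N by exact: leq_ltn_trans qM.
have MR : (M%:R : R) != 0 by rewrite pnatr_eq0 -lt0n.
have [->|q0] := eqVneq q 0.
  under eq_bigr do rewrite mulr0 mul0r mulr0 cis0.
  by rewrite sumr_const card_ord.
set z := cis (2 * pi * q%:~R / M%:R) : C.
under eq_bigr do rewrite cis_natM -/z.
have z1 : z != 1.
  apply: cis_neq1.
    rewrite mulf_neq0 ?invr_eq0// mulf_neq0 ?intr_eq0// mulf_neq0 ?pnatr_eq0//.
    by rewrite gt_eqF// pi_gt0.
  have pi0 := @pi_gt0 R.
  have tpi0 : 0 < 2 * pi :> R by rewrite mulr_gt0.
  rewrite normrM normfV (ger0_norm (ler0n _ M)) normrM (gtr0_norm tpi0).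
  rewrite ltr_pdivrMr ?ltr0n// ltr_pM2l// -intr_norm -[X in _ < X]/((M :
    int)%:~R).
  by rewrite ltr_int -abszE ltz_nat.
have zM : z ^+ M = 1.
  rewrite -cis_natM mulrC mulfVK//; case: q {q0 qM z1 z} => n.
    by rewrite mulrC cis_natM cis2pi expr1n.
  by rewrite NegzE mulrN cisN mulrC cis_natM cis2pi expr1n /= oppr0.
have := subrX1 z M; rewrite zM subrr => /esym/eqP.
by rewrite mulf_eq0 subr_eq0 (negbTE z1) /= => /eqP.
Qed.

End unit_circle_more.

(** * Trigonometric polynomials *)

Notation freq d := {ffun 'I_d -> int}.

Section characters.
Context {R : realType} {d : nat}.
Local Notation C := R[i].
Local Notation X := (Rd R d).
Local Notation D := (@torus R d).
Implicit Types (k l : freq d) (x : X).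

Definition chi k x : C := cis (dot k x).

Lemma chiD k l x : chi (k + l) x = chi k x * chi l x.
Proof.
rewrite /chi -cisD /dot -big_split /=; congr cis; apply: eq_bigr => j _.
by rewrite ffunE rmorphD mulrDl.
Qed.

Lemma chiN k x : chi (- k) x = conjc (chi k x).
Proof.
rewrite /chi -cisN /dot -sumrN; congr cis; apply: eq_bigr => j _.
by rewrite ffunE rmorphN mulNr.
Qed.

Lemma chi0 x : chi 0 x = 1.
Proof. by rewrite /chi /dot big1 ?cis0// => j _; rewrite ffunE mul0r. Qed.

Lemma cabs_chi k x : cabs (chi k x) = 1. Proof. exact: cabs_cis. Qed.

Lemma measurable_dot k : measurable_fun D (fun x => dot k x).
Proof.
rewrite /dot; elim: (index_enum _) => [|j r IH].
  by under eq_fun do rewrite big_nil; exact: measurable_cst.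
under eq_fun do rewrite big_cons.
apply: (measurable_funD _ IH).
apply: (measurable_funM (measurable_cst _)).
by have := @measurable_coord R d j; exact: measurable_funTS.
Qed.

Lemma cbounded_chi k : cbounded (chi k).
Proof.
split; last by exists 1 => x _; rewrite cabs_chi.
have md := measurable_dot k; split.
  exact: (measurableT_comp (continuous_measurable_fun (@continuous_cos R)) md).
exact: (measurableT_comp (continuous_measurable_fun (@continuous_sin R)) md).
Qed.

(** * Orthogonality of the characters, by Riemann sums *)

Section orthogonality.
Variables (M : nat) (k : freq d).
Hypothesis kM : forall j, (`|k j| < M.+1)%N.
Local Notation N := M.+1.
Let h : R := 2 * pi / N%:R.

Let corner (v : {ffun 'I_d -> 'I_N}) (j : 'I_d) : R := - pi + (v j)%:R * h.

(** On the torus the quotient lies in [[0, N)], so that [inord] is exact there. *)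
Let cellidx (t : R) : 'I_N := inord (Num.truncn ((t + pi) / h)).

Let box (v : {ffun 'I_d -> 'I_N}) : set X :=
  [set x | forall j, Defs.coord x j \in `[corner v j, corner v j + h[].

Let h_gt0 : 0 < h. Proof. by rewrite divr_gt0 ?mulr_gt0 ?pi_gt0. Qed.

Let Nh : N%:R * h = 2 * pi. Proof. by rewrite /h mulrC mulfVK// pnatr_eq0. Qed.

Let mbox v : measurable (box v).
Proof. by apply: measurable_Rd; exact: measurable_box. Qed.

Let box_torus v : box v `<=` D.
Proof.
move=> x xv j; have := xv j; rewrite !in_itv /= => /andP[h1 h2].
have vN : (v j)%:R * h + h <= 2 * pi.
  have -> : (v j)%:R * h + h = (v j).+1%:R * h by rewrite -natr1 mulrDl mul1r.
  by rewrite -Nh ler_pM2r// ler_nat ltn_ord.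
have v0 : 0 <= (v j)%:R * h by rewrite mulr_ge0// ltW.
move: h1 h2; rewrite /corner; set c := (v j)%:R * h in vN v0 *.
by move=> h1 h2; apply/andP; split; lra.
Qed.

Let box_cell x v : D x -> (box v x <-> v = [ffun j => cellidx (Defs.coord x
  j)]).
Proof.
move=> Dx; split=> [xv|->].
  apply/ffunP => j; rewrite ffunE; apply/val_inj.
  have := xv j; rewrite in_itv /= => /andP[h1 h2].
  rewrite /cellidx (_ : Num.truncn _ = v j) ?inordK//.
  apply: truncn_def; rewrite ler_pdivlMr// ltr_pdivrMr//.
  move: h1 h2; rewrite /corner -natr1 mulrDl mul1r.
  set c := (v j)%:R * h => h1 h2; apply/andP; split; lra.
move=> j; rewrite /corner ffunE; set t := Defs.coord x j.
have := Dx j; rewrite -/t !in_itv /= => /andP[t1 t2].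
have u0 : 0 <= (t + pi) / h by rewrite divr_ge0 ?(ltW h_gt0)//; lra.
have uN : (Num.truncn ((t + pi) / h) < N)%N.
  by rewrite truncn_lt_nat// ltr_pdivrMr// Nh; lra.
rewrite /cellidx inordK//; have := truncn_itv u0; set n := Num.truncn _.
rewrite ler_pdivlMr// ltr_pdivrMr// -natr1 mulrDl mul1r.
by set c := n%:R * h => /andP[h1 h2]; apply/andP; split; lra.
Qed.

Let mu_box v : lebesgue (box v) = (h ^+ d)%:E.
Proof.
rewrite [LHS](@lebesgue_box R d (corner v) (fun j => corner v j + h)).
  congr EFin; rewrite -[X in _ ^+ X]card_ord -prodr_const;
    apply: eq_bigr => j _.
  by rewrite addrC addKr.
by move=> j; rewrite lerDl ltW.
Qed.

Let val v : C := cis (\sum_(j < d) (k j)%:~R * corner v j).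

Let indbox v (x : X) : C := (\1_(box v) x)%:C%C.

Let bm_ind v : bounded_measurable (\1_(box v) : X -> R).
Proof.
split; first exact: measurable_indic.
by exists 1 => x _; rewrite indicE; case: (_ \in _); rewrite ?normr1 ?normr0.
Qed.

Let cb_ind v : cbounded (indbox v).
Proof.
split; first by apply: cmeasurable_real; case: (bm_ind v).
by exists 1 => x _; rewrite cabs_real indicE; case: (_ \in _);
  rewrite ?normr1 ?normr0.
Qed.

Let int_ind v : cintegral (indbox v) = (h ^+ d)%:C%C.
Proof.
apply: complex_eqP => /=.
  apply: EFin_inj; rewrite -(EFin_J (bm_ind v)) integral_indic// -(mu_box v).
  by congr lebesgue; rewrite setIidl.
by rewrite J_cst mul0r.
Qed.

Let step x : C := \sum_v val v * indbox v x.

Let step_val x : D x -> step x = val [ffun j => cellidx (Defs.coord x j)].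
Proof.
move=> Dx; rewrite /step (bigD1 [ffun j => cellidx (Defs.coord x j)])//= big1.
  rewrite addr0 /indbox indicE mem_set ?mulr1//.
  by apply/(box_cell _ Dx).
move=> v vx; rewrite /indbox indicE memNset ?mulr0//.
by move/(box_cell _ Dx)/eqP; rewrite (negbTE vx).
Qed.

Let chi_step x : D x ->
  cabs (chi k x - step x) <= (\sum_(j < d) `|(k j)%:~R|) * h.
Proof.
move=> Dx; rewrite (step_val Dx) /chi /val;
  apply: le_trans (cis_lipschitz _ _) _.
rewrite /dot -sumrB mulr_suml; apply: le_trans (ler_norm_sum _ _ _) _.
apply: ler_sum => j _; rewrite -mulrBr normrM ler_wpM2l//.
have /(_ j) := (box_cell [ffun j => cellidx (Defs.coord x j)] Dx).2 erefl.
rewrite in_itv /= => /andP[h1 h2].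
by rewrite ger0_norm ?subr_ge0// lerBlDl ltW.
Qed.

(** The sum over the corners factors into one-variable sums over the [N]-th roots of unity, and a
    factor with [k j != 0] vanishes because [|k j| < N]. *)
Let int_step : k != 0 -> cintegral step = 0.
Proof.
move=> k0; rewrite /step.
rewrite (@cintegral_sum _ _ _ _ (fun v x => val v * indbox v x)); last first.
  by move=> v; apply: cbounded_integrable; exact: cboundedZ.
under eq_bigr => v _ do rewrite (cintegralZ _ (cbounded_integrable (cb_ind
  v))) int_ind.
rewrite -mulr_suml; apply/eqP; rewrite mulf_eq0; apply/orP; left; apply/eqP.
pose F (j : 'I_d) (l : 'I_N) : C :=
  cis (- ((k j)%:~R * pi)) * cis (l%:R * (2 * pi * (k j)%:~R / N%:R)).
transitivity (\sum_(v : {ffun 'I_d -> 'I_N}) \prod_j F j (v j)).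
  apply: eq_bigr => v _; rewrite /val (big_morph (@cis R) cisD cis0).
  apply: eq_bigr => j _; rewrite /F -cisD; congr cis.
  rewrite /corner mulrDr mulrN mulrCA; congr (_ + _ * _).
  by rewrite /h [RHS]mulrAC mulrC.
rewrite -(bigA_distr_bigA F).
have [j kj] : exists j, k j != 0.
  apply/existsP; apply: contraR k0 => /existsPn kz.
  by apply/eqP/ffunP => j; have := kz j; rewrite negbK ffunE => /eqP.
apply/eqP/prodf_eq0; exists j => //; rewrite /F -mulr_sumr.
by rewrite sum_roots_of_unity// (negbTE kj) mulr0.
Qed.

(** On each of the [N ^ d] boxes of side [h], the character is compared with its value at the
    corner. The step function has integral exactly 0, so that only the error of the comparison
    remains; the measure of boxes is all that is used about [lebesgue]. *)
Lemma cabs_cintegral_chi_le : k != 0 ->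
  cabs (cintegral (chi k)) <= (2 * pi) ^+ d * (\sum_(j < d) `|(k j)%:~R|) * (2
    * pi / M.+1%:R).
Proof.
rewrite -/h => k0; have bs : cbounded step.
  by apply: cbounded_sum => v; exact: cboundedZ.
have bd := cboundedB (cbounded_chi k) bs.
rewrite -[cintegral _]subr0 -(int_step k0).
have -> : cintegral (chi k) - cintegral step = cintegral (fun x => chi k x -
  step x).
  have := cintegralD (cbounded_integrable bd) (cbounded_integrable bs).
  under eq_cintegral do rewrite subrK.
  by move=> ->; rewrite addrK.
apply: le_trans (ler_cabs_cintegral (cbounded_integrable bd)) _.
rewrite -mulrA mulrC -J_cst.
by apply: (le_J (cbounded_cabs bd) (bounded_measurable_cst _)) => x;
  exact: chi_step.
Qed.

End orthogonality.

Lemma cintegral_chi k :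
  cintegral (chi k) = if k == 0 then ((2 * pi) ^+ d)%:C%C else 0.
Proof.
have [->|k0] := eqVneq k 0.
  rewrite -[RHS]mulr1 -cintegral_cst; apply: eq_cintegral => x _; exact: chi0.
apply: cabs_eq0; apply/eqP; rewrite eq_le cabs_ge0 andbT leNgt;
  apply/negP => c0.
set c := cabs _ in c0.
set K := (2 * pi) ^+ d * (\sum_(j < d) `|(k j)%:~R|) * (2 * pi) : R.
have pi0 := @pi_gt0 R.
have K0 : 0 <= K by rewrite !mulr_ge0 ?exprn_ge0 ?sumr_ge0 ?mulr_ge0// ltW.
(* The maximum provides [|k j| < M.+1], the second summand [K / M.+1 < c]. *)
pose M := (\max_j `|k j| + Num.truncn (K / c))%N.
have kM j : (`|k j| < M.+1)%N   by rewrite ltnS (leq_trans (@leq_bigmax _ (fun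
  j => `|k j|%N) j)) ?leq_addr.
have := cabs_cintegral_chi_le kM k0; rewrite -/c mulrA -/K.
rewrite ler_pdivlMr// mulrC -ler_pdivlMr// leNgt => /negP; apply.
have /andP[_ /lt_le_trans] := truncn_itv (divr_ge0 K0 (ltW c0)); apply.
by rewrite ler_nat ltnS leq_addl.
Qed.

End characters.

(** * Multiplier bounds in [L^(2m)] *)

Section pointwise.
Context {R : realType}.
Local Notation C := R[i].
Implicit Types (a b y : R) (z F H : C).

Lemma expr_tangent_le a b n : 0 <= a -> 0 <= b ->
  b ^+ n + n%:R * b ^+ n.-1 * (a - b) <= a ^+ n.
Proof.
move=> a0 b0; elim: n => [|[|n] IH]; first by rewrite mul0r mul0r addr0.
  by rewrite /= !expr1 expr0 !mul1r addrC subrK.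
have h := ler_wpM2l a0 IH; rewrite -exprS in h; apply: le_trans h.
rewrite -subr_ge0.
have -> : a * (b ^+ n.+1 + n.+1%:R * b ^+ n.+1.-1 * (a - b)) -
   (b ^+ n.+2 + n.+2%:R * b ^+ n.+2.-1 * (a - b)) =
   n.+1%:R * b ^+ n * (a - b) ^+ 2.
  by rewrite /= -(natr1 n.+1) !exprS; ring.
by apply: mulr_ge0; [rewrite mulr_ge0// exprn_ge0|exact: sqr_ge0].
Qed.

(** The tangent at the mean [s] lies below the graph of [t ^+ n], and its weighted average is
    [s ^+ n]. *)
Lemma jensen_expr (I : Type) (r : seq I) (w a : I -> R) n :
  (forall i, 0 <= w i) -> (forall i, 0 <= a i) -> \sum_(i <- r) w i = 1 ->
  (\sum_(i <- r) w i * a i) ^+ n <= \sum_(i <- r) w i * a i ^+ n.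
Proof.
move=> w0 a0 w1; set s := \sum_(i <- r) w i * a i.
have s0 : 0 <= s by apply: sumr_ge0 => i _; exact: mulr_ge0.
apply: (@le_trans _ _ (\sum_(i <- r) w i * (s ^+ n + n%:R * s ^+ n.-1 * (a i -
  s)))).
  rewrite (eq_bigr (fun i => w i * (s ^+ n - n%:R * s ^+ n.-1 * s) +
      w i * a i * (n%:R * s ^+ n.-1))); last by move=> i _; ring.
  by rewrite big_split /= -!mulr_suml w1 -/s mul1r [s * _]mulrC subrK.
by apply: ler_sum => i _; rewrite ler_wpM2l// expr_tangent_le.
Qed.

Lemma exprD_le2 a b n : 0 <= a -> 0 <= b ->
  (a + b) ^+ n <= 2 ^+ n * (a ^+ n + b ^+ n).
Proof.
move=> a0 b0; wlog ab : a b a0 b0 / a <= b.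
  by move=> h; case/orP : (le_total a b) => ?;
    [|rewrite addrC [X in _ * X]addrC]; exact: h.
apply: (@le_trans _ _ ((2 * b) ^+ n)).
  by rewrite lerXn2r ?nnegrE ?addr_ge0 ?mulr_ge0//; lra.
by rewrite exprMn ler_wpM2l ?exprn_ge0// lerDr exprn_ge0.
Qed.

Lemma cabs_exprB1_le z n : cabs ((1 + z) ^+ n - 1) <= (1 + cabs z) ^+ n - 1.
Proof.
elim: n => [|n IH]; first by rewrite !expr0 !subrr cabs0.
have -> : (1 + z) ^+ n.+1 - 1 = (1 + z) * ((1 + z) ^+ n - 1) + z.
  by rewrite exprS; ring.
apply: le_trans (ler_cabsD _ _) _; rewrite cabsM.
have h : cabs (1 + z) <= 1 + cabs z by rewrite (le_trans (ler_cabsD _ _))//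
  cabs1.
have := ler_pM (cabs_ge0 _) (cabs_ge0 _) h IH.
by rewrite exprS; set u := _ ^+ n; set v := cabs z; lra.
Qed.

(** An elementary substitute for an exponential bound: [(1 + y)^n <= 3 / 2] as soon as
    [n * y <= 1 / 3]. *)
Lemma expr1D_mul_le1 y n : 0 <= y -> (1 + y) ^+ n * (1 - n%:R * y) <= 1.
Proof.
move=> y0; elim: n => [|n IH]; first by rewrite expr0 mul0r subr0 mul1r.
apply: le_trans IH; rewrite exprSr -mulrA ler_wpM2l ?exprn_ge0 ?addr_ge0//.
rewrite -natr1; have : 0 <= n%:R * y ^+ 2 by rewrite mulr_ge0 ?sqr_ge0.
have := sqr_ge0 y; rewrite !expr2; set m := n%:R; lra.
Qed.

(* If [w = F + H] is small with respect to [F], then [F * conj H] is close to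
   [- |F|^2]; otherwise [|F|] and [|H|] are controlled by [|w|]. *)
Lemma riesz_pointwise F H m : (0 < m)%N ->
  cabs F ^+ (2 * m) <= 3 * (4 * m)%:R ^+ (2 * m) * cabs (F + H) ^+ (2 * m) +
    2 * ((-1) ^+ m * complex.Re ((F * conjc H) ^+ m)).
Proof.
move=> m0; have mR : 1 <= m%:R :> R by rewrite ler1n.
set w := F + H.
(* Below the threshold [3 m |w|], both [|F|] and [|H|] are at most [4 m |w|]. Then [|F|^(2m)] and
   the term that is doubled are at most [B] in absolute value, and [3 = 1 + 2]. *)
have [Fw|Fw] := leP (cabs F) (3 * m%:R * cabs w).
  have F4 : cabs F <= (4 * m)%:R * cabs w.
    apply: le_trans Fw _; rewrite ler_wpM2r ?cabs_ge0// natrM; lra.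
  have H4 : cabs H <= (4 * m)%:R * cabs w.
    have -> : H = w - F by rewrite /w addrC addKr.
    apply: le_trans (ler_cabsB _ _) _.
    have : cabs w <= m%:R * cabs w by rewrite ler_peMl ?cabs_ge0.
    rewrite natrM; move: Fw; set W := cabs w; set G := cabs F; lra.
  set B := (4 * m)%:R ^+ (2 * m) * cabs w ^+ (2 * m).
  have b1 : cabs F ^+ (2 * m) <= B.
    by rewrite /B -exprMn lerXn2r ?nnegrE ?mulr_ge0 ?cabs_ge0.
  have b2 : `|(-1) ^+ m * complex.Re ((F * conjc H) ^+ m)| <= B.
    rewrite normrM normrX normrN1 expr1n mul1r.
    apply: le_trans (normr_Re _) _; rewrite cabsX cabsM cabs_conj.
    rewrite /B -exprMn exprM lerXn2r ?nnegrE ?mulr_ge0 ?cabs_ge0 ?sqr_ge0//.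
    by rewrite expr2 ler_pM ?cabs_ge0.
  move: b2; rewrite ler_norml => /andP[b2 _].
  by move: b1 b2; rewrite -mulrA -/B; set U := cabs F ^+ _;
    set V := (-1) ^+ m * _; lra.
have F0 : 0 < cabs F by rewrite (le_lt_trans _ Fw)// !mulr_ge0 ?cabs_ge0.
(* Since [H = w - F], this makes [F * conj H] equal to [- |F|^2 (1 - z)], with [m |z| <= 1 / 3]
   above the threshold. *)
set z := F * conjc w / (cabs F ^+ 2)%:C%C.
have FF : ((cabs F ^+ 2)%:C%C : C) != 0.
  apply/eqP => /(congr1 (@complex.Re _)) /= /eqP.
  by rewrite expf_eq0 /= gt_eqF.
have cz : cabs z = cabs w / cabs F.
  rewrite cabsM cabsV cabs_real cabsM cabs_conj ger0_norm ?sqr_ge0// expr2.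
  by rewrite invfM mulrAC mulrA mulfV ?gt_eqF// mul1r mulrC.
have mz : m%:R * cabs z <= 1 / 3.
  by rewrite cz mulrA ler_pdivrMr//; move: Fw; lra.
have E : F * conjc H = - (cabs F ^+ 2)%:C%C * (1 - z).
  have -> : H = w - F by rewrite /w addrC addKr.
  rewrite mulrBr mulr1 mulNr opprK /z [_ * (_ / _)]mulrC mulfVK//.
  by rewrite rmorphB mulrBr mulc_conj addrC.
(* [|(1 - z)^m - 1| <= (1 + |z|)^m - 1 <= 3 / 2 - 1]. *)
have b : 1 / 2 <= complex.Re ((1 - z) ^+ m).
  have := le_trans (normr_Re _) (cabs_exprB1_le (- z) m).
  rewrite cabsN cReD cReN /= ler_norml => /andP[h _].
  have h2 := expr1D_mul_le1 m (cabs_ge0 z).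
  have h3 : (1 + cabs z) ^+ m * (2 / 3) <= 1.
    apply: le_trans h2; rewrite ler_wpM2l ?exprn_ge0 ?addr_ge0 ?cabs_ge0//; lra.
  by move: h h3; set u := _ ^+ m; lra.
have -> : (-1) ^+ m * complex.Re ((F * conjc H) ^+ m) =
    cabs F ^+ (2 * m) * complex.Re ((1 - z) ^+ m).
  have -> : F * conjc H = (- 1) * ((cabs F ^+ 2)%:C%C * (1 - z)).
    by rewrite mulN1r -mulNr.
  rewrite !exprMn.
  have -> : ((-1) ^+ m : C) = ((-1) ^+ m)%:C%C by rewrite rmorphXn rmorphN1.
  by rewrite -rmorphXn !cReZ signrMK -exprM.
have Fm : 0 <= cabs F ^+ (2 * m) by rewrite exprn_ge0 ?cabs_ge0.
have Wm : 0 <= 3 * (4 * m)%:R ^+ (2 * m) * cabs w ^+ (2 * m).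
  by rewrite !mulr_ge0 ?exprn_ge0 ?cabs_ge0.
rewrite -[leLHS]add0r lerD// mulrCA -[leLHS]mulr1 ler_wpM2l//; lra.
Qed.

End pointwise.

(** * Trigonometric polynomials as lists of terms, and their multipliers *)

Section trigpoly.
Context {R : realType} {d : nat}.
Local Notation C := R[i].
Local Notation X := (Rd R d).
Local Notation D := (@torus R d).
Local Notation trig := (seq (C * freq d)).
Implicit Types (p q : trig) (k l : freq d) (x : X) (lam : freq d -> C) (j :
  'I_d).

(** Frequencies may be repeated in the list: terms are never collected, so that products, conjugates
    and multipliers act term by term, and [mean] sums over all the terms of frequency 0. *)
Definition ev p x : C := \sum_(t <- p) t.1 * chi t.2 x.

Definition mean p : C := \sum_(t <- p | t.2 == 0) t.1.

Definition mulp p q : trig := [seq (a.1 * b.1, a.2 + b.2) | a <- p, b <- q].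

Definition conjp p : trig := [seq (conjc t.1, - t.2) | t <- p].

Definition expp p n : trig := iter n (mulp p) [:: (1, 0)].

Definition mult lam p : trig := [seq (lam t.2 * t.1, t.2) | t <- p].

Lemma cbounded_ev p : cbounded (ev p).
Proof. by apply: cbounded_sum => t; exact: cboundedZ (cbounded_chi _). Qed.

Lemma cintegral_ev p : cintegral (ev p) = ((2 * pi) ^+ d)%:C%C * mean p.
Proof.
have ic k := cbounded_integrable (@cbounded_chi R d k).
rewrite /ev (@cintegral_sum _ _ _ _ (fun (t : C * freq d) x => t.1 * chi t.2
  x)); last first.
  by move=> t; exact: cintegrableZ.
rewrite /mean mulr_sumr [RHS]big_mkcond; apply: eq_bigr => t _.
by rewrite cintegralZ// cintegral_chi mulrC; case: eqP; rewrite ?mul0r.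
Qed.

Lemma ev_cat p q x : ev (p ++ q) x = ev p x + ev q x.
Proof. exact: big_cat. Qed.

Lemma ev_mul p q x : ev (mulp p q) x = ev p x * ev q x.
Proof.
rewrite /ev big_allpairs_dep mulr_suml; apply: eq_bigr => a _.
rewrite mulr_sumr; apply: eq_bigr => b _ /=.
by rewrite chiD mulrACA.
Qed.

Lemma ev_conj p x : ev (conjp p) x = conjc (ev p x).
Proof.
rewrite /ev big_map cconj_sum; apply: eq_bigr => t _ /=.
by rewrite chiN cconjM.
Qed.

Lemma ev_exp p n x : ev (expp p n) x = ev p x ^+ n.
Proof.
elim: n => [|n IH]; first by rewrite /ev /= big_seq1 chi0 mulr1.
by rewrite exprS -IH -ev_mul.
Qed.

Lemma mult_mulp lam p q : (forall k l, lam (k + l) = lam k * lam l) ->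
  mulp (mult lam p) (mult lam q) = mult lam (mulp p q).
Proof.
move=> lamD; rewrite /mulp /mult allpairs_mapl allpairs_mapr map_allpairs.
by apply: eq_allpairs => a b /=; rewrite lamD mulrACA.
Qed.

Lemma mult_conjp lam p : (forall k, lam (- k) = conjc (lam k)) ->
  conjp (mult lam p) = mult lam (conjp p).
Proof.
move=> lamN; rewrite /conjp /mult -!map_comp; apply: eq_map => t /=.
by rewrite lamN cconjM.
Qed.

Lemma mean_mult lam p : lam 0 = 1 -> mean (mult lam p) = mean p.
Proof.
move=> lam0; rewrite /mean big_map /=; apply: eq_bigr => t /eqP ->.
by rewrite lam0 mul1r.
Qed.

Definition intpow p n : R := J (fun x => cabs (ev p x) ^+ n).

Lemma bm_cabs_ev p n : bounded_measurable (fun x => cabs (ev p x) ^+ n).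
Proof. exact/bounded_measurableX/cbounded_cabs/cbounded_ev. Qed.

Lemma intpow_ge0 p n : 0 <= intpow p n.
Proof. by apply: J_ge0 => x _; rewrite exprn_ge0 ?cabs_ge0. Qed.

Lemma intpow_even p m :
  intpow p (2 * m) = (2 * pi) ^+ d * complex.Re (mean (expp (mulp p (conjp p))
    m)).
Proof.
rewrite -cReZ -cintegral_ev /=; apply: eq_Rintegral => x _.
by rewrite ev_exp ev_mul ev_conj mulc_conj exprM -rmorphXn.
Qed.

(** Such a [lam] is a unitary character of the group of frequencies, and the multiplier is a
    translation. It commutes with products and conjugation and fixes the constant term of
    [(p * conj p)^m], which is the even moment: translation invariance is obtained without moving
    the domain of integration. *)
Lemma intpow_character lam p m :
  (forall k l, lam (k + l) = lam k * lam l) ->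
  (forall k, lam (- k) = conjc (lam k)) -> lam 0 = 1 ->
  intpow (mult lam p) (2 * m) = intpow p (2 * m).
Proof.
move=> lamD lamN lam0; rewrite !intpow_even; congr (_ * complex.Re _).
rewrite mult_conjp// mult_mulp//.
suff -> : forall q, expp (mult lam q) m = mult lam (expp q m) by exact:
  mean_mult.
move=> q; elim: m => [|m IH]; first by rewrite /= lam0 mul1r.
by rewrite /= -mult_mulp// -IH.
Qed.

(** The constant [c] bounds the [n]-th power of the norm in [L^n], which avoids taking roots. *)
Definition bounded_mult n c lam :=
  forall p, intpow (mult lam p) n <= c * intpow p n.

Lemma ev_multE lam p x : ev (mult lam p) x = \sum_(t <- p) lam t.2 * (t.1 *
  chi t.2 x).
Proof. by rewrite /ev big_map; apply: eq_bigr => t _; rewrite mulrA. Qed.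

Lemma bounded_mult_ext n c lam lam' : lam =1 lam' ->
  bounded_mult n c lam -> bounded_mult n c lam'.
Proof.
move=> e h p; suff -> : mult lam' p = mult lam p by exact: h.
by apply: eq_map => t; rewrite e.
Qed.

Lemma bounded_mult_comp n c c' lam lam' : 0 <= c ->
  bounded_mult n c lam -> bounded_mult n c' lam' ->
  bounded_mult n (c * c') (fun k => lam k * lam' k).
Proof.
move=> c0 h h' p; rewrite -mulrA.
have -> : mult (fun k => lam k * lam' k) p = mult lam (mult lam' p).
  by rewrite /mult -map_comp; apply: eq_map => t /=; rewrite mulrA.
by apply: le_trans (h _) _; rewrite ler_wpM2l.
Qed.

Lemma bounded_mult_le n c c' lam : c <= c' ->
  bounded_mult n c lam -> bounded_mult n c' lam.
Proof. by move=> cc h p; rewrite (le_trans (h p))// ler_wpM2r ?intpow_ge0. Qed.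

Lemma bounded_multB n c c' lam lam' :
  bounded_mult n c lam -> bounded_mult n c' lam' ->
  bounded_mult n (2 ^+ n * (c + c')) (fun k => lam k - lam' k).
Proof.
move=> h h' p; rewrite -mulrA mulrDl.
apply: (@le_trans _ _ (2 ^+ n * (intpow (mult lam p) n + intpow (mult lam' p)
  n))).
  have b1 := bm_cabs_ev (mult lam p) n; have b2 := bm_cabs_ev (mult lam' p) n.
  rewrite /intpow -(JD b1 b2) -(JZ _ (bounded_measurableD b1 b2)).
  apply: (le_J (bm_cabs_ev _ _)).
    exact: (bounded_measurableZ _ (bounded_measurableD b1 b2)).
  move=> x _; have -> : ev (mult (fun k => lam k - lam' k) p) x =
      ev (mult lam p) x - ev (mult lam' p) x.
    by rewrite !ev_multE -sumrB; apply: eq_bigr => t _; rewrite mulrBl.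
  apply: le_trans (exprD_le2 _ (cabs_ge0 _) (cabs_ge0 _)).
  by rewrite lerXn2r ?nnegrE ?addr_ge0 ?cabs_ge0// ler_cabsB.
by rewrite ler_wpM2l ?exprn_ge0// lerD.
Qed.

(** Jensen's inequality for the [n]-th power is applied pointwise, before integration, so that [c]
    is not degraded by the number of terms. *)
Lemma bounded_mult_convex (I : Type) (r : seq I) (w : I -> R) n c
    (lam : I -> freq d -> C) :
  (forall i, 0 <= w i) -> \sum_(i <- r) w i = 1 ->
  (forall i, bounded_mult n c (lam i)) ->
  bounded_mult n c (fun k => \sum_(i <- r) (w i)%:C%C * lam i k).
Proof.
move=> w0 w1 h p.
have bi i := bounded_measurableZ (w i) (bm_cabs_ev (mult (lam i) p) n).
apply: (@le_trans _ _ (\sum_(i <- r) w i * intpow (mult (lam i) p) n)).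
  have -> : \sum_(i <- r) w i * intpow (mult (lam i) p) n =
      J (fun x => \sum_(i <- r) w i * cabs (ev (mult (lam i) p) x) ^+ n).
    by rewrite (J_sum r bi); apply: eq_bigr => i _;
      rewrite -(JZ (w i) (bm_cabs_ev (mult (lam i) p) n)).
  apply: (le_J (bm_cabs_ev _ _) (bounded_measurable_sum r bi)) => x _.
  apply: le_trans (jensen_expr _ w0 (fun i => cabs_ge0 _) w1).
  rewrite lerXn2r ?nnegrE ?cabs_ge0//.
    by rewrite sumr_ge0// => i _; rewrite mulr_ge0 ?cabs_ge0.
  have -> : ev (mult (fun k => \sum_(i <- r) (w i)%:C%C * lam i k) p) x =
      \sum_(i <- r) (w i)%:C%C * ev (mult (lam i) p) x.
    rewrite ev_multE; under eq_bigr do rewrite mulr_suml.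
    rewrite exchange_big /=; apply: eq_bigr => i _.
    by rewrite ev_multE mulr_sumr; apply: eq_bigr => t _; rewrite -mulrA.
  apply: le_trans (ler_cabs_sum _ _ _) _; apply: ler_sum => i _.
  by rewrite cabsZ.
have -> : c * intpow p n = \sum_(i <- r) w i * (c * intpow p n).
  by rewrite -mulr_suml w1 mul1r.
by apply: ler_sum => i _; rewrite ler_wpM2l ?w0 ?h.
Qed.

Lemma mean_eq0 p j : all (fun t : C * freq d => 0 < t.2 j) p -> mean p = 0.
Proof.
move=> /allP h; rewrite /mean big_seq_cond big1// => t /andP[tp /eqP t0].
by have := h t tp; rewrite t0 ffunE ltxx.
Qed.

Lemma all_expp j p m : all (fun t : C * freq d => 0 < t.2 j) p ->
  all (fun t : C * freq d => 0 < t.2 j) (expp p m.+1).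
Proof.
move=> /allP h; apply/allP; elim: m => [|m IH] t.
  by move=> /allpairsP[[a b]] /= [/h a0]; rewrite inE => /eqP -> -> /=;
    rewrite ffunE ffunE addr0.
move=> /allpairsP[[a b]] /= [/h a0 /IH b0 ->] /=; rewrite ffunE.
exact: addr_gt0.
Qed.

Lemma bounded_mult_halfspace j (a : int) m : (0 < m)%N ->
  bounded_mult (2 * m) (3 * (4 * m)%:R ^+ (2 * m)) (fun k => if a <= k j then
    1 else 0).
Proof.
move=> m0 p.
set q := [seq t : C * freq d <- p | a <= t.2 j];
  set q' := [seq t : C * freq d <- p | ~~ (a <= t.2 j)].
have Eq x : ev (mult (fun k => if a <= k j then 1 else 0) p) x = ev q x.
  rewrite ev_multE /ev big_filter [RHS]big_mkcond; apply: eq_bigr => t _.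
  by case: (a <= _); rewrite ?mul1r ?mul0r.
have Ep x : ev p x = ev q x + ev q' x.
  by rewrite /ev !big_filter [LHS](bigID (fun t : C * freq d => a <= t.2 j)).
set g := fun x => (-1) ^+ m * complex.Re ((ev q x * conjc (ev q' x)) ^+ m).
have gE x : g x = (-1) ^+ m * complex.Re (ev (expp (mulp q (conjp q')) m) x).
  by rewrite ev_exp ev_mul ev_conj.
have bg : bounded_measurable g.
  rewrite (funext gE).
  exact/bounded_measurableZ/cbounded_Re/cbounded_ev.
have g0 : J g = 0.
  transitivity (J (fun x => (-1) ^+ m * complex.Re (ev (expp (mulp q (conjp
    q')) m) x))).
    by apply: eq_Rintegral => x _; rewrite gE.
  rewrite (JZ _ (cbounded_Re (cbounded_ev _))).
  rewrite -[X in _ * X = _]/(complex.Re (cintegral (ev (expp (mulp q (conjp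
    q')) m)))).
  rewrite cintegral_ev (@mean_eq0 _ j) ?mulr0//=.
  (* A term of [q * conj q'] has [j]-th frequency [u j - v j > 0], because [v j < a <= u j].
     Positivity is inherited by the power, since [m > 0]. *)
  rewrite -(prednK m0); apply: all_expp;
    apply/allP => t /allpairsP[[u v]] /= [].
  rewrite mem_filter => /andP[ua _] /mapP[v' + ->].
  rewrite mem_filter -ltNge => /andP[va _] -> /=.
  by rewrite !ffunE subr_gt0 (lt_le_trans va).
(* The null integral of [g], added twice on the right, turns the claim into the integral of
   [riesz_pointwise]. *)
rewrite -[leRHS]addr0; have -> : 0 = 2 * J g by rewrite g0 mulr0.
have b1 := bounded_measurableZ (3 * (4 * m)%:R ^+ (2 * m)) (bm_cabs_ev p (2 *
  m)).
have b2 := bounded_measurableZ 2 bg.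
rewrite /intpow -(JZ _ (bm_cabs_ev p (2 * m))) -(JZ _ bg) -(JD b1 b2).
apply: (le_J (bm_cabs_ev _ _) (bounded_measurableD b1 b2)) => x _.
by rewrite Eq Ep; exact: riesz_pointwise.
Qed.

(** The interval is the half-line from [-N] minus the half-line from [N + 1]. The constant absorbs
    [2^(2m) * (3 + 3) * (4m)^(2m)], using [6 <= 6^(2m)] and [2 * 6 * 4 = 48]. *)
Lemma bounded_mult_partial j (N : nat) m : (0 < m)%N ->
  bounded_mult (2 * m) ((48 * m)%:R ^+ (2 * m)) (fun k => if (`|k j| <= N)%N
    then 1 else 0).
Proof.
move=> m0.
have h := bounded_multB (bounded_mult_halfspace j (- N%:Z) m0)
  (bounded_mult_halfspace j N.+1%:Z m0).
apply: (bounded_mult_le _ (bounded_mult_ext _ h)).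
  have -> : (48 * m)%:R = 2 * 6 * (4 * m)%:R :> R by rewrite !natrM; ring.
  rewrite !exprMn -mulrA ler_wpM2l ?exprn_ge0//.
  rewrite -mulrDl ler_wpM2r ?exprn_ge0//.
  rewrite (_ : 3 + 3 = 6 :> R); last by ring.
  by rewrite -[leLHS]expr1 ler_weXn2l ?ler1n// muln_gt0.
move=> k /=.
have [hN|hN] := boolP (`|k j| <= N)%N.
  have -> : - N%:Z <= k j by lia.
  have -> : (N.+1%:Z <= k j) = false by lia.
  by rewrite subr0.
have [k0|k0] := lerP 0 (k j).
  have -> : - N%:Z <= k j by lia.
  have -> : (N.+1%:Z <= k j) by lia.
  by rewrite subrr.
have -> : (- N%:Z <= k j) = false by lia.
have -> : (N.+1%:Z <= k j) = false by lia.
by rewrite subrr.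
Qed.

End trigpoly.

(** * Fejer and logarithmic symbols in one variable *)

Section fejer.
Context {R : realType}.
Local Notation C := R[i].
Implicit Types (q : int) (N M n : nat).

(** The Fejer symbol [max (0, 1 - |q| / (N + 1))], as a normalized count of the pairs with
    [a - b = q]: this form shows that it is positive definite. *)
Definition fejer N q : R :=
  N.+1%:R^-1 * \sum_(a < N.+1) \sum_(b < N.+1) (q - a%:Z + b%:Z == 0)%:R.

(** Both sides are [max (0, N + 1 - |q|)]. The right one exhibits the Fejer mean as the average of
    the partial sums of orders 0 to [N]. *)
Lemma fejer_count N q : \sum_(a < N.+1) \sum_(b < N.+1) (q - a%:Z + b%:Z ==
  0)%:R =
  \sum_(0 <= s < N.+1) (if (`|q| <= s)%N then 1 else 0) :> R.
Proof.
rewrite exchange_big /=.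
transitivity (\sum_(b < N.+1) (if (0 <= q + b%:Z) && (q + b%:Z <= N%:Z) then 1
  else 0) : R).
  apply: eq_bigr => b _; case: ifP => h.
    have aN : (`|(q + b%:Z)%R| < N.+1)%N by lia.
    rewrite (bigD1 (Ordinal aN))//= big1 ?addr0.
      by have -> : (q - `|(q + b%:Z)%R|%:Z + b%:Z == 0)%R by lia.
    move=> a /eqP ab; have -> // : (q - a%:Z + b%:Z == 0) = false.
    by apply/negP => /eqP e; apply: ab; apply/val_inj => /=; lia.
  apply: big1 => a _; have -> // : (q - a%:Z + b%:Z == 0) = false.
  by have := ltn_ord a; move: h; lia.
rewrite big_mkord; have [q0|q0] := lerP 0 q.
  rewrite (reindex_inj rev_ord_inj) /=; apply: eq_bigr => b _.
  by have := ltn_ord b; case: ifP; case: ifP => //; lia.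
by apply: eq_bigr => b _; have := ltn_ord b; case: ifP; case: ifP => //; lia.
Qed.

Definition fejer_node M (l : nat) : R := 2 * pi * l%:R / M%:R.

(** The Fejer kernel at the node, divided by [M]: the inverse discrete Fourier transform of
    [fejer N]. *)
Definition fejer_weight N M l : R :=
  (M%:R * N.+1%:R)^-1 * cabs (\sum_(a < N.+1) cis (a%:R * - fejer_node M l) :
    C) ^+ 2.

Lemma fejer_weight_ge0 N M l : 0 <= fejer_weight N M l.
Proof.
apply: mulr_ge0; last exact: sqr_ge0.
by rewrite invr_ge0 mulr_ge0.
Qed.

(** The frequencies [q - a + b] are smaller than [M] in absolute value, so that no aliasing occurs:
    the sum over the nodes detects [q = a - b] exactly. *)
Lemma sum_fejer_weight N M q : (`|q| + N < M)%N ->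
  \sum_(l < M) (fejer_weight N M l)%:C%C * cis (q%:~R * fejer_node M l) =
  (fejer N q)%:C%C :> C.
Proof.
move=> qM; have M0 : (M%:R : C) != 0 by rewrite pnatr_eq0; lia.
transitivity (((M%:R * N.+1%:R)^-1 : R)%:C%C * \sum_(a < N.+1) \sum_(b < N.+1)
    \sum_(l < M) cis (l%:R * (2 * pi * (q - a%:Z + b%:Z)%:~R / M%:R)) : C).
  rewrite mulr_sumr; under [RHS]eq_bigr do rewrite mulr_sumr.
  under [RHS]eq_bigr do under eq_bigr do rewrite mulr_sumr.
  under [RHS]eq_bigr do rewrite exchange_big /=.
  rewrite [RHS]exchange_big /=; apply: eq_bigr => l _.
  under [RHS]eq_bigr do rewrite -mulr_sumr.
  rewrite -mulr_sumr /fejer_weight rmorphM /= -mulrA; congr (_ * _).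
  rewrite -mulc_conj cconj_sum mulr_suml mulr_suml; apply: eq_bigr => a _.
  rewrite mulr_sumr mulr_suml; apply: eq_bigr => b _.
  rewrite -cisN -!cisD; congr cis; rewrite /fejer_node.
  by rewrite rmorphD rmorphB /=; field; move: M0; rewrite !pnatr_eq0.
transitivity (((M%:R * N.+1%:R)^-1 : R)%:C%C * \sum_(a < N.+1) \sum_(b < N.+1)
    (M%:R * (q - a%:Z + b%:Z == 0)%:R)%:C%C : C).
  congr (_ * _); apply: eq_bigr => a _; apply: eq_bigr => b _.
  rewrite sum_roots_of_unity; last by have := ltn_ord a; have := ltn_ord b; lia.
  by case: eqP => _; rewrite ?mulr1 ?mulr0 ?natrC.
under eq_bigr do rewrite -rmorph_sum -mulr_sumr.
rewrite -rmorph_sum -mulr_sumr -rmorphM /fejer; congr (_%:C)%C.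
rewrite invfM mulrACA mulVf ?mul1r//.
by move: M0; rewrite !pnatr_eq0.
Qed.

Lemma fejer0 N : fejer N 0 = 1.
Proof.
rewrite /fejer fejer_count (eq_bigr (fun=> 1))//.
by rewrite big_mkord sumr_const card_ord mulVf// pnatr_eq0.
Qed.

Lemma sum_fejer_weight1 N M : (N < M)%N -> \sum_(l < M) fejer_weight N M l = 1
  :> R.
Proof.
move=> NM; have := @sum_fejer_weight N M 0; rewrite absz0 add0n => /(_ NM).
under eq_bigr do rewrite mul0r cis0 mulr1.
by rewrite -rmorph_sum fejer0 => /(congr1 (@complex.Re R)).
Qed.

Lemma logsum_gt0 n : 0 < logsum n :> R.
Proof.
rewrite /logsum big_nat_recl// ltr_pwDl ?invr_gt0//.
by apply: sumr_ge0 => i _; rewrite invr_ge0.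
Qed.

Definition logmult (nor : bool) n q : R :=
  (logsum n)^-1 * \sum_(0 <= i < n.+1)
    i.+1%:R^-1 * (if (`|q| <= (if nor then n - i else i))%N then 1 else 0).

Lemma logmult_ge0 nor n q : 0 <= logmult nor n q.
Proof.
rewrite /logmult mulr_ge0 ?invr_ge0 ?(ltW (logsum_gt0 n))//.
by apply: sumr_ge0 => i _; rewrite mulr_ge0 ?invr_ge0//; case: ifP.
Qed.

Lemma logmult_le1 nor n q : logmult nor n q <= 1.
Proof.
rewrite /logmult ler_pdivrMl ?logsum_gt0// mulr1; apply: ler_sum => i _.
by case: ifP; rewrite ?mulr1 ?mulr0 ?invr_ge0.
Qed.

Lemma logmult_eq0 nor n q : (n < `|q|)%N -> logmult nor n q = 0.
Proof.
move=> nq; rewrite /logmult big_nat big1 ?mulr0// => i /andP[_ ilt].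
by rewrite ifF ?mulr0//; case: nor; lia.
Qed.

(** At most [m] indices satisfy [P], and each weighs at most 1. *)
Lemma count_lt_sum (P : pred nat) (w : nat -> R) n m :
  (forall i, 0 <= w i <= 1) -> (forall i, (i < n)%N -> P i -> (i < m)%N) ->
  \sum_(0 <= i < n | P i) w i <= m%:R.
Proof.
move=> w01 Pm; apply: (@le_trans _ _ (\sum_(0 <= i < n | P i) 1)).
  by apply: ler_sum => i _; case/andP: (w01 i).
rewrite big_const_seq iter_addr addr0 ler_nat -size_filter.
rewrite -[leqRHS](size_iota 0); apply: uniq_leq_size.
  by rewrite filter_uniq// iota_uniq.
move=> i; rewrite mem_filter !mem_iota subn0 add0n => /andP[Pi /= iltn].
exact: Pm.
Qed.

(** The terms missing from the symbol have [i < |q|] in the Riesz case and [n - i < |q|] in the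
    Noerlund case. Either way there are at most [|q|] of them, with weights at most 1 before the
    division by [logsum n]. *)
Lemma logmult_ge nor n q : 1 - logmult nor n q <= `|q|%:R / logsum n.
Proof.
have l0 := logsum_gt0 n.
rewrite /logmult ler_pdivlMr// mulrBl mul1r mulrAC mulVf ?gt_eqF// mul1r.
rewrite /logsum -sumrB.
rewrite (eq_bigr (fun i => if ~~ (`|q| <= (if nor then n - i else i))%N
  then i.+1%:R^-1 else 0)); last first.
  by move=> i _; case: ifP => _; rewrite ?mulr1 ?mulr0 ?subrr ?subr0.
rewrite -big_mkcond /=.
have w01 i : 0 <= (i.+1%:R^-1 : R) <= 1.
  by rewrite invr_ge0 ler0n /= invf_le1 ?ler1n ?ltr0n.
case: nor; last by apply: count_lt_sum => // i; lia.
rewrite big_nat_rev /= add0n;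
  apply: (@count_lt_sum _ (fun i => (n.+1 - i.+1).+1%:R^-1)).
  by move=> i; exact: w01.
by move=> i; lia.
Qed.

(** Summation by parts of [1 / (i + 1)] against the partial sums, whose cumulated sums are [(i + 1)]
    times Fejer symbols: [(i + 1) * (1 / (i + 1) - 1 / (i + 2)) = 1 / (i + 2)], and the boundary
    term at [n] has coefficient 1. *)
Lemma riesz_logmult n q : logmult false n q =
  \sum_(0 <= i < n.+1) ((if (i < n)%N then i.+2%:R^-1 else 1) / logsum n) *
    fejer i q.
Proof.
rewrite /logmult mulr_sumr.
rewrite [RHS](eq_bigr (fun i => (logsum n)^-1 *
    ((if (i < n)%N then i.+2%:R^-1 else 1) * fejer i q))); last first.
  by move=> i _; rewrite mulrAC mulrC mulrA.
rewrite -!mulr_sumr; congr (_ * _).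
rewrite [RHS]big_nat_recr//= ltnn mul1r.
rewrite [X in _ = X + _](eq_big_nat _ _ (F2 := fun i => i.+2%:R^-1 * fejer i
  q)); last first.
  by move=> i /andP[_ ->].
elim: n => [|n IH].
  by rewrite big_nat1 big_nil add0r /fejer fejer_count big_nat1.
rewrite big_nat_recr//= IH [X in _ = X + _]big_nat_recr//= -!addrA;
  congr (_ + _).
rewrite /fejer !fejer_count [X in _ = _ + _ * X]big_nat_recr//=.
set A := \sum_(0 <= _ < _) _; set b := if _ then _ else _.
have n1 : (n.+1%:R : R) != 0 by rewrite pnatr_eq0.
have n2 : (n.+2%:R : R) != 0 by rewrite pnatr_eq0.
rewrite mulrDr addrA; congr (_ + _).
rewrite mulrA -mulrDl; congr (_ * _).
move: n1 n2; rewrite -[n.+2%:R]natr1; move: (n.+1%:R) => a a0 a1.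
by field; rewrite a0 a1.
Qed.

End fejer.

(** * The mixed symbol and its moment bounds *)

Section log_multiplier.
Context {R : realType} {d : nat}.
Local Notation C := R[i].
Local Notation X := (Rd R d).
Implicit Types (k : freq d) (j : 'I_d) (B : {set 'I_d}) (n : 'I_d -> nat).

(** On the finitely many frequencies of [p], the Fejer symbol is a convex combination of characters.
    The number [M] of nodes depends on [p], but the bound 1 does not. *)
Lemma bounded_mult_fejer j N m :
  bounded_mult (R := R) (2 * m) 1 (fun k : freq d => (fejer N (k j))%:C%C).
Proof.
move=> p; set mx := (\max_(t <- p) `|t.2 j|)%N; pose M := (N + mx + 1)%N.
pose L (l : 'I_M) k : C := cis ((k j)%:~R * fejer_node M l).
have -> : mult (fun k => (fejer N (k j))%:C%C) p =
    mult (fun k => \sum_(l < M) (fejer_weight N M l)%:C%C * L l k) p.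
  apply/eq_in_map => t tp; rewrite sum_fejer_weight//.
  have : (`|t.2 j| <= mx)%N.
    exact: (@leq_bigmax_seq _ p xpredT (fun t : C * freq d => `|t.2 j|%N)).
  by move=> h; rewrite /M addn1 ltnS addnC leq_add2l.
apply: (@bounded_mult_convex _ _ _ _ (fun l : 'I_M => fejer_weight N M l) _ _
  L).
- by move=> l; exact: fejer_weight_ge0.
- by apply: sum_fejer_weight1; rewrite /M; lia.
move=> l q; rewrite intpow_character ?mul1r//.
- by move=> k k'; rewrite /L ffunE rmorphD mulrDl cisD.
- by move=> k; rewrite /L ffunE rmorphN mulNr cisN.
- by rewrite /L ffunE mul0r cis0.
Qed.

Lemma bounded_mult_logmult nor j (n : nat) m : (0 < m)%N ->
  bounded_mult (2 * m) (if nor then (48 * m)%:R ^+ (2 * m) else 1)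
    (fun k : freq d => (logmult nor n (k j))%:C%C : C).
Proof.
move=> m0; have l0 := @logsum_gt0 R n; case: nor.
  apply: (@bounded_mult_ext _ _ _ _ (fun k => \sum_(i <- index_iota 0 n.+1)
    ((logsum n)^-1 * i.+1%:R^-1)%:C%C * (if (`|k j| <= n - i)%N then 1 else
      0))).
    move=> k; rewrite /logmult mulr_sumr rmorph_sum; apply: eq_bigr => i _.
    by rewrite mulrA [RHS]rmorphM; case: ifP.
  apply: bounded_mult_convex => [i||i].
  - by rewrite mulr_ge0 ?invr_ge0// ltW.
  - by rewrite -mulr_sumr mulVf// gt_eqF.
  - exact: bounded_mult_partial.
apply: (@bounded_mult_ext _ _ _ _ (fun k => \sum_(i <- index_iota 0 n.+1)
    ((if (i < n)%N then i.+2%:R^-1 else 1) / logsum n)%:C%C * (fejer i (k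
      j))%:C%C)).
  move=> k; rewrite riesz_logmult rmorph_sum; apply: eq_bigr => i _.
  by rewrite -rmorphM.
apply: bounded_mult_convex => [i||i].
- by rewrite divr_ge0 ?(ltW l0)//; case: ifP.
(* That the weights sum to 1 is read off the identity at frequency 0, where all the symbols are
   1. *)
- have := @riesz_logmult R n 0; under [in RHS]eq_bigr do rewrite fejer0 mulr1.
  move=> <-; rewrite /logmult; under eq_bigr do rewrite mulr1.
  by rewrite mulVf// gt_eqF.
- exact: bounded_mult_fejer.
Qed.

Definition mixed_mult (B : {set 'I_d}) (n : 'I_d -> nat) k : R :=
  \prod_(j < d) logmult (j \in B) (n j) (k j).

Lemma bounded_mult_mixed B n m : (0 < m)%N ->
  bounded_mult (2 * m) ((48 * m)%:R ^+ (2 * m) ^+ #|B|)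
    (fun k => (mixed_mult B n k)%:C%C : C).
Proof.
move=> m0; set c : 'I_d -> R := fun j => if j \in B then (48 * m)%:R ^+ (2 *
  m) else 1.
have -> : (48 * m)%:R ^+ (2 * m) ^+ #|B| = \prod_(j < d) c j.
  by rewrite /c -big_mkcond /= prodr_const.
rewrite /mixed_mult; elim: (index_enum _) => [|j r IH].
  move=> p; rewrite big_nil mul1r; under eq_fun do rewrite big_nil.
  rewrite (_ : mult _ p = p)//; rewrite /mult -[RHS]map_id.
  by apply: eq_map => -[a k] /=; rewrite rmorph1 mul1r.
rewrite big_cons.
apply: (@bounded_mult_ext _ _ _ _ (fun k => (logmult (j \in B) (n j) (k
  j))%:C%C *
    (\prod_(j <- r) logmult (j \in B) (n j) (k j))%:C%C)).
  by move=> k; rewrite big_cons -rmorphM.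
apply: bounded_mult_comp IH; first by rewrite /c; case: ifP => //;
  rewrite exprn_ge0.
exact: bounded_mult_logmult.
Qed.

Lemma mixed_mult_ge0 B n k : 0 <= mixed_mult B n k.
Proof. by apply: prodr_ge0 => j _; exact: logmult_ge0. Qed.

Lemma mixed_mult_le1 B n k : mixed_mult B n k <= 1.
Proof. by apply: prodr_ile1 => j _; rewrite logmult_ge0 logmult_le1. Qed.

Lemma mixed_mult_eq0 B n k j : (n j < `|k j|)%N -> mixed_mult B n k = 0.
Proof. by move=> h; rewrite /mixed_mult (bigD1 j)//= logmult_eq0// mul0r. Qed.

(** For factors in [[0, 1]], the defect of a product is at most the sum of the defects:
    [(1 - a) * (1 - P) >= 0]. *)
Lemma mixed_mult_ge B n k :
  1 - mixed_mult B n k <= \sum_(j < d) `|k j|%:R / logsum (n j).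
Proof.
rewrite /mixed_mult; elim: (index_enum _) => [|j r IH].
  by rewrite !big_nil subrr.
rewrite !big_cons; set a := logmult _ _ _; set P := \prod_(i <- r) _.
have a1 : a <= 1 by exact: logmult_le1.
have P1 : P <= 1 by apply: prodr_ile1 => i _; rewrite logmult_ge0 logmult_le1.
have := @logmult_ge R (j \in B) (n j) (k j); rewrite -/a; set v := _ / _.
have : 0 <= (1 - a) * (1 - P) by rewrite mulr_ge0 ?subr_ge0.
rewrite mulrBl mul1r mulrBr mulr1.
move: IH; rewrite -/P; set u := \sum_(i <- r) _; lra.
Qed.

End log_multiplier.

(** * Boxes of frequencies, and finite sums over them *)

Section boxes.
Context {d : nat}.
Implicit Types (k : freq d) (N : 'I_d -> nat) (n : nat).

Definition pbox N : seq (freq d) :=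
  [seq [ffun j => (p j)%:Z - (N j)%:Z] | p : {dffun forall j : 'I_d, 'I_(N
    j).*2.+1}].

Lemma uniq_pbox N : uniq (pbox N).
Proof.
rewrite map_inj_uniq ?enum_uniq// => p q /ffunP pq.
apply/ffunP => j; apply/val_inj => /=.
by have := pq j; rewrite !ffunE => /addIr [].
Qed.

Lemma mem_pbox N k : (k \in pbox N) = [forall j, (`|k j| <= N j)%N].
Proof.
apply/idP/forallP => [/mapP[p _ ->] j|h].
  rewrite ffunE; case: (p j) => u /=; rewrite -muln2; lia.
apply/mapP; exists ([ffun j => inord `|(k j + (N j)%:Z)%R|] :
  {dffun forall j : 'I_d, 'I_(N j).*2.+1}); first by rewrite mem_enum.
apply/ffunP => j; rewrite !ffunE inordK; have := h j; rewrite -?muln2;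
  move: (k j) (N j) => u v; lia.
Qed.

Definition box n : seq (freq d) := pbox (fun=> n).

Lemma mem_box n k : (k \in box n) = [forall j, (`|k j| <= n)%N].
Proof. exact: mem_pbox. Qed.

Lemma size_box n : size (box n) = (n.*2.+1 ^ d)%N.
Proof.
rewrite size_map -cardE card_dep_ffun /image_mem.
rewrite -[in RHS](size_enum_ord d); elim: (enum 'I_d) => //= j r ->.
by rewrite card_ord expnS.
Qed.

End boxes.

Lemma big_support (V : nmodType) (K : eqType) (s t : seq K) (F : K -> V) :
  uniq s -> uniq t -> {subset s <= t} ->
  (forall k, k \in t -> k \notin s -> F k = 0) ->
  \sum_(k <- t) F k = \sum_(k <- s) F k.
Proof.
move=> us ut st F0; rewrite (bigID (mem s)) /=.
have -> : \sum_(k <- t | k \notin s) F k = 0.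
  by rewrite big_seq_cond big1// => k /andP[kt ks]; exact: F0.
rewrite addr0 -[LHS]big_filter; apply: perm_big; apply: uniq_perm => //.
  exact: filter_uniq.
move=> k; rewrite mem_filter; case: (boolP (k \in s)) => //= ks.
exact: st.
Qed.

(** The index types, which depend on [j], are gathered in one tagged type, where
    [bigA_distr_big_dep] applies; the resulting families are then read back as dependent
    functions. *)
Lemma prod_sum_dffun (A : comPzSemiRingType) (I : finType) (T_ : I -> finType)
    (F : forall j, T_ j -> A) :
  \prod_j \sum_(i : T_ j) F j i =
  \sum_(i : {dffun forall j, T_ j}) \prod_j F j (i j).
Proof.
under eq_bigr do rewrite (big_tag F).
rewrite (bigA_distr_big_dep (fun j => [in tagged_with T_ j])).
transitivity (\sum_(t : fprod T_) \prod_(j in I) (finfun (F j)) (t j)).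
  rewrite big_fprod; apply: eq_bigr => g gf; apply: eq_bigr => j _.
  by congr (untag _ _ _); apply/funext => u; rewrite ffunE.
rewrite (reindex (@fprod_of_dffun I T_)) /=;
  last exact/onW_bij/fprod_of_dffun_bij.
apply: eq_bigr => i _; apply: eq_bigr => j _.
by rewrite ffunE fprodE.
Qed.

(** * The means as multipliers, and de la Vallee Poussin polynomials *)

Section fourier_multiplier.
Context {R : realType} {d : nat}.
Local Notation C := R[i].
Local Notation X := (Rd R d).
Local Notation D := (@torus R d).
Local Notation P := ((2 * @pi R) ^+ d).
Implicit Types (f g h : X -> C) (k : freq d) (x : X).

Lemma torus_vol_gt0 : 0 < P.
Proof. by rewrite exprn_gt0// mulr_gt0// pi_gt0. Qed.

Definition multop (lam : freq d -> R) n f x : C :=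
  \sum_(k <- box n) (lam k)%:C%C * (fourier f k * chi k x).

Lemma fourierE f k : fourier f k = (P^-1)%:C%C * cintegral (fun x => f x *
  conjc (chi k x)).
Proof.
by congr (_ * cintegral _); apply/funext => x; rewrite -cisN.
Qed.

Lemma partial_sumE (N : 'I_d -> nat) f x :
  partial_sum N f x = \sum_(k <- pbox N) fourier f k * chi k x.
Proof.
rewrite /partial_sum /pbox big_map big_enum /=; apply: eq_bigr => p _.
rewrite /chi; set k := (fun j => _ - _ : int); set l := [ffun j => _].
suff -> : k = l by [].
by apply/funext => j; rewrite ffunE.
Qed.

Lemma partial_sum_box (N : 'I_d -> nat) M f x : (forall j, (N j <= M)%N) ->
  partial_sum N f x = \sum_(k <- box M)
    (\prod_(j < d) (if (`|k j| <= N j)%N then 1 else 0) : R)%:C%C * (fourier f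
      k * chi k x).
Proof.
move=> NM; rewrite partial_sumE.
rewrite (@big_support _ _ (pbox N) (box M)) ?uniq_pbox//.
- rewrite [LHS]big_seq [RHS]big_seq; apply: eq_bigr => k.
  rewrite mem_pbox => /forallP kN; rewrite big1 ?rmorph1 ?mul1r// => j _.
  by rewrite kN.
- move=> k; rewrite mem_pbox mem_box => /forallP kN; apply/forallP => j.
  exact: leq_trans (kN j) (NM j).
- move=> k _; rewrite mem_pbox negb_forall => /existsP[j /negbTE kj].
  by rewrite (bigD1 j)//= kj mul0r mul0r.
Qed.

(** In a common cube, each partial sum has as symbol a product of indicators of intervals. Summed
    against the product weights, these factor into the one-variable symbols by distributivity. Any
    cube that contains the frequencies serves. *)
Lemma log_meanE (B : {set 'I_d}) (n : 'I_d -> nat) M f x :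
  (forall j, (n j <= M)%N) -> log_mean B n f x = multop (mixed_mult B n) M f x.
Proof.
move=> nM; rewrite /log_mean /multop.
pose N (i : {dffun forall j : 'I_d, 'I_(n j).+1}) j :=
  if j \in B then (n j - i j)%N else i j.
have NM i j : (N i j <= M)%N.
  by rewrite /N; have := ltn_ord (i j); have := nM j; case: ifP => _; lia.
rewrite (eq_bigr (fun i : {dffun forall j : 'I_d, 'I_(n j).+1} => \sum_(k <-
  box M)
    ((\prod_(j < d) (i j).+1%:R)^-1)%:C%C *
    ((\prod_(j < d) (if (`|k j| <= N i j)%N then 1 else 0) : R)%:C%C *
      (fourier f k * chi k x)))); last first.
  by move=> i _; rewrite (partial_sum_box _ _ (NM i)) mulr_sumr.
rewrite exchange_big /= mulr_sumr; apply: eq_bigr => k _.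
rewrite (eq_bigr (fun i : {dffun forall j : 'I_d, 'I_(n j).+1} =>
    ((\prod_(j < d) (i j).+1%:R)^-1 *
     \prod_(j < d) (if (`|k j| <= N i j)%N then 1 else 0) : R)%:C%C *
      (fourier f k * chi k x))); last by move=> i _; rewrite mulrA -rmorphM.
rewrite -mulr_suml mulrA; congr (_ * _).
rewrite -rmorph_sum -rmorphM; congr (_%:C)%C.
rewrite /mixed_mult /logmult big_split /= prodfV; congr (_ * _).
under [RHS]eq_bigr do rewrite big_mkord.
rewrite prod_sum_dffun; apply: eq_bigr => i _.
by rewrite big_split /= prodfV.
Qed.

Lemma parseval (c : freq d -> C) (s : seq (freq d)) : uniq s ->
  J (fun x => cabs (\sum_(k <- s) c k * chi k x) ^+ 2) = P * \sum_(k <- s)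
    cabs (c k) ^+ 2.
Proof.
move=> us; set p := [seq (c k, k) | k <- s].
have -> : J (fun x => cabs (\sum_(k <- s) c k * chi k x) ^+ 2) =
    complex.Re (cintegral (ev (mulp p (conjp p)))).
  apply: eq_Rintegral => x _; rewrite ev_mul ev_conj mulc_conj.
  by rewrite /ev big_map.
rewrite cintegral_ev cReZ; congr (_ * _).
rewrite /mean big_mkcond big_allpairs_dep big_map cRe_sum big_seq [RHS]big_seq.
apply: eq_bigr => a sa; rewrite /conjp !big_map (bigD1_seq a)//= subrr eqxx.
rewrite mulc_conj big1 ?addr0// => b ba; rewrite subr_eq0 eq_sym (negbTE ba).
by [].
Qed.

(* A de la Vallee Poussin kernel: the number of pairs [(a, b)] with [a - b = k]
   is [size (box n)] for all [k] in [box n]. *)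
Definition vallee_poussin g n : seq (C * freq d) :=
  [seq (((size (box (d := d) n))%:R^-1)%:C%C * fourier g (a - b), a - b) |
    a : freq d <- box n, b : freq d <- box n.*2].

(** At [x], the polynomial is the integral of [g] against [conj (U A) * U B] divided by
    [P * size A]. From [2uv <= u^2 + v^2] and Parseval, it is at most [(1 + size B / size A) / 2 <=
    (1 + 2^d) / 2], since [4n + 1 <= 2 (2n + 1)]. *)
Lemma cabs_vallee_poussin g n x : cbounded g ->
  (forall y, D y -> cabs (g y) <= 1) ->
  cabs (ev (vallee_poussin g n) x) <= 2 ^+ d.
Proof.
move=> bg g1; rewrite /vallee_poussin; set A := box n; set B := box n.*2.
set q := (X in ev X).
have szA : (0 < (size A)%:R :> R) by rewrite ltr0n size_box expn_gt0.
pose U (s : seq (freq d)) y : C := \sum_(a <- s) conjc (chi a x) * chi a y.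
have bU s : cbounded (U s) by apply: cbounded_sum => a;
  exact/cboundedZ/cbounded_chi.
have JU s : uniq s -> J (fun y => cabs (U s y) ^+ 2) = P * (size s)%:R.
  move=> us; rewrite parseval//; congr (_ * _).
  rewrite (eq_bigr (fun=> 1));
    first by rewrite big_const_seq count_predT iter_addr addr0.
  by move=> a _; rewrite cabs_conj cabs_chi expr1n.
have qE : ev q x = ((size A)%:R^-1 / P)%:C%C *
    cintegral (fun y => g y * (conjc (U A y) * U B y)).
  rewrite rmorphM -mulrA /q /ev big_allpairs_dep.
  have term a b : cbounded (fun y => chi (a - b) x * (g y * conjc (chi (a - b)
    y))).
    exact/cboundedZ/(cboundedM bg)/cbounded_conj/cbounded_chi.
  have -> : cintegral (fun y => g y * (conjc (U A y) * U B y)) =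
      cintegral (fun y => \sum_(a <- A) \sum_(b <- B)
        chi (a - b) x * (g y * conjc (chi (a - b) y))).
    apply: eq_cintegral => y _; rewrite /U cconj_sum mulr_suml mulr_sumr.
    apply: eq_bigr => a _; rewrite !mulr_sumr; apply: eq_bigr => b _.
    by rewrite !chiD !chiN !cconjM !conjcK; ring.
  rewrite cintegral_sum; last first.
    by move=> a; apply: cbounded_integrable; exact: cbounded_sum.
  rewrite !mulr_sumr; apply: eq_bigr => a _.
  rewrite cintegral_sum; last by move=> b; exact: cbounded_integrable.
  rewrite !mulr_sumr; apply: eq_bigr => b _ /=.
  rewrite (cintegralZ _ (cbounded_integrable (cboundedM bg (cbounded_conj
    (cbounded_chi (a - b)))))).
  by rewrite fourierE -!mulrA; congr (_ * (_ * _)); exact: mulrC.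
have bgU := cboundedM bg (cboundedM (cbounded_conj (bU A)) (bU B)).
have bA2 := bounded_measurableX 2 (cbounded_cabs (bU A)).
have bB2 := bounded_measurableX 2 (cbounded_cabs (bU B)).
rewrite qE cabsZ ?divr_ge0 ?invr_ge0 ?(ltW torus_vol_gt0)//.
apply: (@le_trans _ _ ((size A)%:R^-1 / P * (2^-1 * (P * (size A)%:R + P *
  (size B)%:R)))).
  rewrite ler_wpM2l ?divr_ge0 ?invr_ge0 ?(ltW torus_vol_gt0)//.
  apply: le_trans (ler_cabs_cintegral (cbounded_integrable bgU)) _.
  rewrite -(JU A) ?uniq_pbox// -(JU B) ?uniq_pbox// -(JD bA2 bB2).
  rewrite -(JZ _ (bounded_measurableD bA2 bB2)).
  apply: (le_J (cbounded_cabs bgU) (bounded_measurableZ _ (bounded_measurableD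
    bA2 bB2))) => y Dy.
  rewrite !cabsM cabs_conj; set u := cabs (U A y); set v := cabs (U B y).
  have uv0 : 0 <= u * v by rewrite mulr_ge0 ?cabs_ge0.
  apply: (@le_trans _ _ (u * v)); first by rewrite ler_piMl ?g1.
  have := sqr_ge0 (u - v); lra.
have sB : (size B)%:R <= 2 ^+ d * (size A)%:R :> R.
  have le_exp a b e : (a <= b)%N -> (a ^ e <= b ^ e)%N.
    by case: e => // e; rewrite leq_exp2r.
  by rewrite /A /B !size_box -natrX -natrM ler_nat -expnMn le_exp//; lia.
have P0 := torus_vol_gt0.
rewrite -mulrDr mulrCA -mulrA mulKf ?gt_eqF//.
rewrite mulrCA ler_pdivrMl// mulrC -[leRHS]mulrC.
have : 1 <= 2 ^+ d :> R by rewrite exprn_ege1// ler1n.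
rewrite -(ler_pM2r szA) mul1r; lra.
Qed.

End fourier_multiplier.

(** * The [L log^r L] bound *)

Section young.
Context {R : realType}.
Implicit Types (a b A : R).

(** The moment is chosen according to [a]: [m = i + 1] is the least integer above [ln (1 + a)]. If
    [b <= c A m^r] with [c = e 2^r], the first term suffices because [m <= 1 + ln (1 + a)].
    Otherwise [y = b / (A m^r)] exceeds [c], and [a m^r <= e^m 2^(r m) = c^m <= y^(2m - 1)], so that
    the moment of order [2m] suffices. *)
Lemma young_log_moment (r : nat) a b A : 0 <= a -> 0 <= b -> 0 < A ->
  exists i : nat, a * b <= expR 1 * 2 ^+ r * A * 2 ^+ r * (a * (1 + ln (1 + a)
    ^+ r)) +
    A * (b / (A * i.+1%:R ^+ r)) ^+ (2 * i.+1).
Proof.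
move=> a0 b0 A0; set L := ln (1 + a).
have L0 : 0 <= L by rewrite ln_ge0// lerDl.
exists (Num.truncn L); set m := (Num.truncn L).+1.
have /andP[mL Lm] := truncn_itv L0; rewrite -/m in Lm.
set c := expR 1 * 2 ^+ r.
have e1 : 1 <= expR 1 :> R by rewrite -expR0 ler_expR.
have c1 : 1 <= c by rewrite -[leLHS]mulr1 ler_pM// exprn_ege1// ler1n.
have c0 : 0 < c by exact: lt_le_trans c1.
have m0 : 0 < m%:R ^+ r :> R by rewrite exprn_gt0// ltr0n.
have Am0 : 0 < A * m%:R ^+ r by rewrite mulr_gt0.
have [bm|bm] := leP b (c * A * m%:R ^+ r).
  apply: (@le_trans _ _ (c * A * 2 ^+ r * (a * (1 + L ^+ r)))); last first.
    by rewrite lerDl mulr_ge0 ?(ltW A0)// exprn_ge0// divr_ge0// ltW.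
  apply: le_trans (ler_wpM2l a0 bm) _.
  rewrite mulrCA -[leRHS]mulrA ler_wpM2l ?mulr_ge0 ?(ltW c0) ?(ltW A0)//.
  rewrite mulrCA ler_wpM2l//.
  apply: (@le_trans _ _ ((1 + L) ^+ r)).
    by rewrite lerXn2r ?nnegrE ?addr_ge0// -natr1 addrC lerD2l.
  by rewrite -[X in 2 ^+ r * (X + _)](expr1n _ r) exprD_le2.
set y := b / _.
have cy : c < y by rewrite /y ltr_pdivlMr// mulrA.
have y0 : 0 < y by exact: lt_trans cy.
have -> : a * b = A * (a * m%:R ^+ r * y).
  by rewrite /y; field; rewrite !gt_eqF.
rewrite -[leLHS]add0r; apply: lerD.
  by rewrite !mulr_ge0 ?expR_ge0 ?exprn_ge0 ?addr_ge0 ?exprn_ge0 ?(ltW A0).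
rewrite ler_pM2l// (_ : (2 * m = m.*2.-1.+1)%N);
  last by rewrite mul2n /m doubleS.
rewrite exprSr ler_pM2r//.
apply: (@le_trans _ _ (c ^+ m)).
  rewrite /c exprMn ler_pM// ?(ltW m0)//.
    rewrite -expRM_natl mulr1; apply: (@le_trans _ _ (expR L)).
      by rewrite lnK ?posrE ?lerDr// ltr_pwDl.
    by rewrite ler_expR ltW.
  by rewrite exprAC lerXn2r ?nnegrE// -natrX ler_nat ltnW// ltn_expl.
apply: (@le_trans _ _ (c ^+ m.*2.-1));
  first by rewrite ler_weXn2l// /m doubleS /= ltnS -addnn leq_addr.
by rewrite lerXn2r ?nnegrE ?ltW.
Qed.

End young.

(** * Integration of a bound whose index depends on the point *)

Section series_bound.
Context d (T : measurableType d) (R : realType) (mu : {measure set T -> \bar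
  R}).
Local Open Scope ereal_scope.

(** The index varies with [x] in an uncontrolled way; bounding the chosen [u i] by the whole series
    removes the choice, at the price of summing the integrals. *)
Lemma integral_le_series (D : set T) (F W : T -> R) (u : nat -> T -> R)
    (K A c : R) :
  measurable D -> measurable_fun D F -> measurable_fun D W ->
  (forall i, measurable_fun D (u i)) ->
  (forall x, D x -> 0 <= F x)%R -> (forall x, D x -> 0 <= W x)%R ->
  (forall i x, D x -> 0 <= u i x)%R -> (0 <= K)%R -> (0 <= A)%R ->
  (forall x, D x -> exists i, F x <= K * W x + A * u i x)%R ->
  (forall N, \sum_(0 <= i < N) \int[mu]_(x in D) (u i x)%:E <= c%:E) ->
  \int[mu]_(x in D) (F x)%:E <= K%:E * \int[mu]_(x in D) (W x)%:E + A%:E * c%:E.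
Proof.
move=> mD mF mW mu_ F0 W0 u0 K0 A0 FWu uc.
have mFE : measurable_fun D (EFin \o F) by exact/measurable_EFinP.
have mWE : measurable_fun D (EFin \o W) by exact/measurable_EFinP.
have muE i : measurable_fun D (EFin \o u i) by exact/measurable_EFinP.
have mS : measurable_fun D (fun x => \sum_(0 <= i <oo) (u i x)%:E).
  apply: (@ge0_emeasurable_sum _ _ _ D (fun i x => (u i x)%:E) xpredT) => [i x
    Dx _|i _].
    by rewrite lee_fin u0.
  exact: muE.
have S0 x : D x -> 0 <= \sum_(0 <= i <oo) (u i x)%:E.
  by move=> Dx; apply: nneseries_ge0 => i _ _; rewrite lee_fin u0.
have mKW : measurable_fun D (fun x => K%:E * (W x)%:E) by exact:
  measurable_funeM.
have mAS : measurable_fun D (fun x => A%:E * \sum_(0 <= i <oo) (u i x)%:E).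
  exact: measurable_funeM.
apply: (@le_trans _ _ (\int[mu]_(x in D) (K%:E * (W x)%:E +
    A%:E * \sum_(0 <= i <oo) (u i x)%:E))).
  apply: ge0_le_integral => //.
  - exact: emeasurable_funD.
  move=> x Dx; have [i hi] := FWu x Dx.
  apply: (@le_trans _ _ (K * W x + A * u i x)%:E); first by rewrite lee_fin.
  rewrite EFinD !EFinM leeD2l// lee_wpmul2l ?lee_fin//.
  apply: le_trans (nneseries_lim_ge i.+1 _); last by move=> ? _ _;
    rewrite lee_fin u0.
  rewrite big_nat_recr//= leeDr// sume_ge0// => ? _.
  by rewrite lee_fin u0.
rewrite ge0_integralD//.
- rewrite ge0_integralZl//.
  rewrite leeD2l// ge0_integralZl//.
  rewrite lee_wpmul2l ?lee_fin// integral_nneseries//.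
  apply: lime_le.
    apply: is_cvg_nneseries => i _ _; apply: integral_ge0 => x Dx.
    by rewrite lee_fin u0.
  by apply: nearW => N; exact: uc.
- by move=> x Dx; rewrite mule_ge0 ?lee_fin ?W0.
- by move=> x Dx; rewrite mule_ge0 ?lee_fin ?S0.
Qed.

End series_bound.

(** * The bound from [L log^r L] to [L^1], by duality *)

Section weak_type.
Context {R : realType} {d : nat}.
Local Notation C := R[i].
Local Notation X := (Rd R d).
Local Notation D := (@torus R d).
Local Notation mu := (@lebesgue R d).
Local Notation P := ((2 * @pi R) ^+ d).
Implicit Types (f g h : X -> C) (k : freq d) (x : X) (lam : freq d -> R).

(** For every [a] in the cube, the differences [a - b] run once through a set that contains the
    cube, and [lam] kills the others. Hence each [a] contributes one full copy of [multop lam n g],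
    and the coefficient [s] averages them. *)
Lemma multop_vallee_poussin lam n g x :
  (forall k, k \notin box n -> lam k = 0) ->
  multop lam n g x = ev (mult (fun k => (lam k)%:C%C) (vallee_poussin g n)) x.
Proof.
move=> lam0; rewrite ev_multE /vallee_poussin big_allpairs_dep /=.
pose s := ((size (box (d := d) n))%:R^-1 : R)%:C%C : C.
pose phi k := (lam k)%:C%C * (fourier g k * chi k x).
transitivity (\sum_(a <- box (d := d) n) s * multop lam n g x).
  rewrite big_const_seq count_predT iter_addr addr0 -mulrnAl.
  suff -> : s *+ size (box (d := d) n) = 1 by rewrite mul1r.
  rewrite /s -rmorphMn /= -mulr_natr mulVf//.
  by rewrite pnatr_eq0 size_box expn_eq0.
rewrite [LHS]big_seq [RHS]big_seq; apply: eq_bigr => a sa.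
have -> : multop lam n g x = \sum_(k <- [seq a - b | b <- box n.*2]) phi k.
  apply/esym/big_support.
  - exact: uniq_pbox.
  - by rewrite map_inj_uniq ?uniq_pbox// => b b' /addrI/oppr_inj.
  - move=> k sk; apply/mapP; exists (a - k); last by rewrite opprB addrC subrK.
    move: sk sa; rewrite !mem_box => /forallP sk /forallP sa.
    apply/forallP => j; rewrite !ffunE; have := sk j; have := sa j.
    by move: (a j) (k j) => u v; rewrite -muln2; lia.
  - by move=> k _ kn; rewrite /phi lam0// mul0r.
rewrite big_map mulr_sumr; apply: eq_bigr => b _ /=.
by rewrite /phi mulrCA -mulrA.
Qed.

Lemma cbounded_multop lam n g : cbounded (multop lam n g).
Proof. by apply: cbounded_sum => k; exact/cboundedZ/cboundedZ/cbounded_chi. Qed.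

Lemma multop_moment lam n g m c : 0 <= c ->
  (forall k, k \notin box n -> lam k = 0) ->
  bounded_mult m c (fun k => (lam k)%:C%C : C) ->
  cbounded g -> (forall y, D y -> cabs (g y) <= 1) ->
  J (fun x => cabs (multop lam n g x) ^+ m) <= c * ((2 ^+ d) ^+ m * P).
Proof.
move=> c0 lam0 hc bg g1.
have -> : J (fun x => cabs (multop lam n g x) ^+ m) =
    intpow (mult (fun k => (lam k)%:C%C) (vallee_poussin g n)) m.
  by apply: eq_Rintegral => x _; rewrite multop_vallee_poussin.
apply: le_trans (hc _) _; rewrite ler_wpM2l// -J_cst.
apply: (le_J (bm_cabs_ev _ _) (bounded_measurable_cst _)) => x _.
by rewrite lerXn2r ?nnegrE ?cabs_ge0 ?exprn_ge0// cabs_vallee_poussin.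
Qed.

(** The symbol is real, so that the operator is its own adjoint. Only finitely many coefficients
    occur, which lets [h] be merely integrable. *)
Lemma multop_dual lam n h g : cintegrable h -> cbounded g ->
  cintegral (fun x => multop lam n h x * conjc (g x)) =
  cintegral (fun x => h x * conjc (multop lam n g x)).
Proof.
move=> ih bg.
pose u f k := cintegral (fun x => f x * conjc (chi k x)).
have uE f k : fourier f k = (P^-1)%:C%C * u f k by exact: fourierE.
have bgc k := cboundedM (cbounded_conj bg) (@cbounded_chi R d k).
have ihc k := cintegrableM ih (cbounded_conj (@cbounded_chi R d k)).
transitivity (\sum_(k <- box n) (lam k)%:C%C * ((P^-1)%:C%C * u h k * conjc (u
  g k))).
  transitivity (cintegral (fun x => \sum_(k <- box n)
      ((lam k)%:C%C * fourier h k) * (conjc (g x) * chi k x))).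
    apply: eq_cintegral => x _; rewrite /multop mulr_suml;
      apply: eq_bigr => k _.
    by rewrite !mulrA mulrAC.
  rewrite cintegral_sum; last by move=> k;
    exact/cintegrableZ/cbounded_integrable.
  apply: eq_bigr => k _; rewrite (cintegralZ _ (cbounded_integrable (bgc k))).
  rewrite uE -!mulrA; congr (_ * (_ * (_ * _))).
  have := cintegral_conj (cbounded_integrable (cboundedM bg (cbounded_conj
    (@cbounded_chi R d k)))).
  move=> <-; apply: eq_cintegral => x _.
  by rewrite cconjM conjcK.
transitivity (cintegral (fun x => \sum_(k <- box n)
    ((lam k)%:C%C * conjc (fourier g k)) * (h x * conjc (chi k x)))).
  rewrite cintegral_sum; last by move=> k; exact: cintegrableZ.
  apply: eq_bigr => k _; rewrite (cintegralZ _ (ihc k)) uE cconjM -/(u h k).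
  by rewrite cconj_real -!mulrA; congr (_ * (_ * _)); rewrite mulrC.
apply: eq_cintegral => x _; rewrite /multop cconj_sum mulr_sumr;
  apply: eq_bigr => k _.
by rewrite !cconjM cconj_real mulrCA -!mulrA; congr (_ * _); rewrite mulrCA.
Qed.

Lemma ler_cintegral_E f : cintegrable f ->
  ((cabs (cintegral f))%:E <= \int[mu]_(x in D) (cabs (f x))%:E)%E.
Proof.
move=> fi; have [mf fa] := (cintegrableP f).1 fi.
rewrite -[leRHS]fineK; last exact: integrable_fin_num.
by rewrite lee_fin ler_cabs_cintegral.
Qed.

(* The inverse of the modulus is written as an exponential, which makes its
   measurability immediate. *)
Lemma phaseP f : cbounded f -> exists g, [/\ cbounded g,
  forall x, cabs (g x) <= 1 & forall x, f x * conjc (g x) = (cabs (f x))%:C%C].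
Proof.
move=> bf; have ma := measurable_cabs bf.1.
pose w x := expR (- ln (cabs (f x))).
have mw : measurable_fun D w.
  apply: (measurableT_comp (@measurable_expR R)).
  apply: (measurableT_comp (@oppr_measurable R setT)).
  exact: (measurableT_comp (@measurable_ln R)).
exists (fun x => (w x)%:C%C * f x).
have g1 x : cabs ((w x)%:C%C * f x) <= 1.
  rewrite cabsZ ?expR_ge0// /w; have := cabs_ge0 (f x).
  rewrite le_eqVlt => /predU1P[<-|f0]; first by rewrite mulr0.
  by rewrite expRN lnK ?posrE// mulVf// gt_eqF.
split; [split|exact: g1|].
- exact: cmeasurableM (cmeasurable_real mw) bf.1.
- by exists 1 => x _; exact: g1.
move=> x; rewrite cconjM cconj_real mulrCA mulc_conj -rmorphM; congr (_%:C)%C.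
have := cabs_ge0 (f x); rewrite /w le_eqVlt => /predU1P[<-|f0].
  by rewrite expr0n mulr0.
by rewrite expRN lnK ?posrE// expr2 mulrA mulVf ?mul1r// gt_eqF.
Qed.

(** The summand 1 makes the weight dominate [u], which [LlogL_young] does not do near 0; the weight
    thus controls the [L^1] norm too. *)
Definition log_weight (r : nat) (u : R) : R := u * (1 + ln (1 + u) ^+ r).

Lemma measurable_log_weight r (u : X -> R) : measurable_fun D u ->
  measurable_fun D (fun x => log_weight r (u x)).
Proof.
move=> mu_; apply: (measurable_funM mu_).
apply: (measurable_funD (measurable_cst _)); apply: measurable_funX.
apply: (measurableT_comp (@measurable_ln R)).
exact: (measurable_funD (measurable_cst _) mu_).
Qed.

Lemma log_weight_ge0 r u : 0 <= u -> 0 <= log_weight r u.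
Proof.
by move=> u0; rewrite /log_weight mulr_ge0// addr_ge0// exprn_ge0// ln_ge0//
  lerDl.
Qed.

Lemma L1_multop_le r : exists K1 K2 : R, [/\ 0 <= K1, 0 <= K2 &
  forall lam n h, (forall k, k \notin box n -> lam k = 0) ->
  (forall m, (0 < m)%N ->
    bounded_mult (2 * m) ((48 * m)%:R ^+ (2 * m) ^+ r) (fun k => (lam k)%:C%C
      : C)) ->
  cintegrable h ->
  ((J (fun x => cabs (multop lam n h x)))%:E <=
   K1%:E * \int[mu]_(x in D) (log_weight r (cabs (h x)))%:E + K2%:E)%E].
Proof.
(* The value for which [(48 m)^r * 2^d / (A * m^r) = 1 / 2]: the normalized moments are at most
   [P * 2^-(2m)], hence summable over [m] with a total of at most [P]. *)
pose A : R := 2 * 48%:R ^+ r * 2 ^+ d.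
have A0 : 0 < A by rewrite !mulr_gt0 ?exprn_gt0.
pose K : R := expR 1 * 2 ^+ r * A * 2 ^+ r.
have K0 : 0 <= K by rewrite !mulr_ge0 ?expR_ge0 ?exprn_ge0 ?(ltW A0).
have P0 := @torus_vol_gt0 R d.
exists K, (A * P); split => // [|lam n h lam0 hb ih].
  by rewrite mulr_ge0 ?ltW.
(* The conjugate of the phase [g] turns [|T h|] into a pairing, and duality moves the operator onto
   [g], to which the moment bounds apply. *)
have [g [bg g1 gE]] := phaseP (cbounded_multop lam n h).
have bT := cbounded_multop lam n g.
have -> : J (fun x => cabs (multop lam n h x)) =
    complex.Re (cintegral (fun x => h x * conjc (multop lam n g x))).
  by rewrite -multop_dual//; apply: eq_Rintegral => x _; rewrite gE.
have ihT := cintegrableM ih (cbounded_conj bT).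
apply: (@le_trans _ _ (cabs (cintegral (fun x => h x * conjc (multop lam n g
  x))))%:E).
  by rewrite lee_fin ler_Re.
apply: le_trans (ler_cintegral_E ihT) _.
pose u i x : R := (cabs (multop lam n g x) / (A * i.+1%:R ^+ r)) ^+ (2 * i.+1).
have mh := measurable_cabs ((cintegrableP h).1 ih).1.
have ca : bounded_measurable (fun x => cabs (multop lam n g x)) by exact:
  cbounded_cabs.
have bu i : bounded_measurable (u i).
  exact/bounded_measurableX/(bounded_measurableM ca)/bounded_measurable_cst.
have u0 i x : 0 <= u i x.
  by rewrite exprn_ge0// divr_ge0 ?cabs_ge0// mulr_ge0 ?exprn_ge0// ltW.
have mW := measurable_log_weight r mh.
rewrite [X in (_ <= _ + X)%E]EFinM.
apply: (integral_le_series (@measurable_torus R d) (u := u)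
  (measurable_cabs ((cintegrableP _).1 ihT).1) mW (fun i => (bu i).1)
  (fun x _ => cabs_ge0 _) (fun x _ => log_weight_ge0 r (cabs_ge0 (h x)))
  (fun i x _ => u0 i x) K0 (ltW A0)).
  move=> x _; rewrite cabsM cabs_conj.
  exact: (young_log_moment r (cabs_ge0 (h x)) (cabs_ge0 (multop lam n g x)) A0).
move=> N; apply: (@le_trans _ _ (\sum_(0 <= i < N) (P * 2^-1 ^+ i.+1)%:E)%E).
  apply: lee_sum => i _; rewrite (EFin_J (bu i)) lee_fin.
  pose m := i.+1; have Am : 0 < A * m%:R ^+ r by rewrite mulr_gt0 ?exprn_gt0.
  have cm0 : 0 <= (48 * m)%:R ^+ (2 * m) ^+ r :> R by rewrite !exprn_ge0.
  have := multop_moment cm0 lam0 (hb m erefl) bg (fun y _ => g1 y).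
  rewrite exprAC => hm.
  have -> : J (u i) = (A * m%:R ^+ r)^-1 ^+ (2 * m) *
      J (fun x => cabs (multop lam n g x) ^+ (2 * m)).
    rewrite -(JZ _ (bounded_measurableX (2 * m) ca));
      apply: eq_Rintegral => x _.
    by rewrite /u exprMn mulrC.
  have Ai0 : 0 <= (A * m%:R ^+ r)^-1 ^+ (2 * m) by rewrite exprn_ge0//
    invr_ge0 ltW.
  apply: le_trans (ler_wpM2l Ai0 hm) _.
  rewrite mulrA -exprMn mulrA -exprMn mulrC ler_pM2l//.
  have -> : (A * m%:R ^+ r)^-1 * (48 * m)%:R ^+ r * 2 ^+ d = 2^-1.
    rewrite natrM exprMn /A invfM; field.
    by rewrite !expf_eq0 /= !pnatr_eq0 ?andbF.
  rewrite ler_wiXn2l ?invr_ge0 ?invf_le1//; last by rewrite -/m; lia.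
  by rewrite ler1n.
rewrite sumEFin lee_fin -mulr_sumr ler_piMr ?(ltW P0)//.
suff -> : \sum_(0 <= i < N) 2^-1 ^+ i.+1 = 1 - 2^-1 ^+ N :> R.
  by rewrite lerBlDr lerDl exprn_ge0.
elim: N => [|N IH]; first by rewrite big_nil expr0 subrr.
by rewrite big_nat_recr//= IH exprS; field.
Qed.

End weak_type.

(** * Dominated convergence to 0 *)

Section bounded_convergence.
Context d (T : measurableType d) (R : realType) (mu : {measure set T -> \bar
  R}).

Lemma dominated_convergence0 (D : set T) (v : nat -> T -> R) (W : T -> R) :
  measurable D -> (forall n, measurable_fun D (v n)) ->
  mu.-integrable D (EFin \o W) ->
  (forall n x, D x -> `|v n x| <= W x) -> (forall x, D x -> v n x @[n --> \oo]
    --> 0) ->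
  forall e : R, 0 < e -> exists n, \int[mu]_(x in D) v n x < e.
Proof.
move=> mD mv Wi vW v0 e e0.
have mvE n : measurable_fun D (EFin \o v n) by exact/measurable_EFinP.
have v0E : \forall x \ae mu, D x -> (v n x)%:E @[n --> \oo] --> 0%E.
  apply: aeW => x Dx; apply/fine_cvgP; split; first exact: nearW.
  exact: v0.
have vWE : \forall x \ae mu, forall n, D x -> (`|(v n x)%:E| <= (W x)%:E)%E.
  by apply: aeW => x n Dx; rewrite lee_fin vW.
have [_ _] := dominated_convergence mD mvE (measurable_cst 0%E) v0E Wi vWE.
rewrite integral0 => /fine_cvgP[_ /cvgrPdist_lt/(_ e e0)[n _ /(_ n (leqnn n))]].
rewrite /= sub0r normrN => hn.
by exists n; exact: le_lt_trans (ler_norm _) hn.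
Qed.

Lemma bounded_convergence0 (D : set T) (v : nat -> T -> R) (M : R) :
  measurable D -> (mu D < +oo)%E -> (forall n, measurable_fun D (v n)) ->
  (forall n x, D x -> `|v n x| <= M) -> (forall x, D x -> v n x @[n --> \oo]
    --> 0) ->
  forall e : R, 0 < e -> exists n, \int[mu]_(x in D) v n x < e.
Proof.
move=> mD muD mv; apply: dominated_convergence0 => //.
apply: (@measurable_bounded_integrable _ _ _ _ (cst M)) => //.
by exists `|M|; split => [|N MN x _ /=]; rewrite ?num_real// ltW.
Qed.

End bounded_convergence.

(** * Density of trigonometric polynomials *)

Section elementary_limits.
Context {R : realType}.
Implicit Types u : R.

Lemma expr_lt1_cvg0 u : 0 <= u -> u < 1 -> u ^+ n @[n --> \oo] --> 0.
Proof.
move=> u0 u1; have := @cvg_geometric R 1 u; rewrite ger0_norm// => /(_ u1).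
by under [X in X @ \oo]eq_fun do rewrite /geometric /= mul1r.
Qed.

Lemma expr_one_minus_sqr_cvg u : `|u| <= 1 ->
  1 - (1 - u ^+ 2) ^+ n @[n --> \oo] --> (if u != 0 then 1 else 0 : R).
Proof.
move=> u1; have [->|u0] := eqVneq u 0.
  rewrite /=; under eq_fun do rewrite expr0n /= subr0 expr1n subrr.
  exact: cvg_cst.
rewrite /= -[X in _ --> X]subr0; apply: cvgB; first exact: cvg_cst.
have u2 : 0 < u ^+ 2 by rewrite exprn_even_gt0.
apply: expr_lt1_cvg0; last by rewrite ltrBlDr ltrDl.
by rewrite subr_ge0 -real_normK ?num_real// exprn_ile1.
Qed.

Lemma bernoulli_sub (x : R) n : 0 <= x <= 1 -> 1 - n%:R * x <= (1 - x) ^+ n.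
Proof.
move=> /andP[x0 x1]; elim: n => [|n IH]; first by rewrite expr0 mul0r subr0.
have x1' : 0 <= 1 - x by rewrite subr_ge0.
rewrite exprS; apply: le_trans (ler_wpM2l x1' IH).
have : 0 <= n%:R * x ^+ 2 by rewrite mulr_ge0 ?sqr_ge0.
by rewrite -natr1 expr2; set m := n%:R; lra.
Qed.

Lemma bernoulli_add (x : R) n : 0 <= x -> 1 + n%:R * x <= (1 + x) ^+ n.
Proof.
move=> x0; elim: n => [|n IH]; first by rewrite expr0 mul0r addr0.
have x1' : 0 <= 1 + x by rewrite addr_ge0.
rewrite exprS; apply: le_trans (ler_wpM2l x1' IH).
have : 0 <= n%:R * x ^+ 2 by rewrite mulr_ge0 ?sqr_ge0.
by rewrite -natr1 expr2; set m := n%:R; lra.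
Qed.

(** With [w = (1 - u) / 2], the decisive quantity is [2^n * w^n = (1 - u)^n], which tends to 0 for
    [u] in []0, 1]] and to infinity for [u < 0]. *)
Definition step_approx n u : R := (1 - ((1 - u) / 2) ^+ n) ^+ (2 ^ n).

Lemma step_approx_bound n u : `|u| <= 1 -> 0 <= step_approx n u <= 1.
Proof.
move=> /ler_normlP[u1 u2].
have w0 : 0 <= (1 - u) / 2 by lra.
have w1 : (1 - u) / 2 <= 1 by lra.
have wn0 : 0 <= ((1 - u) / 2) ^+ n by rewrite exprn_ge0.
have wn1 : ((1 - u) / 2) ^+ n <= 1 by rewrite exprn_ile1.
by rewrite /step_approx exprn_ge0 ?exprn_ile1 ?subr_ge0//; lra.
Qed.

(* The Bernoulli inequalities used in the Brosowski-Deutsch proof of the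
   Stone-Weierstrass theorem. *)
Lemma step_approx_cvg u : `|u| <= 1 -> u != 0 ->
  step_approx n u @[n --> \oo] --> (if 0 < u then 1 else 0 : R).
Proof.
move=> u1 u0; have /ler_normlP[u1a u1b] := u1.
set w := (1 - u) / 2.
have w0 : 0 <= w by rewrite /w; lra.
have w1 : w <= 1 by rewrite /w; lra.
have wn n : 0 <= w ^+ n <= 1 by rewrite exprn_ge0//= exprn_ile1.
have ww : 2 * w = 1 - u by rewrite /w; lra.
have E n : (2 ^ n)%:R * w ^+ n = (1 - u) ^+ n by rewrite natrX -exprMn ww.
case: ifPn => [up|].
  apply: (@squeeze_cvgr _ _ _ _ (fun n => 1 - (1 - u) ^+ n) (fun=> 1)).
  - apply: nearW => n; have /andP[_ ->] := step_approx_bound n u1.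
    by rewrite andbT -E bernoulli_sub.
  - rewrite -[X in _ --> X]subr0; apply: cvgB; first exact: cvg_cst.
    by apply: expr_lt1_cvg0; lra.
  - exact: cvg_cst.
rewrite -leNgt => um; have ult : u < 0 by rewrite lt_neqAle u0.
apply: (@squeeze_cvgr _ _ _ _ (fun=> 0) (fun n => (- u)^-1 * n.+1%:R^-1)).
- near=> n; have /andP[-> _] /= := step_approx_bound n u1.
  have wn1 : 0 <= 1 - w ^+ n by have /andP[_] := wn n; rewrite subr_ge0.
  have h1 : step_approx n u * (1 + (1 - u) ^+ n) <= 1.
    have wp : 0 <= 1 + w ^+ n by rewrite addr_ge0//; case/andP: (wn n).
    (* The product of the two powers is [(1 - w^(2n))^(2^n) <= 1], and by Bernoulli the second one
       is at least [1 + (1 - u)^n]. *)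
    apply: (@le_trans _ _ ((1 - w ^+ n) ^+ (2 ^ n) * (1 + w ^+ n) ^+ (2 ^ n))).
      rewrite /step_approx -/w ler_wpM2l ?exprn_ge0// -E bernoulli_add//.
      by case/andP: (wn n).
    rewrite -exprMn exprn_ile1//; first by rewrite mulr_ge0.
    have := sqr_ge0 (w ^+ n); rewrite expr2; set z := w ^+ n; lra.
  have h2 : - u * n.+1%:R <= 1 + (1 - u) ^+ n.
    have := bernoulli_add n (ltW (_ : 0 < - u)); rewrite oppr_gt0 => /(_ ult).
    by rewrite -natr1; set z := _ ^+ n; set m := n%:R; lra.
  rewrite -invfM -[leRHS]div1r ler_pdivlMr; last by rewrite mulr_gt0 ?oppr_gt0.
  apply: le_trans h1; rewrite ler_wpM2l//.
  by have /andP[] := step_approx_bound n u1.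
- exact: cvg_cst.
- have h := cvgM (cvg_cst (- u)^-1 : cst (- u)^-1 @ \oo --> _) (@cvg_harmonic
  R).
  by rewrite mulr0 in h; exact: h.
Unshelve. all: by end_near.
Qed.

End elementary_limits.

(** * The algebra of bounded [L^2] limits of trigonometric polynomials *)

Section density.
Context {R : realType} {d : nat}.
Local Notation C := R[i].
Local Notation X := (Rd R d).
Local Notation D := (@torus R d).
Local Notation mu := (@lebesgue R d).
Implicit Types (f g h : X -> C) (u v : X -> R) (x : X) (e M : R) (j : 'I_d)
  (E : set X).

Definition sqdist f g : R := J (fun x => cabs (f x - g x) ^+ 2).

Lemma bm_sqdist f g : cbounded f -> cbounded g ->
  bounded_measurable (fun x => cabs (f x - g x) ^+ 2).
Proof. by move=> bf bg; exact/bounded_measurableX/cbounded_cabs/cboundedB. Qed.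

Lemma sqdist_triangle f g h : cbounded f -> cbounded g -> cbounded h ->
  sqdist f h <= 2 * (sqdist f g + sqdist g h).
Proof.
move=> bf bg bh; have b1 := bm_sqdist bf bg; have b2 := bm_sqdist bg bh.
rewrite /sqdist -(JD b1 b2) -(JZ _ (bounded_measurableD b1 b2)).
apply: (le_J (bm_sqdist bf bh) (bounded_measurableZ _ (bounded_measurableD b1
  b2))).
move=> x _; have : cabs (f x - h x) <= cabs (f x - g x) + cabs (g x - h x).
  by apply: le_trans (ler_cabsD _ _); rewrite addrA subrK.
set a := cabs (f x - g x); set b := cabs (g x - h x).
move=> ab; apply: (@le_trans _ _ ((a + b) ^+ 2)).
  by rewrite lerXn2r ?nnegrE ?addr_ge0 ?cabs_ge0.
have := sqr_ge0 (a - b); lra.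
Qed.

(** Boundedness is required of [g], not uniformly of the approximating polynomials; it is what makes
    the class stable under products. *)
Definition approximable g :=
  cbounded g /\ forall e, 0 < e -> exists p, sqdist g (ev p) < e.

Lemma approximable_ev p : approximable (ev p).
Proof.
split; first exact: cbounded_ev.
move=> e e0; exists p; rewrite (_ : sqdist _ _ = 0)//.
rewrite /sqdist -[RHS](mul0r ((2 * pi) ^+ d)) -J_cst.
by apply: eq_Rintegral => x _; rewrite subrr cabs0 expr0n.
Qed.

Lemma approximable_closed g : cbounded g ->
  (forall e, 0 < e -> exists2 f, approximable f & sqdist g f < e) ->
    approximable g.
Proof.
move=> bg h; split=> // e e0;
  have [f [bf fe] gf] := h (e / 4) (divr_gt0 e0 (ltr0n _ 4)).
have [p fp] := fe (e / 4) (divr_gt0 e0 (ltr0n _ 4)); exists p.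
apply: le_lt_trans (sqdist_triangle bg bf (cbounded_ev p)) _; lra.
Qed.

Lemma eq_sqdist f g h : (forall x, D x -> f x = g x) -> sqdist f h = sqdist g h.
Proof. by move=> fg; apply: eq_Rintegral => x /set_mem Dx; rewrite fg. Qed.

Lemma eq_cbounded f g : (forall x, D x -> f x = g x) -> cbounded f -> cbounded
  g.
Proof.
move=> fg [[mr mi] [M fM]]; split; last by exists M => x Dx; rewrite -fg// fM.
split.
  apply: (eq_measurable_fun (fun x => complex.Re (f x))) mr.
  by move=> x /set_mem Dx; rewrite fg.
apply: (eq_measurable_fun (fun x => complex.Im (f x))) mi.
by move=> x /set_mem Dx; rewrite fg.
Qed.

Lemma eq_approximable f g : (forall x, D x -> f x = g x) ->
  approximable f -> approximable g.
Proof.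
move=> fg [bf fe]; split; first exact: eq_cbounded bf.
by move=> e /fe[p fp]; exists p; rewrite -(eq_sqdist _ fg).
Qed.

Lemma approximableD f g : approximable f -> approximable g ->
  approximable (fun x => f x + g x).
Proof.
move=> [bf fe] [bg ge]; apply: approximable_closed; first exact: cboundedD.
move=> e e0.
have [p fp] := fe (e / 4) (divr_gt0 e0 (ltr0n _ 4)).
have [q gq] := ge (e / 4) (divr_gt0 e0 (ltr0n _ 4)).
exists (ev (p ++ q)); first exact: approximable_ev.
have b1 := bm_sqdist bf (cbounded_ev p);
  have b2 := bm_sqdist bg (cbounded_ev q).
apply: (@le_lt_trans _ _ (2 * (sqdist f (ev p) + sqdist g (ev q))));
  last by lra.
rewrite /sqdist -(JD b1 b2) -(JZ _ (bounded_measurableD b1 b2)).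
apply: (le_J (bm_sqdist (cboundedD bf bg) (cbounded_ev _))
  (bounded_measurableZ _ (bounded_measurableD b1 b2))) => x _.
rewrite ev_cat opprD addrACA.
set a := cabs (f x - _); set b := cabs (g x - _).
apply: (@le_trans _ _ ((a + b) ^+ 2)).
  by rewrite lerXn2r ?nnegrE ?addr_ge0 ?cabs_ge0// ler_cabsD.
have := sqr_ge0 (a - b); lra.
Qed.

Lemma sqdistM f g h M : cbounded f -> cbounded g -> cbounded h -> 0 <= M ->
  (forall x, D x -> cabs (h x) <= M) ->
  sqdist (fun x => h x * f x) (fun x => h x * g x) <= M ^+ 2 * sqdist f g.
Proof.
move=> bf bg bh M0 hM; have b := bm_sqdist bf bg.
rewrite /sqdist -(JZ _ b).
apply: (le_J (bm_sqdist (cboundedM bh bf) (cboundedM bh bg))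
  (bounded_measurableZ _ b)) => x Dx.
rewrite -mulrBr cabsM exprMn ler_wpM2r ?sqr_ge0//.
by rewrite lerXn2r ?nnegrE ?cabs_ge0// hM.
Qed.

Lemma cbounded_bound f : cbounded f ->
  exists2 M, 0 < M & forall x, D x -> cabs (f x) <= M.
Proof.
move=> [_ [M fM]]; exists (`|M| + 1); first by rewrite ltr_wpDl.
by move=> x Dx; rewrite (le_trans (fM x Dx))// ler_wpDr// ler_norm.
Qed.

(** The approximating polynomials have no common bound, so that the factors are replaced one at a
    time: [g] by a polynomial while [f] is kept, then [f] against that fixed polynomial. *)
Lemma approximableM f g : approximable f -> approximable g ->
  approximable (fun x => f x * g x).
Proof.
have step (h k : X -> C) : cbounded h -> approximable k ->
    (forall p, approximable (fun x => h x * ev p x)) ->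
    approximable (fun x => h x * k x).
  move=> bh [bk ke] hp; apply: approximable_closed; first exact: cboundedM.
  move=> e e0; have [M M0 hM] := cbounded_bound bh.
  have M2 : 0 < M ^+ 2 by rewrite exprn_gt0.
  have [p kp] := ke (e / M ^+ 2) (divr_gt0 e0 M2).
  exists (fun x => h x * ev p x); first exact: hp.
  apply: le_lt_trans (sqdistM bk (cbounded_ev p) bh (ltW M0) hM) _.
  by rewrite mulrC -ltr_pdivlMr.
move=> af ag; apply: (step _ _ af.1 ag) => p.
have : approximable (fun x => ev p x * f x).
  apply: (step _ _ (cbounded_ev p) af) => q.
  apply: (@eq_approximable (ev (mulp p q))); last exact: approximable_ev.
  by move=> x _; rewrite ev_mul.
by apply: eq_approximable => x _; rewrite mulrC.
Qed.

Definition rapproximable u := approximable (fun x => (u x)%:C%C).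

Lemma eq_rapproximable u v : (forall x, D x -> u x = v x) ->
  rapproximable u -> rapproximable v.
Proof. by move=> uv; apply: eq_approximable => x Dx; rewrite uv. Qed.

Lemma rapproximableD u v : rapproximable u -> rapproximable v ->
  rapproximable (fun x => u x + v x).
Proof.
move=> au av; have := approximableD au av; apply: eq_approximable => x _.
by rewrite -rmorphD.
Qed.

Lemma rapproximableM u v : rapproximable u -> rapproximable v ->
  rapproximable (fun x => u x * v x).
Proof.
move=> au av; have := approximableM au av; apply: eq_approximable => x _.
by rewrite -rmorphM.
Qed.

Lemma approximable_cst (z : C) : approximable (fun=> z).
Proof.
apply: (@eq_approximable (ev [:: (z, 0)])); last exact: approximable_ev.
by move=> x _; rewrite /ev big_seq1 chi0 mulr1.
Qed.

Lemma rapproximable_cst (a : R) : rapproximable (fun=> a).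
Proof. exact: approximable_cst. Qed.

Lemma rapproximableZ (a : R) u : rapproximable u -> rapproximable (fun x => a
  * u x).
Proof. exact/rapproximableM/rapproximable_cst. Qed.

Lemma rapproximableB u v : rapproximable u -> rapproximable v ->
  rapproximable (fun x => u x - v x).
Proof.
move=> au av; have := rapproximableD au (rapproximableZ (-1) av).
by apply: eq_rapproximable => x _; rewrite mulN1r.
Qed.

Lemma rapproximableX u n : rapproximable u -> rapproximable (fun x => u x ^+ n).
Proof.
move=> au; elim: n => [|n IH]; first exact: rapproximable_cst.
have := rapproximableM au IH; apply: eq_rapproximable => x _.
by rewrite exprS.
Qed.

(** Bounded pointwise limits stay in the class, by dominated convergence of the squared distance.
    All the indicator functions below are reached in this way. *)
Lemma rapproximable_lim (v : nat -> X -> R) u M :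
  (forall n, rapproximable (v n)) -> (forall n x, D x -> `|v n x| <= M) ->
  (forall x, D x -> v n x @[n --> \oo] --> u x) -> rapproximable u.
Proof.
move=> av vM vu.
have mv n : measurable_fun D (v n) by have [[[]]] := av n.
have mu_ : measurable_fun D u by exact: (measurable_fun_cvg mv).
have uM x : D x -> `|u x| <= M.
  move=> Dx; have h : `|v n x| @[n --> \oo] --> `|u x| by apply: cvg_norm;
    exact: vu.
  rewrite -(cvg_lim _ h)//; apply: limr_le; first by apply/cvg_ex;
    exists `|u x|.
  by apply: nearW => n; exact: vM.
have bu : cbounded (fun x => (u x)%:C%C).
  by split; [exact: cmeasurable_real|exists M => x Dx; rewrite cabs_real uM].
apply: approximable_closed => // e e0.
have mw n : measurable_fun D (fun x => (u x - v n x) ^+ 2).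
  exact: (measurable_funX 2 (measurable_funB mu_ (mv n))).
have wM n x : D x -> `|(u x - v n x) ^+ 2| <= (2 * M) ^+ 2.
  move=> Dx; have h1 := uM x Dx; have h2 := vM n x Dx.
  have M0 : 0 <= M by exact: le_trans h1.
  rewrite normrX lerXn2r ?nnegrE ?mulr_ge0//.
  by apply: le_trans (ler_normB _ _) _; lra.
have wc x : D x -> (u x - v n x) ^+ 2 @[n --> \oo] --> 0.
  move=> Dx; have h : u x - v n x @[n --> \oo] --> u x - u x.
    by apply: cvgB; [exact: cvg_cst|exact: vu].
  rewrite subrr in h.
  have h2 := cvgM h h; rewrite mulr0 in h2.
  by under eq_fun do rewrite expr2; exact: h2.
have [n hn] := bounded_convergence0 (@measurable_torus R d)
  (@lebesgue_torus_lty R d) mw wM wc e0.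
exists (fun x => (v n x)%:C%C); first exact: av.
apply: le_lt_trans hn; rewrite le_eqVlt; apply/orP; left; apply/eqP.
apply: eq_Rintegral => x _.
by rewrite -rmorphB cabs_real -normrX ger0_norm// sqr_ge0.
Qed.

Lemma rapproximable_neq0 u : rapproximable u -> (forall x, D x -> `|u x| <= 1)
  ->
  rapproximable (fun x => if u x != 0 then 1 else 0).
Proof.
move=> au u1; apply: (@rapproximable_lim (fun n x => 1 - (1 - u x ^+ 2) ^+ n)
  _ 1).
- move=> n; apply: (rapproximableB (rapproximable_cst 1));
  apply: rapproximableX.
  exact: (rapproximableB (rapproximable_cst 1) (rapproximableX 2 au)).
- move=> n x Dx; have := sqr_ge0 (u x).
  have : u x ^+ 2 <= 1 by rewrite -real_normK ?num_real// exprn_ile1// u1.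
  set w := u x ^+ 2 => w1 w0.
  have a0 : 0 <= (1 - w) ^+ n by rewrite exprn_ge0// subr_ge0.
  have a1 : (1 - w) ^+ n <= 1 by rewrite exprn_ile1 ?subr_ge0//; lra.
  by rewrite ler_norml; apply/andP; split; lra.
- by move=> x Dx; exact/expr_one_minus_sqr_cvg/u1.
Qed.

(** At [u = 0] the polynomials [step_approx] tend to [1 / e] instead of 0. The factor [s], itself
    approximable, corrects this. *)
Lemma rapproximable_gt0 u : rapproximable u -> (forall x, D x -> `|u x| <= 1) ->
  rapproximable (fun x => if 0 < u x then 1 else 0).
Proof.
move=> au u1.
pose s x : R := if u x != 0 then 1 else 0.
apply: (@rapproximable_lim (fun n x => step_approx n (u x) * s x) _ 1).
- move=> n; apply: rapproximableM (rapproximable_neq0 au u1).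
  apply: (@rapproximableX (fun x => 1 - ((1 - u x) / 2) ^+ n)).
  apply: (rapproximableB (rapproximable_cst 1)); apply: rapproximableX.
  apply: (rapproximableM _ (rapproximable_cst 2^-1)).
  exact: (rapproximableB (rapproximable_cst 1) au).
- move=> n x Dx; have /andP[s0 s1] := step_approx_bound n (u1 x Dx).
  rewrite /s; case: ifP => _; first by rewrite mulr1 ger0_norm.
  by rewrite mulr0 normr0.
- move=> x Dx; rewrite /s; have [u0|u0] := eqVneq (u x) 0.
    rewrite u0 ltxx /=; under eq_fun do rewrite mulr0.
    exact: cvg_cst.
  under eq_fun do rewrite mulr1.
  exact: step_approx_cvg (u1 x Dx) u0.
Qed.

Definition unit_freq j : freq d := [ffun i => if i == j then 1 else 0].

Lemma dot_unit_freq j x : dot (unit_freq j) x = Defs.coord x j.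
Proof.
rewrite /dot (bigD1 j)//= ffunE eqxx mul1r big1 ?addr0// => i ij.
by rewrite ffunE (negbTE ij) mul0r.
Qed.

Lemma rapproximable_cos j : rapproximable (fun x => cos (Defs.coord x j)).
Proof.
apply: (@eq_approximable (ev [:: ((2^-1)%:C%C, unit_freq j);
  ((2^-1)%:C%C, - unit_freq j)])).
  move=> x _; rewrite /ev big_cons big_seq1 /= chiN -mulrDr /chi dot_unit_freq.
  by apply: complex_eqP; rewrite ?cReZ ?cImZ ?cReD ?cImD /=; field.
exact: approximable_ev.
Qed.

Lemma rapproximable_sin j : rapproximable (fun x => sin (Defs.coord x j)).
Proof.
apply: (@eq_approximable (ev [:: ((0 -i* 2^-1)%C, unit_freq j);
  ((0 +i* 2^-1)%C, - unit_freq j)])).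
  move=> x _; rewrite /ev big_cons big_seq1 /= chiN /chi dot_unit_freq.
  by apply: complex_eqP; rewrite ?cReD ?cImD ?cReM ?cImM /=; field.
exact: approximable_ev.
Qed.

End density.

Section cut_cos.
Context {R : realType}.
Implicit Types t a : R.

(* Increasing on [[-pi, pi[], and a bounded limit of trigonometric polynomials. *)
Definition cut_cos t : R := (2 * (if 0 < sin t then 1 else 0) - 1) * (1 - cos
  t).

Lemma sin_gt0_iff t : t \in `[- pi, pi[ -> (0 < sin t) = (0 < t).
Proof.
rewrite in_itv /= => /andP[t1 t2]; have [t0|t0] := ltP 0 t.
  by rewrite sin_gt0_pi// t0.
apply/negbTE; rewrite -leNgt -oppr_ge0 -sinN sin_ge0_pi// oppr_ge0 t0 /=.
by rewrite lerNl.
Qed.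

Lemma cut_cos_mono a t : a \in `[- pi, pi[ -> t \in `[- pi, pi[ ->
  a < t -> cut_cos a < cut_cos t.
Proof.
move=> aI tI lat; rewrite /cut_cos !sin_gt0_iff//.
move: aI tI; rewrite !in_itv /= => /andP[a1 a2] /andP[t1 t2].
have pi0 := @pi_gt0 R.
have [a0|a0] := ltP 0 a; have [t0|t0] := ltP 0 t; rewrite ?mulr1 ?mulr0.
- have : cos t < cos a by rewrite ltr_cos// in_itv /= ?(ltW a0) ?(ltW t0) /=
  ltW.
  by lra.
- by have := lt_le_trans (lt_trans a0 lat) t0; rewrite ltxx.
- have : cos t < cos 0 by rewrite ltr_cos// in_itv /= ?lexx ?(ltW t0) /= ltW.
  have := cos_le1 a; rewrite cos0; lra.
have : cos (- a) < cos (- t).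
  rewrite ltr_cos ?ltrN2// in_itv /= oppr_ge0 ?a0 ?t0 /= lerNl//.
rewrite !cosN; lra.
Qed.

Lemma cut_cos_le a t : a \in `[- pi, pi[ -> t \in `[- pi, pi[ ->
  (cut_cos t <= cut_cos a) = (t <= a).
Proof.
move=> aI tI; have [ta|at_] := leP t a.
  move: ta; rewrite le_eqVlt => /predU1P[->|ta]; first by rewrite lexx.
  by rewrite ltW// cut_cos_mono.
by rewrite leNgt cut_cos_mono.
Qed.

Lemma cut_cos_bound t : `|cut_cos t| <= 2.
Proof.
have c1 := cos_le1 t; have c2 := cos_geN1 t.
by rewrite /cut_cos; case: ifP => _; rewrite ler_norml; apply/andP; split; lra.
Qed.

End cut_cos.

(** * From half-spaces to all bounded measurable functions *)

Section density_sets.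
Context {R : realType} {d : nat}.
Local Notation C := R[i].
Local Notation X := (Rd R d).
Local Notation D := (@torus R d).
Local Notation mu := (@lebesgue R d).
Implicit Types (f g : X -> C) (u v : X -> R) (x : X) (e M : R) (j : 'I_d) (E F
  : set X).

Definition approximable_set E := rapproximable (\1_E : X -> R).

Lemma rapproximable_cut_cos j : rapproximable (fun x : X => cut_cos
  (Defs.coord x j)).
Proof.
apply: rapproximableM;
  last exact: (rapproximableB (rapproximable_cst 1) (rapproximable_cos j)).
apply: (rapproximableB _ (rapproximable_cst 1)); apply: rapproximableZ.
apply: (rapproximable_gt0 (rapproximable_sin j)) => x _.
exact: sin_max.
Qed.

(** On the torus, the inequality is one between values of the increasing function [cut_cos], hence a
    sign condition on an approximable function; the factor [1 / 4] brings it into [[-1, 1]]. For [a]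
    outside [[-pi, pi[], the trace on the torus is empty or full. *)
Lemma approximable_ray j (a : R) : approximable_set [set x : X | Defs.coord x
  j <= a].
Proof.
have [aI|aI] := boolP (a \in `[- pi, pi[).
  pose w (x : X) := 4^-1 * (cut_cos (Defs.coord x j) - cut_cos a).
  have aw : rapproximable w.
    apply: rapproximableZ.
    exact: (rapproximableB (rapproximable_cut_cos j) (rapproximable_cst
      (cut_cos a))).
  have w1 x : D x -> `|w x| <= 1.
    move=> _; rewrite /w normrM ger0_norm ?invr_ge0// ler_pdivrMl// mulr1.
    apply: le_trans (ler_normB _ _) _.
    by have := cut_cos_bound (Defs.coord x j); have := cut_cos_bound a; lra.
  have := rapproximableB (rapproximable_cst 1) (rapproximable_gt0 aw w1).
  apply: eq_rapproximable => x Dx; rewrite indicE /w.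
  have -> : (0 < 4^-1 * (cut_cos (Defs.coord x j) - cut_cos a)) =
      ~~ (Defs.coord x j <= a).
    by rewrite pmulr_rgt0 ?invr_gt0// subr_gt0 ltNge cut_cos_le.
  have [h|h] := boolP (Defs.coord x j <= a).
    by rewrite /= subr0 mem_set.
  by rewrite /= subrr memNset//; exact/negP.
move: aI; rewrite in_itv /= negb_and -ltNge -leNgt => /orP[al|al].
  have := rapproximable_cst (d := d) (0 : R); apply: eq_rapproximable => x Dx.
  rewrite indicE memNset//= => xa; have := Dx j;
    rewrite in_itv /= => /andP[h _].
  by have := lt_le_trans al (le_trans h xa); rewrite ltxx.
have := rapproximable_cst (d := d) (1 : R); apply: eq_rapproximable => x Dx.
rewrite indicE mem_set//=; have := Dx j; rewrite in_itv /= => /andP[_ h].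
exact: le_trans (ltW h) al.
Qed.

Lemma approximable_setC E : approximable_set E -> approximable_set (~` E).
Proof.
move=> aE; have := rapproximableB (rapproximable_cst 1) aE.
by apply: eq_rapproximable => x _; rewrite !indicE in_setC; case: (x \in E);
  rewrite ?subrr ?subr0.
Qed.

Lemma approximable_setI E F : approximable_set E -> approximable_set F ->
  approximable_set (E `&` F).
Proof.
move=> aE aF; have := rapproximableM aE aF.
by apply: eq_rapproximable => x _; rewrite !indicE in_setI -natrM mulnb.
Qed.

Lemma approximable_setU E F : approximable_set E -> approximable_set F ->
  approximable_set (E `|` F).
Proof.
move=> aE aF; rewrite -[E `|` F]setCK setCU; apply: approximable_setC.
by apply: approximable_setI; exact: approximable_setC.
Qed.

Lemma approximable_set0 : approximable_set (set0 : set X).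
Proof.
by have := rapproximable_cst (d := d) (0 : R); apply: eq_rapproximable => x _;
  rewrite indic0.
Qed.

Lemma approximable_bigcup (A : nat -> set X) : (forall n, approximable_set (A
  n)) ->
  approximable_set (\bigcup_n A n).
Proof.
move=> aA; apply: (@rapproximable_lim _ _ (fun n => \1_(\big[setU/set0]_(k <
  n) A k)) _ 1).
- elim=> [|n IH]; first by rewrite big_ord0; exact: approximable_set0.
  by rewrite big_ord_recr; exact: (approximable_setU IH (aA n)).
- by move=> n x _; rewrite indicE ger0_norm// lern1 leq_b1.
move=> x _; have [[k _ Akx]|Nx] := pselect ((\bigcup_n A n) x).
  apply: cvg_near_cst; exists k.+1 => // n /= kn.
  rewrite !indicE !mem_set//; first by exists k.
  by rewrite -bigcup_mkord; exists k.
under eq_fun => n.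
  rewrite indicE memNset; first over.
  by rewrite -bigcup_mkord => -[k _ Akx]; apply: Nx; exists k.
rewrite indicE memNset//; exact: cvg_cst.
Qed.

(** The approximable sets form a sigma-algebra that contains the coordinate preimages of the
    intervals []a, b]]. The generation is used twice: for the product structure, then for the
    line. *)
Lemma approximable_borel (E : set (d.-tuple (measurableTypeR R))) :
  measurable E -> approximable_set (E : set X).
Proof.
move: E; apply: smallest_sub.
  split; first exact: approximable_set0.
    by move=> A aA; rewrite setTD; exact: approximable_setC.
  exact: approximable_bigcup.
move=> E; rewrite -bigcup_seq => -[i _ [A mA <-]].
rewrite setTI; move: A mA; apply: smallest_sub.
  split.
  - exact: approximable_set0.
  - by move=> A aA; rewrite setTD preimage_setC; exact: approximable_setC.
  - by move=> A aA; rewrite preimage_bigcup; exact: approximable_bigcup.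
move=> _ [[a b] _ <-] /=.
have := approximable_setI (approximable_ray i b) (approximable_setC
  (approximable_ray i a)).
apply: eq_rapproximable => x _; congr (\1_ _ _); apply/seteqP; split => y /=.
  by rewrite in_itv /= => -[yb /negP]; rewrite -ltNge => ay; apply/andP.
by rewrite in_itv /= => /andP[ay yb]; split => //; apply/negP; rewrite -ltNge.
Qed.

(** The completed measure is an infimum over countable Borel covers, and the union of a nearly
    optimal cover is the required set. This is the passage from Borel to Lebesgue measurable
    sets. *)
Lemma borel_cover (E : set X) (e : R) : measurable E -> (mu E < +oo)%E -> 0 <
  e ->
  exists A : set (d.-tuple (measurableTypeR R)), [/\ measurable A,
    E `<=` (A : set X) & (mu ((A : set X) `\` E) < e%:E)%E].
Proof.
move=> mE Efin e0.
have Efn : mu E \is a fin_num by rewrite ge0_fin_numE.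
have [_ [F [mF EF] <-] Fe] := lb_ereal_inf_adherent e0 Efn.
exists (\bigcup_k F k); split => //; first exact: bigcup_measurable.
have mA : measurable (\bigcup_k F k) by exact: bigcup_measurable.
have mAX : measurable (\bigcup_k F k : set X) by exact: measurable_Rd.
have muA : (mu (\bigcup_k F k) <= \sum_(k <oo) borel_lebesgue d (F k))%E.
  rewrite -[leLHS](_ : borel_lebesgue d (\bigcup_k F k) = _).
    exact: measure_sigma_subadditive.
  by rewrite [RHS]measurable_mu_extE.
have := le_lt_trans muA Fe.
have -> : mu (\bigcup_k F k) = (mu E + mu (\bigcup_k F k `\` E))%E.
  by rewrite [LHS](measureDI _ mAX mE) addeC; congr (mu _ + _)%E;
    rewrite setIidr.
by rewrite lteD2lE.
Qed.

Lemma approximable_measurable E : measurable E -> approximable_set E.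
Proof.
move=> mE; have bind (F : set X) : measurable F -> cbounded (fun x : X =>
  (\1_F x : R)%:C%C).
  move=> mF; split; first by apply: cmeasurable_real; exact: measurable_indic.
  by exists 1 => x _; rewrite cabs_real indicE ger0_norm// lern1 leq_b1.
apply: approximable_closed; first exact: bind.
(* Cutting with the torus makes the measure finite, as the covering lemma requires. *)
move=> e e0; have mED := measurableI _ _ mE (@measurable_torus R d).
have EDoo : (mu (E `&` D) < +oo)%E.
  apply: le_lt_trans (@lebesgue_torus_lty R d).
  by apply: le_measure; rewrite ?inE//; exact: measurable_torus.
have [A [mA EA Ae]] := borel_cover mED EDoo e0.
have mAX : measurable (A : set X) by exact: measurable_Rd.
exists (fun x => (\1_(A : set X) x)%:C%C); first exact: approximable_borel.
have mAE : measurable ((A : set X) `\` (E `&` D)) by exact: measurableD.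
have -> : sqdist (fun x : X => (\1_E x : R)%:C%C) (fun x => (\1_(A : set X)
  x)%:C%C) =
    J (\1_((A : set X) `\` (E `&` D)) : X -> R).
  apply: eq_Rintegral => x /set_mem Dx; rewrite -rmorphB cabs_real !indicE.
  rewrite in_setD in_setI (mem_set Dx) andbT.
  have [Ex|Ex] := boolP (x \in E); last first.
    by case: (x \in A); rewrite ?subr0 ?sub0r ?normrN ?normr1 ?normr0 ?expr1n
      ?expr0n.
  have Ax : x \in (A : set X) by apply/mem_set/EA; split => //; exact/set_mem.
  by rewrite Ax subrr normr0 expr0n.
have bmi : bounded_measurable (\1_((A : set X) `\` (E `&` D)) : X -> R).
  split; first exact: measurable_indic.
  by exists 1 => x _; rewrite indicE ger0_norm// lern1 leq_b1.
rewrite -lte_fin -(EFin_J bmi) (integral_indic mu (@measurable_torus R d) mAE).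
apply: le_lt_trans Ae; apply: le_measure; rewrite ?inE//.
by apply: measurableI => //; exact: measurable_torus.
Qed.

Lemma staircase (y : R) N : 0 <= y -> y <= N%:R ->
  y <= \sum_(0 <= i < N) (if i%:R < y then 1 else 0) <= y + 1.
Proof.
move=> y0 yN.
(* Capping both bounds at [N] yields a statement that holds without [y <= N] and passes through
   induction on [N]. *)
suff /andP[h1 h2] : Num.min y N%:R <= \sum_(0 <= i < N) (if i%:R < y then 1
  else 0) <=
    Num.min (y + 1) N%:R.
  by move: h1 h2; rewrite min_l// le_min => -> /andP[].
elim: N {yN} => [|N /andP[h1 h2]].
  by rewrite big_nil !ge_min !le_min lexx orbT addr_ge0.
rewrite big_nat_recr//= -natr1; move: h1 h2.
set S := \sum_(0 <= i < N) _; rewrite !le_min !ge_min.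
case: (ltP N%:R y) => Ny.
  move=> h1 /andP[h2 h3]; have {}h1 : N%:R <= S.
    by case/orP: h1 => // /(lt_le_trans Ny)/ltW.
  by rewrite !lerD2r h1 orbT /= h3 andbT; lra.
move=> h1 /andP[h2 h3]; have {}h1 : y <= S by case/orP: h1 => // /(le_trans Ny).
by rewrite addr0 h1 h2 /=; lra.
Qed.

(** After an affine change of values to [[0, 1]], the function is a uniform limit of averages of
    [n + 1] indicators of its level sets, with error at most [1 / (n + 1)]. *)
Lemma approximable_real u : bounded_measurable u -> rapproximable u.
Proof.
move=> [mu_ [M0 uM0]]; pose M := `|M0| + 1.
have M_gt0 : 0 < M by rewrite /M ltr_wpDl.
have uM x : D x -> `|u x| <= M.
  by move=> Dx; rewrite (le_trans (uM0 x Dx))// /M ler_wpDr// ler_norm.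
pose v x := 2^-1 * (M^-1 * u x + 1).
have v01 x : D x -> 0 <= v x <= 1.
  move=> Dx; have /ler_normlP[h1 h2] := uM x Dx.
  have k1 : M^-1 * u x <= 1 by rewrite ler_pdivrMl// mulr1.
  have k2 : - 1 <= M^-1 * u x by rewrite ler_pdivlMl// mulrN1 lerNl.
  by rewrite /v; apply/andP; split; lra.
suff av : rapproximable v.
  have := rapproximableZ M (rapproximableB (rapproximableZ 2 av)
    (rapproximable_cst 1)).
  apply: eq_rapproximable => x _; rewrite /v mulVKf ?pnatr_eq0// addrK mulVKf//.
  by rewrite gt_eqF.
have mv : measurable_fun D v.
  apply: (measurable_funM (measurable_cst _)).
  apply: (measurable_funD _ (measurable_cst _)).
  exact: (measurable_funM (measurable_cst _) mu_).
pose s (n : nat) x : R := n.+1%:R^-1 *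
  \sum_(0 <= i < n.+1) (if i%:R < n.+1%:R * v x then 1 else 0).
have sv n x : D x -> v x <= s n x <= v x + n.+1%:R^-1.
  move=> /v01/andP[v0 v1]; have n0 : 0 < n.+1%:R :> R by rewrite ltr0n.
  have y0 : 0 <= n.+1%:R * v x by rewrite mulr_ge0.
  have yN : n.+1%:R * v x <= n.+1%:R by rewrite ler_piMr.
  have /andP[h1 h2] := staircase y0 yN.
  by rewrite /s ler_pdivlMl// h1 /= ler_pdivrMl// mulrDr mulfV ?gt_eqF.
have as_ n : rapproximable (s n).
  apply: rapproximableZ; elim: (index_iota _ _) => [|i r IH].
    have := rapproximable_cst (d := d) (0 : R); apply: eq_rapproximable => x _.
    by rewrite big_nil.
  pose E := D `&` (fun x => n.+1%:R * v x) @^-1` `]i%:R, +oo[%classic.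
  have mE : measurable E.
    exact: (measurable_funM (measurable_cst _) mv) (@measurable_torus R d) _
      (measurable_itv _).
  have := rapproximableD (approximable_measurable mE) IH.
  apply: eq_rapproximable => x Dx; rewrite big_cons indicE; congr (_ + _).
  case: ifPn => h; first by rewrite mem_set// /E; split => //=;
    rewrite in_itv /= andbT.
  by rewrite memNset// /E => -[_ /=]; rewrite in_itv /= andbT; exact/negP.
apply: (rapproximable_lim (M := 2) as_).
- move=> n x Dx; have /andP[h1 h2] := sv n x Dx; have /andP[v0 v1] := v01 x Dx.
  have : n.+1%:R^-1 <= 1 :> R by rewrite invf_le1// ler1n.
  by rewrite ler_norml; set t := _^-1 in h2 *; move=> t1; apply/andP; split;
    lra.
move=> x Dx; apply: (@squeeze_cvgr _ _ _ _ (fun=> v x) (fun n => v x +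
  n.+1%:R^-1)).
- by apply: nearW => n; exact: sv.
- exact: cvg_cst.
rewrite -[X in _ --> X]addr0; apply: cvgD; first exact: cvg_cst.
exact: cvg_harmonic.
Qed.

Lemma approximable_cbounded g : cbounded g -> approximable g.
Proof.
move=> [[mr mi] [M gM]].
have ar : rapproximable (fun x => complex.Re (g x)).
  apply: approximable_real; split => //.
  by exists M => x Dx; rewrite (le_trans (normr_Re _))// gM.
have ai : rapproximable (fun x => complex.Im (g x)).
  apply: approximable_real; split => //.
  by exists M => x Dx; rewrite (le_trans (normr_Im _))// gM.
have := approximableD ar (approximableM (approximable_cst (0 +i* 1)%C) ai).
apply: eq_approximable => x _.
by apply: complex_eqP; rewrite ?cReD ?cImD ?cReM ?cImM /=; ring.
Qed.

End density_sets.

(** * Convergence of the means *)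

Section log_estimates.
Context {R : realType}.
Implicit Types (u v s M : R) (r n : nat).

(** By induction, the increment [ln (1 + 1 / (n + 2))] is at most [1 / (n + 2)]. *)
Lemma logsum_ge_ln n : ln n.+2%:R <= logsum n :> R.
Proof.
elim: n => [|n IH].
  rewrite /logsum big_nat1 invr1 -(_ : 1 + 1 = 2%:R)//.
  by rewrite le_ln1Dx.
have n0 : 0 < n.+2%:R :> R by rewrite ltr0n.
rewrite /logsum big_nat_recr//= -/(logsum n).
have -> : n.+3%:R = n.+2%:R * (1 + n.+2%:R^-1) :> R.
  by rewrite mulrDr mulr1 mulfV ?gt_eqF// natr1.
have i0 : 0 < n.+2%:R^-1 :> R by rewrite invr_gt0.
rewrite lnM ?posrE ?addr_gt0// lerD// le_ln1Dx//.
exact: lt_trans i0.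
Qed.

Lemma logsum_unbounded M : exists N, forall n, (N <= n)%N -> M < logsum n :> R.
Proof.
exists (Num.truncn (expR M)) => n Nn; apply: lt_le_trans (logsum_ge_ln n).
rewrite -[ltLHS]expRK ltr_ln ?posrE ?expR_gt0 ?ltr0n//.
have /andP[_ /lt_le_trans] := truncn_itv (expR_ge0 M); apply.
by rewrite ler_nat (leq_trans _ (leqnSn _))// ltnS.
Qed.

Lemma log_weight_ge r u : 0 <= u -> u <= log_weight r u.
Proof.
move=> u0; rewrite /log_weight ler_peMr// lerDl exprn_ge0// ln_ge0// lerDl//.
Qed.

Lemma log_weight_le r u v : 0 <= u -> u <= v -> log_weight r u <= log_weight r
  v.
Proof.
move=> u0 uv; have v0 : 0 <= v by exact: le_trans uv.
rewrite /log_weight ler_pM ?addr_ge0 ?exprn_ge0 ?ln_ge0 ?lerDl// lerD2l.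
rewrite lerXn2r ?nnegrE ?ln_ge0 ?lerDl//.
by rewrite ler_ln ?posrE ?lerD2l ?ltr_pwDl.
Qed.

(** A finite Luxemburg norm gives integrability at one scale only; this moves it to any other. It
    rests on [1 + s v <= (1 + s)(1 + v)] and on [v <= e + v ln^r (1 + v)], where [e] covers the
    range [ln (1 + v) < 1]. *)
Lemma log_weight_scale r s v : 0 <= s -> 0 <= v ->
  log_weight r (s * v) <= s * (1 + 2 ^+ r * ln (1 + s) ^+ r) * expR 1 +
    s * (1 + 2 ^+ r * ln (1 + s) ^+ r + 2 ^+ r) * LlogL_young r v.
Proof.
move=> s0 v0; rewrite /LlogL_young ger0_norm//.
have L0 u : 0 <= u -> 0 <= ln (1 + u) by move=> u0; rewrite ln_ge0// lerDl.
set a := ln (1 + s); set b := ln (1 + v).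
have a0 : 0 <= a by exact: L0.
have b0 : 0 <= b by exact: L0.
have lab : ln (1 + s * v) <= a + b.
  rewrite -lnM ?posrE ?ltr_pwDl// ler_ln ?posrE ?mulr_gt0 ?ltr_pwDl ?mulr_ge0//.
  by have : 0 <= s + v by [rewrite addr_ge0];
    rewrite mulrDl !mulrDr !mul1r !mulr1; lra.
have labr : ln (1 + s * v) ^+ r <= 2 ^+ r * (a ^+ r + b ^+ r).
  apply: le_trans (exprD_le2 r a0 b0).
  by rewrite lerXn2r ?nnegrE ?addr_ge0// L0// mulr_ge0.
have vb : v <= expR 1 + v * b ^+ r.
  have [b1|b1] := leP 1 b.
    by rewrite -[leLHS]add0r lerD ?expR_ge0// ler_peMr// exprn_ege1.
  rewrite -[leLHS]addr0 lerD ?mulr_ge0 ?exprn_ge0//.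
  apply: (@le_trans _ _ (1 + v)); first by rewrite lerDr.
  have v1 : 0 < 1 + v by rewrite ltr_pwDl.
  by rewrite -[leLHS]lnK ?posrE// ler_expR ltW.
have sv0 : 0 <= s * v by rewrite mulr_ge0.
set A := 1 + 2 ^+ r * a ^+ r.
have A0 : 0 <= s * A by rewrite mulr_ge0// addr_ge0 ?mulr_ge0 ?exprn_ge0.
apply: (@le_trans _ _ (s * v * (1 + 2 ^+ r * (a ^+ r + b ^+ r)))).
  by rewrite /log_weight ler_wpM2l// lerD2l.
have := ler_wpM2l A0 vb; rewrite /A.
set p := 2 ^+ r; set x := a ^+ r; set y := b ^+ r; set z := expR 1.
rewrite !mulrDr !mulrDl !mulr1 !mulrA; lra.
Qed.

End log_estimates.

Section integral_triangle.
Context d (T : measurableType d) (R : realType) (mu : {measure set T -> \bar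
  R}).
Local Open Scope ereal_scope.

Lemma ge0_integral_le3 (D : set T) (F a b c : T -> R) :
  measurable D -> measurable_fun D F -> measurable_fun D a ->
  measurable_fun D b -> measurable_fun D c ->
  (forall x, D x -> 0 <= F x)%R -> (forall x, D x -> 0 <= a x)%R ->
  (forall x, D x -> 0 <= b x)%R -> (forall x, D x -> 0 <= c x)%R ->
  (forall x, D x -> F x <= a x + b x + c x)%R ->
  \int[mu]_(x in D) (F x)%:E <= \int[mu]_(x in D) (a x)%:E +
    \int[mu]_(x in D) (b x)%:E + \int[mu]_(x in D) (c x)%:E.
Proof.
move=> mD mF ma mb mc F0 a0 b0 c0 Fabc.
have mE (f : T -> R) : measurable_fun D f -> measurable_fun D (EFin \o f).
  by move=> mf; exact/measurable_EFinP.
have mab : measurable_fun D (fun x => a x + b x)%R by exact: measurable_funD.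
have mabc : measurable_fun D (fun x => a x + b x + c x)%R by exact:
  measurable_funD.
apply: (@le_trans _ _ (\int[mu]_(x in D) (a x + b x + c x)%:E)).
  apply: ge0_le_integral => //; first exact: mE.
    exact: mE.
have ab0 x : D x -> 0 <= (a x + b x)%:E by move=> Dx;
  rewrite lee_fin addr_ge0 ?a0 ?b0.
under eq_integral do rewrite EFinD.
rewrite ge0_integralD//=; last 2 first.
  exact: mE.
  exact: mE.
rewrite leeD2r//; under eq_integral do rewrite EFinD.
by rewrite ge0_integralD//=; exact: mE.
Qed.

End integral_triangle.

(** * Convergence of the means on bounded functions *)

Section convergence.
Context {R : realType} {d : nat}.
Local Notation C := R[i].
Local Notation X := (Rd R d).
Local Notation D := (@torus R d).
Local Notation mu := (@lebesgue R d).
Local Notation P := ((2 * @pi R) ^+ d).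
Implicit Types (f g h b : X -> C) (x : X) (k : freq d) (lam : freq d -> R)
  (B : {set 'I_d}) (n : 'I_d -> nat) (M : nat) (e : R).

Lemma fourierZ (z : C) f k : cintegrable f ->
  fourier (fun x => z * f x) k = z * fourier f k.
Proof.
move=> fi; have fic := cintegrableM fi (cbounded_conj (@cbounded_chi R d k)).
rewrite !fourierE mulrCA; congr (_ * _); rewrite -(cintegralZ z fic).
by apply: eq_cintegral => x _; rewrite mulrA.
Qed.

Lemma fourierD f g k : cintegrable f -> cintegrable g ->
  fourier (fun x => f x + g x) k = fourier f k + fourier g k.
Proof.
move=> fi gi; have bc := cbounded_conj (@cbounded_chi R d k).
rewrite !fourierE -mulrDr -(cintegralD (cintegrableM fi bc) (cintegrableM gi
  bc)).
by congr (_ * _); apply: eq_cintegral => x _; rewrite mulrDl.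
Qed.

Lemma multopZ lam M (z : C) f x : cintegrable f ->
  multop lam M (fun x => z * f x) x = z * multop lam M f x.
Proof.
move=> fi; rewrite /multop mulr_sumr; apply: eq_bigr => k _.
by rewrite fourierZ// -!mulrA mulrCA.
Qed.

Lemma multopD lam M f g x : cintegrable f -> cintegrable g ->
  multop lam M (fun x => f x + g x) x = multop lam M f x + multop lam M g x.
Proof.
move=> fi gi; rewrite /multop -big_split; apply: eq_bigr => k _ /=.
by rewrite fourierD// mulrDl mulrDr.
Qed.

Lemma fourier_ev p k : fourier (ev p) k = \sum_(t <- p) (if t.2 == k then t.1
  else 0) :> C.
Proof.
have -> : fourier (ev p) k = (P^-1)%:C%C * cintegral (ev (mulp p [:: (1, -
  k)])).
  rewrite fourierE; congr (_ * _); apply: eq_cintegral => x _.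
  by rewrite ev_mul [ev [:: _] _]big_seq1 mul1r chiN.
rewrite cintegral_ev mulrA -rmorphM mulVf ?gt_eqF ?torus_vol_gt0// rmorph1
  mul1r.
rewrite /mean big_mkcond big_allpairs_dep; apply: eq_bigr => t _.
by rewrite big_seq1 /= mulr1 subr_eq0.
Qed.

Lemma multop_ev lam M p x : (forall k, k \notin box M -> lam k = 0) ->
  multop lam M (ev p) x = ev (mult (fun k => (lam k)%:C%C) p) x.
Proof.
move=> lam0; rewrite /multop ev_multE.
under eq_bigr do rewrite fourier_ev mulr_suml mulr_sumr.
rewrite exchange_big /=; apply: eq_bigr => t _.
have [tM|tM] := boolP (t.2 \in box M).
  rewrite (bigD1_seq t.2) ?uniq_pbox//= eqxx big1 ?addr0// => k kt.
  by rewrite eq_sym (negbTE kt) mul0r mulr0.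
rewrite (lam0 _ tM) mul0r big_seq big1// => k kM.
by case: eqP => [tk|_]; rewrite ?mul0r ?mulr0//; move: tM; rewrite tk kM.
Qed.

(** Expanding the square, the distance is the squared norm of [g] plus [P] times the sum of
    [(lam^2 - 2 lam) |g^(k)|^2], which is at most 0 for [lam] in [[0, 1]]. The finite sum makes this
    exact, without completeness of the characters. *)
Lemma multop_contraction lam M g : cbounded g -> (forall k, 0 <= lam k <= 1) ->
  sqdist g (multop lam M g) <= J (fun x => cabs (g x) ^+ 2).
Proof.
move=> bg lam01; have bT := cbounded_multop lam M g.
have bgT := cboundedM bg (cbounded_conj bT).
pose S (c : freq d -> R) := \sum_(k <- box M) c k * cabs (fourier g k) ^+ 2.
have int1 : cintegral (fun x => g x * conjc (multop lam M g x)) = (P * S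
  lam)%:C%C.
  have ic k := cbounded_integrable (cboundedM bg (cbounded_conj (@cbounded_chi
    R d k))).
  transitivity (cintegral (fun x => \sum_(k <- box M)
      ((lam k)%:C%C * conjc (fourier g k)) * (g x * conjc (chi k x)))).
    apply: eq_cintegral => x _; rewrite /multop cconj_sum mulr_sumr;
      apply: eq_bigr => k _.
    by rewrite !cconjM cconj_real; ring.
  rewrite cintegral_sum; last by move=> k; exact: cintegrableZ.
  transitivity (\sum_(k <- box M)
      P%:C%C * ((lam k)%:C%C * (fourier g k * conjc (fourier g k))));
        last first.
    rewrite -mulr_sumr rmorphM; congr (_ * _); rewrite rmorph_sum;
      apply: eq_bigr => k _.
    by rewrite mulc_conj -rmorphM.
  apply: eq_bigr => k _; rewrite (cintegralZ _ (ic k)).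
  have -> : cintegral (fun x => g x * conjc (chi k x)) = P%:C%C * fourier g k.
    by rewrite fourierE mulrA -rmorphM mulfV ?gt_eqF ?torus_vol_gt0// rmorph1
      mul1r.
  ring.
have int2 : J (fun x => cabs (multop lam M g x) ^+ 2) = P * S (fun k => lam k
  ^+ 2).
  transitivity (J (fun x => cabs (\sum_(k <- box M) ((lam k)%:C%C * fourier g
    k) * chi k x) ^+ 2)).
    apply: eq_Rintegral => x _; congr (cabs _ ^+ 2); apply: eq_bigr => k _.
    by rewrite mulrA.
  rewrite parseval ?uniq_pbox//; congr (_ * _); apply: eq_bigr => k _.
  by rewrite cabsZ ?exprMn//; case/andP: (lam01 k).
have bg2 := bounded_measurableX 2 (cbounded_cabs bg).
have bT2 := bounded_measurableX 2 (cbounded_cabs bT).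
have bR := bounded_measurableZ (- 2) (cbounded_Re bgT).
have -> : sqdist g (multop lam M g) = J (fun x => cabs (g x) ^+ 2 +
    (- 2 * complex.Re (g x * conjc (multop lam M g x)) + cabs (multop lam M g
      x) ^+ 2)).
  apply: eq_Rintegral => x _;
    rewrite !sqr_cabs cReM cReD cImD cReN cImN cRe_conj cIm_conj.
  ring.
rewrite (JD bg2 (bounded_measurableD bR bT2)) (JD bR bT2) (JZ _ (cbounded_Re
  bgT)) int2.
have -> : J (fun x => complex.Re (g x * conjc (multop lam M g x))) = P * S lam.
  by rewrite -[LHS]/(complex.Re (cintegral _)) int1.
rewrite gerDl mulrCA -mulrDr pmulr_rle0 ?torus_vol_gt0// /S mulr_sumr
  -big_split.
apply: sumr_le0 => k _ /=; rewrite mulrA -mulrDl mulr_le0_ge0 ?sqr_ge0//.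
have /andP[l0 l1] := lam01 k;
  have : lam k ^+ 2 <= lam k by rewrite expr2 ler_piMr.
lra.
Qed.

(** Cauchy-Schwarz on a set of finite measure, in the form [2 u <= e + u^2 / e] with a free
    parameter. *)
Lemma J_le_J2 g e : cbounded g -> 0 < e ->
  J (fun x => cabs (g x)) <= 2^-1 * (e * P + e^-1 * J (fun x => cabs (g x) ^+
    2)).
Proof.
move=> bg e0; have b1 := cbounded_cabs bg; have b2 := bounded_measurableX 2 b1.
have b3 := bounded_measurableZ e^-1 b2.
rewrite -J_cst -(JZ e^-1 b2) -(JD (bounded_measurable_cst e) b3).
have b4 := bounded_measurableD (bounded_measurable_cst e) b3.
rewrite -(JZ _ b4); apply: (le_J b1 (bounded_measurableZ _ b4)) => x _.
set u := cabs (g x); rewrite ler_pdivlMl// -(ler_pM2r e0).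
have -> : (e + e^-1 * u ^+ 2) * e = e ^+ 2 + u ^+ 2 by field; rewrite gt_eqF.
have := sqr_ge0 (u - e); lra.
Qed.

Lemma mixed_mult_notin_box B n M k : (forall j, (n j <= M)%N) -> k \notin box
  M ->
  mixed_mult B n k = 0 :> R.
Proof.
move=> nM; rewrite mem_box negb_forall => /existsP[j]; rewrite -ltnNge => Mk.
by apply: (@mixed_mult_eq0 _ _ _ _ _ j); exact: leq_ltn_trans (nM j) Mk.
Qed.

Lemma mixed_mult_cvg B k e : 0 < e -> exists N, forall n,
  (forall j, (N <= n j)%N) -> 1 - mixed_mult B n k < e :> R.
Proof.
move=> e0; set K : R := \sum_(j < d) `|k j|%:R.
have K0 : 0 <= K by exact: sumr_ge0.
have [N hN] := logsum_unbounded (R := R) ((K + 1) / e).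
exists N => n Nn; apply: le_lt_trans (mixed_mult_ge B n k) _.
have K1 : 0 < K + 1 by rewrite ltr_wpDl.
apply: (@le_lt_trans _ _ (K * (e / (K + 1)))).
  rewrite mulr_suml; apply: ler_sum => j _; rewrite ler_wpM2l//.
  have h := hN _ (Nn j); rewrite -[leRHS]invrK invfM invrK mulrC.
  by rewrite lef_pV2 ?posrE ?logsum_gt0 ?divr_gt0// ltW.
by rewrite mulrCA mulrC gtr_pMl// ltr_pdivrMr// mul1r ltrDl.
Qed.

Lemma multop_ev_cvg B p e : 0 < e -> exists N, forall n M,
  (forall j, (N <= n j)%N) -> (forall j, (n j <= M)%N) ->
  forall x, cabs (multop (mixed_mult B n) M (ev p) x - ev p x) < e.
Proof.
elim: p e => [|t p IH] e e0.
  exists 0%N => n M _ nM x; rewrite multop_ev; last first.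
    by move=> k; exact: mixed_mult_notin_box.
  by rewrite /ev !big_nil subrr cabs0.
have e2 : 0 < e / 2 by rewrite divr_gt0.
have [N1 h1] := IH _ e2.
have t0 : 0 < cabs t.1 + 1 by rewrite ltr_wpDl ?cabs_ge0.
have [N2 h2] := mixed_mult_cvg B t.2 (divr_gt0 e2 t0).
exists (maxn N1 N2) => n M Nn nM x.
have N1n j : (N1 <= n j)%N by rewrite (leq_trans _ (Nn j))// leq_maxl.
have N2n j : (N2 <= n j)%N by rewrite (leq_trans _ (Nn j))// leq_maxr.
have l0 k : k \notin box M -> mixed_mult B n k = 0 :> R.
  exact: mixed_mult_notin_box.
have := h1 n M N1n nM x; rewrite !multop_ev// !ev_multE big_cons.
rewrite /ev big_cons; set U := \sum_(t <- p) _; set V := \sum_(t <- p) _ => UV.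
set l := mixed_mult B n t.2.
have -> : l%:C%C * (t.1 * chi t.2 x) + U - (t.1 * chi t.2 x + V) =
    (l - 1)%:C%C * (t.1 * chi t.2 x) + (U - V).
  by rewrite rmorphB rmorph1; ring.
apply: le_lt_trans (ler_cabsD _ _) _.
rewrite !cabsM cabs_chi mulr1 cabs_real.
have l1 := mixed_mult_le1 B n t.2 (R := R).
rewrite ler0_norm ?subr_le0// opprB.
have := h2 n N2n; rewrite -/l ltr_pdivlMr// mulrDr mulr1.
have : 0 <= 1 - l by rewrite subr_ge0.
by move: UV; set w := cabs (U - V); set y := (1 - l) * _; lra.
Qed.

Lemma multop_cvg_bounded B b e : cbounded b -> 0 < e -> exists N, forall n M,
  (forall j, (N <= n j)%N) -> (forall j, (n j <= M)%N) ->
  J (fun x => cabs (multop (mixed_mult B n) M b x - b x)) < e.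
Proof.
move=> bb e0; have P0 := @torus_vol_gt0 R d.
(* With [dl = e / (2 P)], a uniform error [dl] on the polynomial costs [dl * P = e / 2]. A squared
   error below [dl * (e / 2)] on the remainder costs less than [(e / 2 + e / 2) / 2] by
   [J_le_J2]. *)
have dl0 : 0 < e / (2 * P) by rewrite divr_gt0 ?mulr_gt0.
set dl := e / (2 * P) in dl0.
have de0 : 0 < dl * (e / 2) by rewrite mulr_gt0// divr_gt0.
have [p bp] := (approximable_cbounded bb).2 _ de0.
have [N hN] := multop_ev_cvg B p dl0.
exists N => n M Nn nM; set T := multop (mixed_mult B n) M.
have bg := cboundedB bb (cbounded_ev p).
pose g x := b x - ev p x.
have l01 k : 0 <= (mixed_mult B n k : R) <= 1.
  by rewrite mixed_mult_ge0 mixed_mult_le1.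
have hc := multop_contraction M (bg : cbounded g) l01.
have bT f : cbounded (T f) by exact: cbounded_multop.
have bgT : cbounded (fun x => g x - T g x) := cboundedB bg (bT g).
have bTp := cboundedB (bT (ev p)) (cbounded_ev p).
have b1 := cbounded_cabs bgT; have b2 := cbounded_cabs bTp.
apply: (@le_lt_trans _ _ (J (fun x => cabs (g x - T g x)) +
    J (fun x => cabs (T (ev p) x - ev p x)))).
  rewrite -(JD b1 b2).
  apply: (le_J (cbounded_cabs (cboundedB (bT b) bb)) (bounded_measurableD b1
    b2)) => x _.
  have -> : T b x = T g x + T (ev p) x.
    rewrite /T -multopD; last 2 first.
    - exact: cbounded_integrable bg.
    - exact/cbounded_integrable/cbounded_ev.
    by rewrite /g; under [in RHS]eq_fun do rewrite subrK.
  rewrite -[cabs (g x - T g x)]cabsN; apply: le_trans (ler_cabsD _ _).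
  by rewrite /g le_eqVlt; apply/orP; left; apply/eqP; congr cabs; ring.
apply: (@lt_le_trans _ _ (e / 2 + e / 2)); last by lra.
apply: ltr_leD.
  apply: le_lt_trans (J_le_J2 bgT dl0) _.
  have h1 : dl * P = e / 2 by rewrite /dl; field; rewrite gt_eqF.
  have : dl^-1 * J (fun x => cabs (g x - T g x) ^+ 2) < e / 2.
    by rewrite ltr_pdivrMl//; apply: le_lt_trans bp.
  by rewrite h1; lra.
apply: (@le_trans _ _ (J (fun=> dl))).
  by apply: (le_J b2 (bounded_measurable_cst _)) => x _; exact/ltW/hN.
by rewrite J_cst /dl le_eqVlt; apply/orP; left; apply/eqP; field;
  rewrite gt_eqF.
Qed.

End convergence.

(** * The Orlicz class, truncation and the conclusion *)

Section orlicz.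
Context {R : realType} {d : nat}.
Local Notation C := R[i].
Local Notation X := (Rd R d).
Local Notation D := (@torus R d).
Local Notation mu := (@lebesgue R d).
Implicit Types (f : X -> C) (x : X) (r : nat) (A e : R).

(** Some [k] satisfies the Luxemburg condition; scaling by [s = k / dl] passes from [f / k] to
    [f / dl], and the constant term is integrable on the torus. *)
Lemma log_weight_integrable r f (dl : R) : in_LlogL r f -> 0 < dl ->
  mu.-integrable D (EFin \o (fun x => log_weight r (dl^-1 * cabs (f x)))).
Proof.
move=> [mf /ereal_inf_lt[_ [k [k0 intk] <-] _]] dl0.
have ma := measurable_cabs mf.
pose s := k / dl; have s0 : 0 <= s by rewrite divr_ge0 ?ltW.
pose a := s * (1 + 2 ^+ r * ln (1 + s) ^+ r) * expR 1.
pose b := s * (1 + 2 ^+ r * ln (1 + s) ^+ r + 2 ^+ r).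
pose Q x := LlogL_young r (cabs (f x) / k).
have ls : 0 <= ln (1 + s) by rewrite ln_ge0// lerDl.
have mQ : measurable_fun D Q.
  have mk : measurable_fun D (fun x => cabs (f x) / k).
    exact: (measurable_funM ma (measurable_cst _)).
  have mn : measurable_fun D (fun x => `|cabs (f x) / k|).
    exact: (measurableT_comp (@normr_measurable R setT) mk).
  apply: (measurable_funM mn); apply: measurable_funX.
  apply: (measurableT_comp (@measurable_ln R)).
  exact: (measurable_funD (measurable_cst _) mn).
have Q0 x : 0 <= Q x.
  by rewrite /Q /LlogL_young mulr_ge0 ?exprn_ge0// ln_ge0// lerDl.
have iQ : mu.-integrable D (EFin \o Q).
  apply/integrableP; split; first exact/measurable_EFinP.
  apply: le_lt_trans (ltry 1).
  have -> : (\int[mu]_(x in D) `|(EFin \o Q) x| = \int[mu]_(x in D) (Q x)%:E)%E.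
    by apply: eq_integral => x _ /=; rewrite ger0_norm.
  exact: intk.
have ibQ := integrableZl (@measurable_torus R d) b iQ.
have ia := bounded_measurable_integrable (@bounded_measurable_cst R d a).
have iab := integrableD (@measurable_torus R d) ia ibQ.
apply: (le_integrable (@measurable_torus R d) _ _ iab).
  apply/measurable_EFinP/measurable_log_weight.
  exact: (measurable_funM (measurable_cst _) ma).
move=> x Dx.
have c0 : 0 <= cabs (f x) by exact: cabs_ge0.
have u0 : 0 <= dl^-1 * cabs (f x) by rewrite mulr_ge0// invr_ge0 ltW.
have h : log_weight r (dl^-1 * cabs (f x)) <= a + b * Q x.
  have -> : dl^-1 * cabs (f x) = s * (cabs (f x) / k).
    by rewrite /s; field; rewrite !gt_eqF.
  by apply: log_weight_scale => //; rewrite divr_ge0// ltW.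
rewrite /= lee_fin ger0_norm ?log_weight_ge0//.
exact: le_trans h (ler_norm _).
Qed.

Lemma LlogL_integrable r f : in_LlogL r f -> cintegrable f.
Proof.
move=> hf; apply/cintegrableP; split; first by case: hf.
apply: (le_integrable (@measurable_torus R d) _ _ (log_weight_integrable hf
  ltr01)).
  by apply/measurable_EFinP/measurable_cabs; case: hf.
move=> x _; rewrite /= invr1 mul1r lee_fin.
rewrite !ger0_norm ?cabs_ge0 ?log_weight_ge0 ?cabs_ge0//.
exact/log_weight_ge/cabs_ge0.
Qed.

Definition tail A f x : C := if A < cabs (f x) then f x else 0.

Lemma cmeasurable_tail A f : cmeasurable f -> cmeasurable (tail A f).
Proof.
move=> mf; have ma := measurable_cabs mf.
pose E := D `&` (fun x => cabs (f x)) @^-1` `]A, +oo[%classic.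
have mE : measurable E by exact: ma (@measurable_torus R d) _ (measurable_itv
  _).
have mi : measurable_fun D (\1_E : X -> R) by exact: measurable_indic.
have [m1 m2] := cmeasurableM (cmeasurable_real mi) mf.
have tE x : D x -> tail A f x = (\1_E x)%:C%C * f x.
  move=> Dx; rewrite /tail indicE; case: ifPn => h.
    by rewrite mem_set ?mul1r//; split => //=; rewrite in_itv /= andbT.
  by rewrite memNset ?mul0r// => -[_ /=]; rewrite in_itv /= andbT; exact/negP.
split.
  by apply: (eq_measurable_fun _ _ m1) => x /set_mem Dx; rewrite tE.
by apply: (eq_measurable_fun _ _ m2) => x /set_mem Dx; rewrite tE.
Qed.

Lemma cabs_tail_le A f x : cabs (tail A f x) <= cabs (f x).
Proof. by rewrite /tail; case: ifP => _; rewrite ?cabs0 ?cabs_ge0. Qed.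

(** At each point the tail vanishes once the level reaches [|f x|], and the weight of [f / dl]
    dominates. *)
Lemma log_weight_tail r f (dl e : R) : in_LlogL r f -> 0 < dl -> 0 < e ->
  exists A, \int[mu]_(x in D) log_weight r (dl^-1 * cabs (tail A f x)) < e.
Proof.
move=> hf dl0 e0; have [mf _] := hf.
have di : 0 <= dl^-1 by rewrite invr_ge0 ltW.
have t0 A x : 0 <= dl^-1 * cabs (tail A f x) by rewrite mulr_ge0 ?cabs_ge0.
have mt (m : nat) : measurable_fun D (fun x => log_weight r (dl^-1 * cabs
  (tail m%:R f x))).
  apply: measurable_log_weight; apply: (measurable_funM (measurable_cst _)).
  exact/measurable_cabs/cmeasurable_tail.
have [] := dominated_convergence0 (@measurable_torus R d) mt
  (log_weight_integrable hf dl0) _ _ e0.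
- move=> m x _; rewrite ger0_norm ?log_weight_ge0//.
  by rewrite log_weight_le// ler_wpM2l// cabs_tail_le.
- move=> x _; apply: cvg_near_cst;
  exists (Num.truncn (cabs (f x))).+1 => // m /= xm.
  have fm : cabs (f x) <= m%:R.
    have /andP[_ /ltW/le_trans] := truncn_itv (cabs_ge0 (f x)); apply.
    by rewrite ler_nat.
  by rewrite /tail ltNge fm cabs0 mulr0 /log_weight mul0r.
by move=> m hm; exists m%:R.
Qed.

Lemma log_mean_cvg_L1 (B : {set 'I_d}) f : in_LlogL #|B| f ->
  forall e, 0 < e -> exists N : nat, forall n : 'I_d -> nat, (forall j, (N <=
    n j)%N) ->
    (L1norm (fun x => log_mean B n f x - f x)%R < e%:E)%E.
Proof.
move=> hf e e0; have [K1 [K2 [K10 K20 hK]]] := @L1_multop_le R d #|B|.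
have fi := LlogL_integrable hf; have mf := ((cintegrableP f).1 fi).1.
(* Chosen so that [dl * (K1 + K2) + dl = e / 2]: the first summand will bound [T h], the second [h]
   itself. *)
pose dl := e / 2 / (K1 + K2 + 1).
have KK : 0 < K1 + K2 + 1 by rewrite ltr_wpDl ?addr_ge0.
have dl0 : 0 < dl by rewrite divr_gt0// divr_gt0.
(* The level depends on [dl]; it makes the weight of [h / dl] of integral less than 1. *)
have [A hA] := log_weight_tail hf dl0 ltr01.
pose h := tail A f; pose b x := f x - h x.
have mh : cmeasurable h by exact: cmeasurable_tail.
have bb : cbounded b.
  split; first exact: cmeasurableB.
  exists `|A| => x _; rewrite /b /h /tail; case: ltP => fA.
    by rewrite subrr cabs0.
  by rewrite subr0 (le_trans fA)// ler_norm.
have hi : cintegrable h.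
  apply/cintegrableP; split => //.
  apply: (le_integrable (@measurable_torus R d) _ _ ((cintegrableP f).1 fi).2).
    exact/measurable_EFinP/measurable_cabs.
  by move=> x _; rewrite /= lee_fin !ger0_norm ?cabs_ge0// cabs_tail_le.
have e2 : 0 < e / 2 by rewrite divr_gt0.
have [N hN] := multop_cvg_bounded B bb e2.
(* The threshold [N] comes from the bounded part alone, because the bound for [h] is uniform in [n];
   the cube [M] may therefore depend on [n]. *)
exists N => n Nn; pose M := (\max_j n j)%N.
have nM j : (n j <= M)%N by exact: leq_bigmax.
pose T : (X -> C) -> X -> C := multop (mixed_mult B n) M.
have l0 k : k \notin box M -> mixed_mult B n k = 0 :> R by exact:
  mixed_mult_notin_box.
have bT (g : X -> C) : cbounded (T g) by exact: cbounded_multop.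
have bi := cbounded_integrable bb.
pose h' x := (dl^-1)%:C%C * h x.
have h'i : cintegrable h' by exact: cintegrableZ.
have dli : 0 <= dl^-1 by rewrite invr_ge0 ltW.
have ch' x : cabs (h' x) = dl^-1 * cabs (h x) by rewrite cabsZ.
have mh' := measurable_cabs (cmeasurableZ (dl^-1)%:C%C mh).
have mW := measurable_log_weight #|B| mh'.
pose W x := log_weight #|B| (cabs (h' x)).
have W0 x : 0 <= W x by exact/log_weight_ge0/cabs_ge0.
have Wlt : (\int[mu]_(x in D) (W x)%:E <= 1)%E.
  have iW : mu.-integrable D (EFin \o W).
    apply: (le_integrable (@measurable_torus R d) _ _ (log_weight_integrable
      hf dl0)).
      exact/measurable_EFinP.
    move=> x _; rewrite /= lee_fin !ger0_norm ?log_weight_ge0 ?mulr_ge0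
      ?cabs_ge0//.
    by rewrite /W log_weight_le ?cabs_ge0// ch' ler_wpM2l// cabs_tail_le.
  rewrite -[leLHS]fineK;
    last exact: (integrable_fin_num (@measurable_torus R d) iW).
  rewrite lee_fin; apply: ltW; apply: le_lt_trans hA.
  by rewrite le_eqVlt; apply/orP; left; apply/eqP; apply: eq_Rintegral => x _;
    rewrite /W ch'.
(* Linearity gives [T h = dl * T h'], and the non-homogeneous bound is applied to [h'], whose weight
   has integral at most 1. *)
have hT : (\int[mu]_(x in D) (cabs (T h x))%:E <= (dl * (K1 + K2))%:E)%E.
  have hb m (m0 : (0 < m)%N) := bounded_mult_mixed (R := R) B n m0.
  have := hK _ M h' l0 hb h'i.
  have bT' := cbounded_cabs (bT h').
  have -> : (\int[mu]_(x in D) (cabs (T h x))%:E)%E = (dl * J (fun x => cabs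
    (T h' x)))%:E.
    rewrite -(JZ _ bT') -(EFin_J (bounded_measurableZ dl bT')).
    apply: eq_integral => x _; congr EFin; rewrite /T /h' multopZ// cabsZ//.
    by rewrite mulrA mulfV ?gt_eqF// mul1r.
  move=> hle; rewrite lee_fin ler_pM2l// -lee_fin; apply: le_trans hle _.
  by rewrite EFinD leeD2r// -[leRHS]mule1 lee_wpmul2l.
have hh : (\int[mu]_(x in D) (cabs (h x))%:E <= dl%:E)%E.
  apply: (@le_trans _ _ (\int[mu]_(x in D) (dl%:E * (W x)%:E))%E).
    apply: (@ge0_le_integral _ _ _ mu D (@measurable_torus R d)).
    - by move=> x _; rewrite lee_fin cabs_ge0.
    - exact/measurable_EFinP/measurable_cabs.
    - by apply: measurable_funeM; exact/measurable_EFinP.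
    move=> x _; rewrite -EFinM lee_fin -ler_pdivrMl// -ch'.
    exact/log_weight_ge/cabs_ge0.
  rewrite ge0_integralZl_EFin.
  - by rewrite -[leRHS]mule1 lee_wpmul2l// lee_fin ltW.
  - exact: measurable_torus.
  - by move=> x _; rewrite lee_fin.
  - exact/measurable_EFinP.
  - exact: ltW.
have bTb := cboundedB (bT b) bb.
have hTb : J (fun x => cabs (T b x - b x)) < e / 2 := hN n M Nn nM.
have mTf : cmeasurable (fun x => log_mean B n f x - f x).
  have -> : (fun x => log_mean B n f x - f x) = (fun x => T f x - f x).
    by apply/funext => x; rewrite (log_meanE B f x nM).
  exact: (cmeasurableB (bT f).1 mf).
rewrite /L1norm; apply: (@le_lt_trans _ _ (\int[mu]_(x in D) (cabs (T b x - b
  x))%:E +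
    \int[mu]_(x in D) (cabs (T h x))%:E + \int[mu]_(x in D) (cabs (h x))%:E)%E).
  have c0 (g : X -> C) x : D x -> 0 <= cabs (g x) by move=> _; exact: cabs_ge0.
  apply: (ge0_integral_le3 mu (@measurable_torus R d) (measurable_cabs mTf)
    (measurable_cabs bTb.1) (measurable_cabs (bT h).1) (measurable_cabs mh)
    (c0 _) (c0 _) (c0 _) (c0 _)) => x _.
  rewrite (log_meanE B f x nM) -/T.
  have -> : T f x = T b x + T h x.
    by rewrite /T -multopD// /b; under [in RHS]eq_fun do rewrite subrK.
  have -> : T b x + T h x - f x = (T b x - b x) + T h x - h x.
    by rewrite /b; ring.
  by apply: le_trans (ler_cabsB _ _) _; rewrite lerD2r ler_cabsD.
rewrite (EFin_J (cbounded_cabs bTb)).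
apply: (@le_lt_trans _ _ ((J (fun x => cabs (T b x - b x)) + dl * (K1 + K2) +
  dl)%:E)).
  by rewrite !EFinD leeD// leeD.
rewrite lte_fin.
have : dl * (K1 + K2) + dl = e / 2.
  by rewrite -{2}[dl]mulr1 -mulrDr /dl mulfVK// gt_eqF.
by move: hTb; move: (J (fun x => cabs (T b x - b x))) => j; lra.
Qed.

End orlicz.

Theorem theorem2 (R : realType) (d : nat) (hd : (1 <= d)%N)
    (B : {set 'I_d}) (hB : B != finset.set0)
    (f : Rd R d -> R[i]) (hf : in_LlogL #|B| f) :
  forall eps : R, 0 < eps ->
    exists N : nat, forall n : 'I_d -> nat, (forall j, (N <= n j)%N) ->
      (L1norm (fun x => log_mean B n f x - f x)%R < eps%:E)%E.
Proof. exact: log_mean_cvg_L1 hf. Qed.
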